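(* Let $k\ge3$. On a cuboid cell $T$ let $\boldsymbol\Xi_T$ be the space of traceless matrix fields $\boldsymbol\tau$ with $\tau_{ii}\in\mathcal Q_{k-1,k-1,k-1}$ for each $i$, and $\tau_{ij}\in\mathcal Q(i{:}k-2,j{:}k,l{:}k-1)$ for $i\neq j$. The following degrees of freedom are unisolvent for $\boldsymbol\Xi_T$. For the diagonal $(\tau_{11},\tau_{22},\tau_{33})$: (a) the values of $\tau_{11},\tau_{22},\tau_{33}$ at each vertex; (b) moments of $\tau_{11},\tau_{22},\tau_{33}$ on each edge against polynomials of degree $\le k-3$ in the edge variable; (c) for each $i$, moments of $\tau_{ii}$ on each face $F_{jl}$ (normal to the $x_i$-direction) against $\mathcal Q(j{:}k-3,l{:}k-3)$; (d) $\int_T(\tau_{11}\xi_1+\tau_{22}\xi_2+\tau_{33}\xi_3)$ for all $(\xi_1,\xi_2,\xi_3)\in\mathcal B(T)$. (In (a) and (b), since $\tau_{11}+\tau_{22}+\tau_{33}=0$, only two of the three listed functionals are counted at each vertex and for each edge test function.) For each off-diagonal entry $\tau_{ij}$, $i\neq j$: (a) moments of $\tau_{ij}$ on each face $F_{il}$ against $\mathcal Q(i{:}k-2,l{:}k-1)$; (b) moments of $\tau_{ij}$ on $T$ against $\mathcal Q(i{:}k-2,j{:}k-2,l{:}k-1)$. Moreover, the resulting finite element space $\widetilde{\boldsymbol\Xi}_h$ on $\mathcal T_h$ is $\boldsymbol H(\operatorname{div};\mathbb T)$ conforming, i.e. $\widetilde{\boldsymbol\Xi}_h\subset\boldsymbol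 H(\operatorname{div},\Omega;\mathbb T)$.
   Context: Coordinates are $(x_1,x_2,x_3)=(x,y,z)$. Whenever indices $i,j,l$ occur together they are pairwise distinct, i.e. $\{i,j,l\}=\{1,2,3\}$. $\mathcal Q(i{:}a,j{:}b,l{:}c)$ is the space of polynomials of degree at most $a$ in $x_i$, at most $b$ in $x_j$ and at most $c$ in $x_l$ (separately); similarly with fewer variables on faces and edges. $\mathcal Q_{a,b,c}=\mathcal Q(1{:}a,2{:}b,3{:}c)$. $\mathcal B(T)$ is the space of triples $(\xi_1,\xi_2,\xi_3)\in(\mathcal Q_{k-1,k-1,k-1})^3$ with $\xi_1+\xi_2+\xi_3=0$ and such that, for each $i$, $\xi_i$ vanishes on the two faces of $T$ normal to the $x_i$-direction. $\mathbb T$ is the space of traceless real $3\times3$ matrices; $\operatorname{div}$ acts row-wise on matrix fields; $\boldsymbol H(\operatorname{div},\Omega;\mathbb T)=\{\boldsymbol v\in L^2(\Omega;\mathbb T):\operatorname{div}\boldsymbol v\in L^2(\Omega;\mathbb R^3)\}$. $\Omega\subset\mathbb R^3$ is a contractible domain with Lipschitz boundary, partitioned by a (face-to-face) mesh $\mathcal T_h$ of axis-parallel cuboids. $F_{ij}=F_{ji}$ denotes a face parallel to the $x_i$- and $x_j$-axes. ''Moments of $f$ on $G$ against $P$'' means the functionals $\int_G f\,p$, $p\in P$ (with $p$ running over a basis of $P$ when counting). Degrees of freedom are unisolvent for a shape function space if they form a basis of its dual space. The resulting finite element space consists of all fields on $\Omega$ whose restriction to each cell is in the shape function space and such that each degree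 of freedom attached to a vertex, edge or face has the same value from all cells containing that vertex, edge or face. *)

(* Defs.v *)
From HB Require Import structures.
From mathcomp Require Import all_boot all_order all_algebra.
From mathcomp Require Import all_classical all_reals all_analysis.
Set Implicit Arguments.
Unset Strict Implicit.
Unset Printing Implicit Defensive.
Import Order.TTheory GRing.Theory Num.Theory.
Import numFieldNormedType.Exports.
Local Open Scope classical_set_scope.
Local Open Scope ring_scope.

(* Points of R^3 are triples, so that the library's topology, normed module
   structure, product sigma-algebra and product Lebesgue measure apply.
   Coordinates are indexed by 'I_3 (0, 1, 2 standing for 1, 2, 3); the two
   indices other than i are ordS i and ord_pred i. *)
Notation R3 R := (R * R * R)%type.

Notation leb1 R := (@lebesgue_measure R).
Notation leb2 R := (leb1 R \x leb1 R)%E.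
Notation leb3 R := (leb2 R \x leb1 R)%E.

Definition crd (R : realType) (x : R3 R) (i : 'I_3) : R :=
  if val i == 0%N then x.1.1 else if val i == 1%N then x.1.2 else x.2.

Definition pt (R : realType) (u : 'I_3 -> R) : R3 R :=
  (u (inord 0), u (inord 1), u (inord 2)).

(* The point with x_i = s, x_(ordS i) = t and x_(ord_pred i) = u. *)
Definition pt3 (R : realType) (i : 'I_3) (s t u : R) : R3 R :=
  pt (fun m => if m == i then s else if m == ordS i then t else u).

Definition unitv (R : realType) (i : 'I_3) : R3 R := pt3 i 1 0 0.

(* Q d is the space of polynomials of degree at most d i in x_i, for each i.
   Polynomials in fewer variables have degree 0 in the missing ones. *)
Definition Q (R : realType) (d : 'I_3 -> nat) : set (R3 R -> R) :=
  [set f | exists c : nat -> nat -> nat -> R, forall x : R3 R,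
     f x = \sum_(a < (d (inord 0)).+1) \sum_(b < (d (inord 1)).+1)
           \sum_(e < (d (inord 2)).+1)
             c a b e * crd x (inord 0) ^+ a * crd x (inord 1) ^+ b
                     * crd x (inord 2) ^+ e].

(* The degrees (i:a, j:b, l:c), where {i, j, l} = {1, 2, 3}. *)
Definition deg3 (i : 'I_3) (a : nat) (j : 'I_3) (b c : nat) : 'I_3 -> nat :=
  fun m => if m == i then a else if m == j then b else c.

Section Bases.
Variables (R : realType) (V : lmodType R).

Definition is_basis (X : set V) (s : seq V) : Prop :=
  (forall n : 'I_(size s), X s`_n) /\
  (forall v, X v ->
     exists! c : 'rV[R]_(size s), v = \sum_(n < size s) c 0 n *: s`_n).

Definition linear_on (X : set V) (f : V -> R) : Prop :=
  forall (a : R) (u v : V), X u -> X v -> f (a *: u + v) = a * f u + f v.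

(* s is a basis of the dual space of X, functionals on X being identified when
   they agree on X. *)
Definition unisolvent (X : set V) (s : seq (V -> R)) : Prop :=
  (forall n : 'I_(size s), linear_on X s`_n) /\
  (forall f, linear_on X f ->
     exists! c : 'rV[R]_(size s),
       forall v, X v -> f v = \sum_(n < size s) c 0 n * s`_n v).

End Bases.

Record cuboid (R : realType) := Cuboid {
  lo : 'I_3 -> R;
  hi : 'I_3 -> R;
  lo_lt_hi : forall i, lo i < hi i }.

Section Cell.
Variables (R : realType) (T : cuboid R).

Definition cell : set (R3 R) := [set x | forall i, lo T i <= crd x i <= hi T i].

Definition open_cell : set (R3 R) :=
  [set x | forall i, lo T i < crd x i < hi T i].

Definition bnd (i : 'I_3) (b : bool) : R := if b then hi T i else lo T i.

(* An edge is given by its direction i and by the two sides on which it lies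
   with respect to ordS i and ord_pred i; a face by its normal direction and
   its side. *)
Definition vert_ix : Type := (bool * bool * bool)%type.
Definition edge_ix : Type := ('I_3 * bool * bool)%type.
Definition face_ix : Type := ('I_3 * bool)%type.

Definition vertex (v : vert_ix) : R3 R :=
  (bnd (inord 0) v.1.1, bnd (inord 1) v.1.2, bnd (inord 2) v.2).

Definition edge_dir (e : edge_ix) : 'I_3 := e.1.1.
Definition face_normal (F : face_ix) : 'I_3 := F.1.

Definition edge_pt (e : edge_ix) (t : R) : R3 R :=
  pt3 (edge_dir e) t (bnd (ordS (edge_dir e)) e.1.2)
                     (bnd (ord_pred (edge_dir e)) e.2).

Definition face_pt (F : face_ix) (u : R * R) : R3 R :=
  pt3 (face_normal F) (bnd (face_normal F) F.2) u.1 u.2.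

Definition edge_dom (e : edge_ix) : set R :=
  `[lo T (edge_dir e), hi T (edge_dir e)].

Definition face_dom (F : face_ix) : set (R * R) :=
  `[lo T (ordS F.1), hi T (ordS F.1)] `*`
  `[lo T (ord_pred F.1), hi T (ord_pred F.1)].

Definition edge (e : edge_ix) : set (R3 R) := edge_pt e @` edge_dom e.
Definition face (F : face_ix) : set (R3 R) := face_pt F @` face_dom F.

Definition edge_moment (e : edge_ix) (f p : R3 R -> R) : R :=
  \int[leb1 R]_(t in edge_dom e) (f (edge_pt e t) * p (edge_pt e t)).

Definition face_moment (F : face_ix) (f p : R3 R -> R) : R :=
  \int[leb2 R]_(u in face_dom F) (f (face_pt F u) * p (face_pt F u)).

Definition cell_moment (f p : R3 R -> R) : R :=
  \int[leb3 R]_(x in cell) (f x * p x).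

End Cell.

Definition entry (R : realType) (tau : R3 R -> 'M[R]_3) (i j : 'I_3) :
  R3 R -> R := fun x => tau x i j.

(* Polynomial fields are taken on all of R^3: a polynomial is determined by its
   restriction to a cell, so this space does not depend on the cell. *)
Definition Xi (R : realType) (k : nat) : set (R3 R -> 'M[R]_3) :=
  [set tau | [/\ forall x, \tr (tau x) = 0,
     forall i, Q (fun=> (k - 1)%N) (entry tau i i) &
     forall i j, i != j ->
       Q (deg3 i (k - 2) j k (k - 1)) (entry tau i j)]].

Definition Bub (R : realType) (k : nat) (T : cuboid R) :
  set (R3 R -> 'rV[R]_3) :=
  [set xi | [/\ forall i, Q (fun=> (k - 1)%N) (fun x => xi x 0 i),
     forall x, \sum_i xi x 0 i = 0 &
     forall (i : 'I_3) (b : bool) x, face T (i, b) x -> xi x 0 i = 0]].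

Definition bub_moment (R : realType) (T : cuboid R)
  (tau : R3 R -> 'M[R]_3) (xi : R3 R -> 'rV[R]_3) : R :=
  \int[leb3 R]_(x in cell T) (\sum_i tau x i i * xi x 0 i).

Definition edge_test (R : realType) (k : nat) (e : edge_ix) :
  set (R3 R -> R) :=
  Q (fun m => if m == edge_dir e then (k - 3)%N else 0%N).

Definition diag_face_test (R : realType) (k : nat) (F : face_ix) :
  set (R3 R -> R) :=
  Q (fun m => if m == face_normal F then 0%N else (k - 3)%N).

(* For the entry (i, j) on faces normal to x_j. *)
Definition off_face_test (R : realType) (k : nat) (i j : 'I_3) :
  set (R3 R -> R) := Q (deg3 i (k - 2) j 0 (k - 1)).

Definition off_cell_test (R : realType) (k : nat) (i j : 'I_3) :
  set (R3 R -> R) := Q (deg3 i (k - 2) j (k - 2) (k - 1)).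

(* The choices left open when the degrees of freedom are counted: bases of the
   test spaces, and which of the three (dependent) diagonal functionals is left
   out at each vertex and for each edge test function. *)
Record dof_choice (R : realType) (k : nat) (T : cuboid R) := DofChoice {
  vert_omit : vert_ix -> 'I_3;
  edge_basis : edge_ix -> seq (R3 R -> R);
  edge_basisP : forall e, is_basis (edge_test k e) (edge_basis e);
  edge_omit : edge_ix -> (R3 R -> R) -> 'I_3;
  diag_face_basis : face_ix -> seq (R3 R -> R);
  diag_face_basisP : forall F,
    is_basis (diag_face_test k F) (diag_face_basis F);
  bub_basis : seq (R3 R -> 'rV[R]_3);
  bub_basisP : is_basis (Bub k T) bub_basis;
  off_face_basis : 'I_3 -> face_ix -> seq (R3 R -> R);
  off_face_basisP : forall i F, i != face_normal F ->
    is_basis (off_face_test k i (face_normal F)) (off_face_basis i F);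
  off_cell_basis : 'I_3 -> 'I_3 -> seq (R3 R -> R);
  off_cell_basisP : forall i j, i != j ->
    is_basis (off_cell_test k i j) (off_cell_basis i j) }.

Section Dofs.
Variables (R : realType) (k : nat) (T : cuboid R) (D : dof_choice k T).

Definition all_but (i0 : 'I_3) : seq 'I_3 := [seq i <- enum 'I_3 | i != i0].

Definition vertex_dofs : seq ((R3 R -> 'M[R]_3) -> R) :=
  [seq (fun tau => entry tau i i (vertex T v)) |
     v <- enum {: bool * bool * bool}, i <- all_but (vert_omit D v)].

Definition edge_dofs : seq ((R3 R -> 'M[R]_3) -> R) :=
  flatten [seq
    [seq (fun tau => edge_moment T e (entry tau i i) p) |
       p <- edge_basis D e, i <- all_but (edge_omit D e p)]
    | e <- enum {: 'I_3 * bool * bool}].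

Definition diag_face_dofs : seq ((R3 R -> 'M[R]_3) -> R) :=
  [seq (fun tau => face_moment T F
                     (entry tau (face_normal F) (face_normal F)) p) |
     F <- enum {: 'I_3 * bool}, p <- diag_face_basis D F].

Definition bub_dofs : seq ((R3 R -> 'M[R]_3) -> R) :=
  [seq (fun tau => bub_moment T tau xi) | xi <- bub_basis D].

Definition off_face_dofs (i j : 'I_3) : seq ((R3 R -> 'M[R]_3) -> R) :=
  [seq (fun tau => face_moment T (j, b) (entry tau i j) p) |
     b <- enum {: bool}, p <- off_face_basis D i (j, b)].

Definition off_cell_dofs (i j : 'I_3) : seq ((R3 R -> 'M[R]_3) -> R) :=
  [seq (fun tau => cell_moment T (entry tau i j) p) |
     p <- off_cell_basis D i j].

Definition dofs : seq ((R3 R -> 'M[R]_3) -> R) :=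
  vertex_dofs ++ edge_dofs ++ diag_face_dofs ++ bub_dofs ++
  flatten [seq off_face_dofs i j ++ off_cell_dofs i j |
             i <- enum 'I_3, j <- all_but i].

End Dofs.

Section Domain.
Variables (R : realType) (Omega : set (R3 R)).

Definition contractible : Prop :=
  exists (p : R3 R) (H : R * R3 R -> R3 R),
    [/\ Omega p,
        {within `[0, 1]%classic `*` Omega, continuous H},
        forall t x, `[0, 1]%classic t -> Omega x -> Omega (H (t, x)) &
        forall x, Omega x -> H (0, x) = x /\ H (1, x) = p].

(* Near each boundary point p, in suitable orthonormal coordinates y centred
   at p, Omega is the set of points lying below the graph of a Lipschitz
   function of (y_1, y_2). *)
Definition lipschitz_boundary : Prop :=
  forall p, (closure Omega `\` interior Omega) p ->
    exists (A : 'M[R]_3) (g : R * R -> R),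
      [/\ A *m A^T = 1%:M, [lipschitz g y | y in setT] &
          \forall x \near p,
            let y i := \sum_j A i j * crd (x - p) j in
            Omega x <-> y (inord 2) < g (y (inord 0), y (inord 1))].

Definition lipschitz_domain : Prop :=
  [/\ open Omega, connected Omega & lipschitz_boundary].

Variables (N : nat) (K : 'I_N -> cuboid R).

(* Conforming (face-to-face) partition of Omega into finitely many cells. *)
Definition cuboid_mesh : Prop :=
  [/\ closure Omega = \bigcup_m cell (K m),
      forall m n, m != n -> open_cell (K m) `&` open_cell (K n) = set0 &
      forall m n, m != n -> let G := cell (K m) `&` cell (K n) in
        [\/ G = set0,
            exists v w, G = [set vertex (K m) v] /\ G = [set vertex (K n) w],
            exists d e, G = edge (K m) d /\ G = edge (K n) e |
            exists E F, G = face (K m) E /\ G = face (K n) F]].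

End Domain.

Section FESpace.
Variables (R : realType) (k N : nat) (K : 'I_N -> cuboid R).

(* The degrees of freedom attached to a common vertex, edge or face of two
   cells take the same value on the cellwise polynomials tau m. *)
Definition vertex_match (tau : 'I_N -> R3 R -> 'M[R]_3) : Prop :=
  forall m n v w, vertex (K m) v = vertex (K n) w ->
  forall i, entry (tau m) i i (vertex (K m) v)
          = entry (tau n) i i (vertex (K n) w).

Definition edge_match (tau : 'I_N -> R3 R -> 'M[R]_3) : Prop :=
  forall m n d e, edge (K m) d = edge (K n) e ->
  forall i p, edge_test k d p ->
    edge_moment (K m) d (entry (tau m) i i) p
  = edge_moment (K n) e (entry (tau n) i i) p.

Definition face_match (tau : 'I_N -> R3 R -> 'M[R]_3) : Prop :=
  forall m n E F, face (K m) E = face (K n) F ->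
  let j := face_normal E in
  (forall p, diag_face_test k E p ->
     face_moment (K m) E (entry (tau m) j j) p
   = face_moment (K n) F (entry (tau n) j j) p) /\
  (forall i p, i != j -> off_face_test k i j p ->
     face_moment (K m) E (entry (tau m) i j) p
   = face_moment (K n) F (entry (tau n) i j) p).

(* Fields are determined up to their (irrelevant) values on the mesh skeleton,
   where normal traces from different cells agree but other entries jump. *)
Definition Xi_h : set (R3 R -> 'M[R]_3) :=
  [set v | exists tau : 'I_N -> R3 R -> 'M[R]_3,
     [/\ forall m, Xi k (tau m),
         forall m x, open_cell (K m) x -> v x = tau m x,
         vertex_match tau, edge_match tau & face_match tau]].

End FESpace.

Section Hdiv.
Variables (R : realType) (Omega : set (R3 R)).

Definition partial (i : 'I_3) (f : R3 R -> R) : R3 R -> R :=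
  fun x => 'D_(unitv R i) f x.

Definition smooth (f : R3 R -> R) : Prop :=
  forall s : seq 'I_3, let g := foldr partial f s in
    continuous g /\ forall i x, derivable g x (unitv R i).

Definition test_function (phi : R3 R -> R) : Prop :=
  [/\ smooth phi, compact (closure [set x | phi x != 0]) &
      closure [set x | phi x != 0] `<=` Omega].

(* Functions on Omega are extended by zero. *)
Definition L2 (f : R3 R -> R) : Prop := (f \_ Omega) \in Lfun (leb3 R) 2%:E.

(* w is the row-wise distributional divergence of v on Omega. *)
Definition weak_div (v : R3 R -> 'M[R]_3) (w : R3 R -> 'rV[R]_3) : Prop :=
  forall phi, test_function phi -> forall i,
    \int[leb3 R]_(x in Omega) (\sum_j (v x i j * partial j phi x))
  = - \int[leb3 R]_(x in Omega) (w x 0 i * phi x).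

(* Elements of L^2 are classes for almost everywhere equality, hence the
   (Borel measurable) representative g of v. *)
Definition Hdiv : set (R3 R -> 'M[R]_3) :=
  [set v | exists (g : R3 R -> 'M[R]_3) (w : R3 R -> 'rV[R]_3),
     [/\ {ae leb3 R, forall x, Omega x -> v x = g x /\ \tr (g x) = 0},
         forall i j, L2 (entry g i j),
         forall i, L2 (fun x => w x 0 i) &
         weak_div g w]].

End Hdiv.

(* Main.v *)
(* Unisolvence needs no dimension count: the degrees of freedom separate the
   shape functions, and they are independent, because each block of them (at
   vertices, then on edges, on faces, in the interior) is tested nondegenerately
   by fields built from bubble and hat functions on which all previous blocks
   vanish.  Every nondegeneracy is the positivity of an integral of w p^2 with
   w > 0 in the interior.  A separating independent finite family has a dual
   basis, hence is a basis of the dual space.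

   Conformity: the same arguments on a single face show that the normal
   components tau_ij on a face normal to x_j are determined by the degrees of
   freedom attached to that face, so they agree from both sides.  Integrating
   d_j(tau_ij phi) over each open cell by Fubini and the fundamental theorem of
   calculus leaves fluxes through faces.  If phi does not vanish on an open face,
   the face meets the open set Omega, and face-to-face conformity of the mesh
   provides exactly one cell on the other side, whose flux cancels. *)

(* Unisolvence of the degrees of freedom and conformity of the space *)
Require Import Defs.
From HB Require Import structures.
From mathcomp Require Import all_boot all_order all_algebra.
From mathcomp Require Import all_classical all_reals all_analysis.
From mathcomp Require Import measurable_realfun.
From mathcomp Require Import zify ring lra.
Set Implicit Arguments.
Unset Strict Implicit.
Unset Printing Implicit Defensive.
Import Order.TTheory GRing.Theory Num.Theory.
Import numFieldNormedType.Exports.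
Local Open Scope classical_set_scope.
Local Open Scope ring_scope.

(** * Dual bases *)

Section DualBases.
Variables (R : realType) (V : lmodType R).
Implicit Types (X Y : set V) (s : seq (V -> R)).

(** The test bases and the omitted diagonal entries are arbitrary data, so independence is
    formulated relative to a set of fields, and each block is tested inside the common kernel of the
    preceding ones. The degrees fit exactly: a bubble costs two degrees and a hat one, whence k-1 =
    2 + (k-3) for diagonal entries on edges and faces, and k = 2 + (k-2) for off-diagonal entries in
    the cell. The trace constraint excludes fields with a single nonzero diagonal entry; test fields
    carry g in one entry and -g in another, placed where the functionals under consideration do not
    see it. The entry omitted on an edge may vary with the test function, which forces a dual family
    of edge polynomials there instead of a plain nondegeneracy argument. For conformity, a field is
    arbitrary on the mesh skeleton and is replaced by the representative that is zero there. The
    mesh gives the closure of Omega as the union of the closed cells; passing between integrals over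
    Omega and over open cells rests on the test function vanishing outside Omega. *)

Definition subspace_closed X :=
  X 0 /\ forall (a : R) u v, X u -> X v -> X (a *: u + v).

Definition kills s (v : V) := forall f, f \in s -> f v = 0.

(** Coefficients are indexed by [nat] rather than by ['I_(size s)], so that splitting a
    concatenation only shifts an index. *)
Definition indep X s := forall c : nat -> R,
  (forall v, X v -> \sum_(n < size s) c n * s`_n v = 0) ->
  forall n, (n < size s)%N -> c n = 0.

Lemma subspace_sum X n (c : nat -> R) (w : nat -> V) :
  subspace_closed X -> (forall i, (i < n)%N -> X (w i)) ->
  X (\sum_(i < n) c i *: w i).
Proof.
move=> [X0 XD]; elim: n => [|n IH] Xw; first by rewrite big_ord0.
rewrite big_ord_recr /= addrC; apply: XD; first exact: Xw.
by apply: IH => i lin; apply: Xw; exact: ltnW.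
Qed.

Lemma linear_on0 X (f : V -> R) : subspace_closed X -> linear_on X f -> f 0 = 0.
Proof.
move=> [X0 _] fL; have := fL 1 0 0 X0 X0.
by rewrite scaler0 addr0 mul1r => /eqP; rewrite addrC -subr_eq subrr eq_sym => /eqP.
Qed.

Lemma linear_on_sum X (f : V -> R) n (c : nat -> R) (w : nat -> V) :
  subspace_closed X -> linear_on X f -> (forall i, (i < n)%N -> X (w i)) ->
  f (\sum_(i < n) c i *: w i) = \sum_(i < n) c i * f (w i).
Proof.
move=> XS fL; elim: n => [|n IH] Xw; first by rewrite !big_ord0 (linear_on0 XS).
rewrite !big_ord_recr /= addrC fL; last 2 first.
- exact: Xw.
- by apply: (@subspace_sum X _ c w XS) => i lin; apply: Xw; exact: ltnW.
by rewrite addrC IH// => i lin; apply: Xw; exact: ltnW.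
Qed.

Lemma indep_cat_split (s1 s2 : seq (V -> R)) (c : nat -> R) v :
  \sum_(n < size (s1 ++ s2)) c n * (s1 ++ s2)`_n v =
  \sum_(n < size s1) c n * s1`_n v +
  \sum_(n < size s2) c (size s1 + n)%N * s2`_n v.
Proof.
rewrite -(big_mkord xpredT (fun n => c n * (s1 ++ s2)`_n v)).
rewrite (big_cat_nat (n := size s1))//= ?size_cat ?leq_addr//; congr (_ + _).
  by rewrite big_mkord; apply: eq_bigr => i _; rewrite nth_cat ltn_ord.
rewrite -{1}[size s1]add0n big_addn addKn big_mkord; apply: eq_bigr => i _.
by rewrite nth_cat addnC ltnNge leq_addr /= addnC addnK.
Qed.

Lemma kills_sum0 s (c : nat -> R) v : kills s v ->
  \sum_(n < size s) c n * s`_n v = 0.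
Proof.
by move=> sv; rewrite big1// => n _; rewrite sv ?mulr0 ?mem_nth.
Qed.

(** Block-triangular argument: on [Y] a relation loses its [s1] part, which settles the coefficients
    of [s2]; those of [s1] are then settled on all of [X]. *)
Lemma indep_cat_r X Y s1 s2 : Y `<=` X -> (forall v, Y v -> kills s1 v) ->
  indep Y s2 -> indep X s1 -> indep X (s1 ++ s2).
Proof.
move=> YX k1 i2 i1 c c0.
have c2 n : (n < size s2)%N -> c (size s1 + n)%N = 0.
  apply: i2 (fun n => c (size s1 + n)%N) _ n => v Yv.
  by have := c0 v (YX _ Yv); rewrite indep_cat_split (kills_sum0 _ (k1 _ Yv)) add0r.
have c1 n : (n < size s1)%N -> c n = 0.
  apply: i1 => v Xv; have := c0 v Xv; rewrite indep_cat_split.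
  by rewrite [X in _ + X]big1 ?addr0// => i _; rewrite c2 ?mul0r.
move=> n; rewrite size_cat; case: (ltnP n (size s1)) => [/c1//|le ltn].
by rewrite -(subnKC le) c2// ltn_subLR.
Qed.

Lemma indep_cat_l X Y s1 s2 : Y `<=` X -> (forall v, Y v -> kills s2 v) ->
  indep Y s1 -> indep X s2 -> indep X (s1 ++ s2).
Proof.
move=> YX k2 i1 i2 c c0.
have c1 n : (n < size s1)%N -> c n = 0.
  apply: i1 => v Yv.
  by have := c0 v (YX _ Yv); rewrite indep_cat_split (@kills_sum0 s2 (fun n => c (size s1 + n)%N) v (k2 _ Yv)) addr0.
have c2 n : (n < size s2)%N -> c (size s1 + n)%N = 0.
  apply: i2 (fun n => c (size s1 + n)%N) _ n => v Xv.
  have := c0 v Xv; rewrite indep_cat_split.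
  by rewrite big1 ?add0r// => i _; rewrite c1 ?mul0r.
move=> n; rewrite size_cat; case: (ltnP n (size s1)) => [/c1//|le ltn].
by rewrite -(subnKC le) c2// ltn_subLR.
Qed.

Lemma indep_nil X : indep X [::].
Proof. by []. Qed.

(** Block-diagonal argument: [Y e] is a set of test vectors seen by the block of [e] alone. *)
Lemma indep_flatten (E : eqType) (S : E -> seq (V -> R)) (es : seq E) X
    (Y : E -> set V) : uniq es ->
  (forall e, e \in es -> Y e `<=` X) ->
  (forall e, e \in es -> indep (Y e) (S e)) ->
  (forall e e', e \in es -> e' \in es -> e != e' ->
     forall v, Y e v -> kills (S e') v) ->
  indep X (flatten [seq S e | e <- es]).
Proof.
elim: es => [|e es IH] /=; first by move=> *; exact: indep_nil.
move=> /andP[ees ues] YX iY kY; apply: (@indep_cat_l X (Y e)).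
- by apply: YX; rewrite mem_head.
- move=> v Yv f /flattenP[/= t /mapP[e' e'es ->]]; apply: kY Yv f.
  + exact: mem_head.
  + by rewrite inE e'es orbT.
  + by apply: contraNneq ees => ->.
- by apply: iY; rewrite mem_head.
- apply: IH => //.
  + by move=> e' e'es; apply: YX; rewrite inE e'es orbT.
  + by move=> e' e'es; apply: iY; rewrite inE e'es orbT.
  + by move=> e1 e2 e1es e2es; apply: kY; rewrite inE ?e1es ?e2es orbT.
Qed.

Lemma indep_map (E : eqType) (g : E -> V -> R) (es : seq E) X : uniq es ->
  (forall e, e \in es -> exists2 v, X v &
     g e v != 0 /\ forall e', e' \in es -> e != e' -> g e' v = 0) ->
  indep X [seq g e | e <- es].
Proof.
move=> ues gX.
have -> : [seq g e | e <- es] = flatten [seq [:: g e] | e <- es].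
  by elim: es {ues gX} => //= e es ->.
pose Y e : set V := [set v | [/\ X v, g e v != 0 &
  forall e', e' \in es -> e != e' -> g e' v = 0]].
apply: (@indep_flatten _ _ _ _ Y) => //.
- by move=> e _ v [].
- move=> e /gX[v Xv [ev e'v]] c c0 [|]//= _.
  have : Y e v by split.
  by move/c0; rewrite big_ord1 /= => /eqP; rewrite mulf_eq0 (negbTE ev) orbF => /eqP.
- by move=> e e' ees e'es ee' v [_ _ h] f; rewrite inE => /eqP ->; exact: h.
Qed.

(** Induction on the family. The dual vectors of [s] project onto its common kernel; the new
    functional [f] is nonzero somewhere on that kernel, which provides its dual vector, and the old
    vectors are corrected by multiples of it. *)
Lemma dual_basis X s : subspace_closed X ->
  (forall f, f \in s -> linear_on X f) -> indep X s ->
  exists w : nat -> V, forall m, (m < size s)%N -> X (w m) /\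
    forall n, (n < size s)%N -> s`_n (w m) = (n == m)%:R.
Proof.
move=> XS; elim/last_ind: s => [|s f IH] sL si; first by exists (fun=> 0).
have sL' g : g \in s -> linear_on X g.
  by move=> gs; apply: sL; rewrite mem_rcons inE gs orbT.
have fL : linear_on X f by apply: sL; rewrite mem_rcons mem_head.
have si' : indep X s.
  move=> c c0 n ns; pose c' m := if (m < size s)%N then c m else 0.
  have := si c' _ n; rewrite /c' ns size_rcons; apply; last exact: ltnW.
  move=> v Xv; rewrite big_ord_recr /= ltnn mul0r addr0 -[RHS](c0 v Xv).
  by apply: eq_bigr => i _; rewrite ltn_ord nth_rcons ltn_ord.
have [w wP] := IH sL' si'.
pose proj v := v - \sum_(m < size s) s`_m v *: w m.
have Xproj v : X v -> X (proj v).
  move=> Xv; rewrite /proj -scaleN1r addrC; apply: XS.2 => //.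
  by apply: (@subspace_sum X _ (fun m => s`_m v) w XS) => i /wP[].
have linproj g v : linear_on X g -> X v ->
    g (proj v) = g v - \sum_(m < size s) s`_m v * g (w m).
  move=> gL Xv; rewrite /proj addrC -scaleN1r gL//; last first.
    by apply: (@subspace_sum X _ (fun m => s`_m v) w XS) => i /wP[].
  rewrite (@linear_on_sum X g _ (fun m => s`_m v) w)//; first by rewrite mulN1r addrC.
  by move=> i /wP[].
have [v Xv fv] : exists2 v, X v & f (proj v) != 0.
  apply: contrapT => nv.
  have f0 v : X v -> f (proj v) = 0.
    by move=> Xv; apply: contrapT => /eqP fv; apply: nv; exists v.
  (* If [f] vanished after projection, it would be the combination of [s] with coefficients
     [f (w m)]: a relation with leading coefficient 1. *)
  pose c m := if (m < size s)%N then - f (w m) else 1.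
  have := si c _ (size s); rewrite size_rcons /c ltnn.
  move=> /(_ _ (ltnSn _)) h; suff : (1 : R) = 0 by move/eqP; rewrite oner_eq0.
  apply: h => u Xu; rewrite big_ord_recr /= ltnn mul1r nth_rcons ltnn eqxx.
  rewrite -[RHS](f0 _ Xu) linproj// addrC; congr (_ + _); rewrite -sumrN.
  by apply: eq_bigr => i _; rewrite ltn_ord nth_rcons ltn_ord mulNr mulrC.
pose z := (f (proj v))^-1 *: proj v.
have Xz : X z.
  by rewrite /z -[_ *: _]addr0; apply: XS.2; [exact: Xproj|exact: XS.1].
have linz g : linear_on X g -> g z = (f (proj v))^-1 * g (proj v).
  move=> gL; rewrite /z -[_ *: _]addr0 gL; [|exact: Xproj|exact: XS.1].
  by rewrite (linear_on0 XS)// addr0.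
have fz : f z = 1 by rewrite linz// mulVf.
have sz n : (n < size s)%N -> s`_n z = 0.
  move=> ns; rewrite linz; last by apply: sL'; rewrite mem_nth.
  rewrite (linproj _ _ (sL' _ (mem_nth 0 ns)))//.
  rewrite (bigD1 (Ordinal ns))//= (wP _ ns).2// eqxx mulr1.
  rewrite big1 ?addr0 ?subrr ?mulr0// => i; rewrite -val_eqE /= => ni.
  by rewrite (wP _ (ltn_ord i)).2// eq_sym (negbTE ni) mulr0.
(* Subtracting [f (w m) *: z] makes [f] vanish and leaves the values of [s] unchanged, since [s]
   kills [z]. *)
exists (fun m => if (m < size s)%N then (- f (w m)) *: z + w m else z).
move=> m; rewrite size_rcons ltnS leq_eqVlt => /orP[/eqP ->|ms].
  rewrite ltnn; split=> // n; rewrite ltnS leq_eqVlt nth_rcons.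
  by case: ltngtP => // ns _; rewrite ?fz ?sz.
rewrite ms; split; first by apply: XS.2 => //; exact: (wP _ ms).1.
move=> n; rewrite ltnS leq_eqVlt nth_rcons; have Xw := (wP _ ms).1.
case: ltngtP => // ns _.
  by rewrite (sL' _ (mem_nth 0 ns))// sz// mulr0 add0r; exact: (wP _ ms).2.
by rewrite fL// fz mulr1 addNr ns gtn_eqF.
Qed.

(** The difference between [v] and its expansion in the dual vectors is killed by [s], hence zero. A
    functional [f] therefore has the coefficients [f (w m)], and evaluation at the dual vectors
    shows that no others are possible. *)
Lemma unisolventP X s : subspace_closed X ->
  (forall f, f \in s -> linear_on X f) -> indep X s ->
  (forall v, X v -> kills s v -> v = 0) -> unisolvent X s.
Proof.
move=> XS sL si sep; split=> [n|f fL]; first by apply: sL; rewrite mem_nth.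
have [w wP] := dual_basis XS sL si.
have Xw m : (m < size s)%N -> X (w m) by case/wP.
have expand v : X v -> v = \sum_(m < size s) s`_m v *: w m.
  move=> Xv; apply/eqP; rewrite -subr_eq0; apply/eqP; apply: sep.
    rewrite -scaleN1r addrC.
    apply: XS.2 => //.
    exact: (@subspace_sum X _ (fun m => s`_m v) w XS).
  move=> g gs; rewrite addrC -scaleN1r sL//; last first.
    exact: (@subspace_sum X _ (fun m => s`_m v) w XS).
  rewrite (@linear_on_sum X g _ (fun m => s`_m v) w)//; last exact: sL.
  move: gs => /(nthP 0)[n ns <-]; rewrite (bigD1 (Ordinal ns))//= (wP _ ns).2//.
  rewrite eqxx mulr1 big1 ?addr0 ?mulN1r ?addNr// => i; rewrite -val_eqE /= => ni.
  by rewrite (wP _ (ltn_ord i)).2// eq_sym (negbTE ni) mulr0.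
exists (\row_m f (w m)); split=> [v Xv|c cP].
  rewrite {1}(expand v Xv) (@linear_on_sum X f _ (fun m => s`_m v) w)//.
  by apply: eq_bigr => i _; rewrite mxE mulrC.
apply/rowP => m; rewrite mxE cP; last exact: Xw.
rewrite (bigD1 m)//= (wP _ (ltn_ord m)).2// eqxx mulr1 big1 ?addr0// => i.
rewrite -val_eqE /= => im.
by rewrite (wP _ (ltn_ord m)).2// (negbTE im) mulr0.
Qed.

End DualBases.

(** * Functionals given by pairing with the elements of a basis *)

Section Pairings.
Variables (R : realType) (V W : lmodType R).
Variables (P : set W) (b : seq W) (L : V -> W -> R).
Hypotheses (PS : subspace_closed P) (bP : is_basis P b).

Lemma basis_nth i : (i < size b)%N -> P b`_i.
Proof. by move=> ib; exact: (bP.1 (Ordinal ib)). Qed.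

Lemma basis_mem p : p \in b -> P p.
Proof. by move=> /(nthP 0)[n nb <-]; exact: basis_nth. Qed.

(** A relation between the functionals is itself the pairing with one element [p] of [P].
    Nondegeneracy gives [p = 0], and a basis gives zero only zero coordinates. The choice of the
    basis thus drops out. *)
Lemma indep_basis (Y : set V) : (forall v, Y v -> linear_on P (L v)) ->
  (forall p, P p -> (forall v, Y v -> L v p = 0) -> p = 0) ->
  indep Y [seq L^~ p | p <- b].
Proof.
move=> Llin nondeg c; rewrite size_map => c0.
pose p := \sum_(i < size b) c i *: b`_i.
have Pp : P p by exact: (@subspace_sum _ _ P _ c (nth 0 b) PS basis_nth).
have p0 : p = 0.
  apply: nondeg => // v Yv; rewrite -[RHS](c0 v Yv).
  rewrite (@linear_on_sum _ _ P (L v) _ c (nth 0 b) PS (Llin v Yv) basis_nth).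
  by apply: eq_bigr => i _; rewrite (nth_map 0).
have [c1 [_ cU]] := bP.2 _ PS.1; move=> n nb.
have e1 : c1 = \row_i c i.
  by apply: cU; rewrite -[LHS]p0; apply: eq_bigr => i _; rewrite mxE.
have e2 : c1 = 0.
  by apply: cU; rewrite big1// => i _; rewrite mxE scale0r.
by have := congr1 (fun A : 'rV_ _ => A 0 (Ordinal nb)) (etrans (esym e1) e2); rewrite !mxE.
Qed.

Lemma kills_basis v : linear_on P (L v) ->
  kills [seq L^~ p | p <- b] v -> forall p, P p -> L v p = 0.
Proof.
move=> Lv kv p Pp; have [c [-> _]] := bP.2 _ Pp.
(* The coordinates, extended by zero from ordinals to [nat]. *)
pose c' n := odflt 0 (omap (c 0) (insub n)).
rewrite (eq_bigr (fun i : 'I__ => c' i *: b`_i)); last by move=> i _; rewrite /c' valK.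
rewrite (@linear_on_sum _ _ P (L v) _ c' (nth 0 b) PS Lv basis_nth).
rewrite big1// => i _; rewrite (_ : L v b`_i = 0) ?mulr0//.
by apply: (kv (L^~ b`_i)); apply: map_f; rewrite mem_nth.
Qed.

End Pairings.

(** * Coordinates and polynomials *)

Lemma ord3P (i m : 'I_3) : [|| m == i, m == ordS i | m == ord_pred i].
Proof. by case: i m => [[|[|[|//]]] ?] [[|[|[|//]]] ?]. Qed.

Lemma ord3_inord (i : 'I_3) : [\/ i = inord 0, i = inord 1 | i = inord 2].
Proof.
by case: i => [[|[|[|//]]] ?]; [constructor 1|constructor 2|constructor 3];
  apply/val_inj; rewrite /= inordK.
Qed.

Lemma big3_inord (S : Type) (idx : S) (op : Monoid.law idx) (F : 'I_3 -> S) :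
  \big[op/idx]_i F i = op (op (F (inord 0)) (F (inord 1))) (F (inord 2)).
Proof.
rewrite !big_ord_recr big_ord0 /= Monoid.mul1m.
by congr (op (op (F _) (F _)) (F _)); apply/val_inj; rewrite /= inordK.
Qed.

Section Coordinates.
Variable R : realType.
Implicit Types (x y : R3 R) (i m : 'I_3).

Lemma crd_pt (u : 'I_3 -> R) i : crd (pt u) i = u i.
Proof.
by case: i => [[|[|[|//]]] ?]; rewrite /crd /pt /=; congr u; apply/val_inj;
  rewrite /= inordK.
Qed.

Lemma crd_inj x y : (forall i, crd x i = crd y i) -> x = y.
Proof.
case: x y => [[x0 x1] x2] [[y0 y1] y2] h.
have := h (inord 0); have := h (inord 1); have := h (inord 2).
by rewrite /crd /= !inordK//= => -> -> ->.
Qed.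

Lemma crdD x y i : crd (x + y) i = crd x i + crd y i.
Proof. by rewrite /crd; case: ifP => // _; case: ifP. Qed.

Lemma crdZ a x i : crd (a *: x) i = a * crd x i.
Proof. by rewrite /crd; case: ifP => // _; case: ifP. Qed.

Lemma crd_unitv i m : crd (unitv R i) m = (m == i)%:R.
Proof.
rewrite /unitv /pt3 crd_pt; case: ifP => // _; case: ifP => //.
Qed.

Definition upd x i (a : R) : R3 R := pt (fun m => if m == i then a else crd x m).

Lemma crd_upd x i a m : crd (upd x i a) m = if m == i then a else crd x m.
Proof. by rewrite crd_pt. Qed.

Lemma upd_id x i : upd x i (crd x i) = x.
Proof. by apply: crd_inj => m; rewrite crd_upd; case: eqP => [->|]. Qed.

Lemma upd_add x i h : h *: unitv R i + x = upd x i (h + crd x i).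
Proof.
apply: crd_inj => m; rewrite crd_upd crdD crdZ crd_unitv.
by case: eqP => [->|]; rewrite ?mulr1 ?mulr0 ?add0r.
Qed.

Lemma upd_pt3 i s t u a : upd (pt3 i s t u) i a = pt3 i a t u.
Proof.
by apply: crd_inj => m; rewrite /pt3 !crd_upd !crd_pt; case: eqP.
Qed.

Lemma crd_pt3 i s t u m : crd (pt3 i s t u) m =
  if m == i then s else if m == ordS i then t else u :> R.
Proof. by rewrite /pt3 crd_pt. Qed.

End Coordinates.

(** * Polynomial spaces: vanishing, division, bubbles, hats and derivatives *)

Section Polynomials.
Variable R : realType.
Implicit Types (x y : R3 R) (i m : 'I_3) (d e : 'I_3 -> nat) (f g : R3 R -> R).

Definition mono e x : R := \prod_i crd x i ^+ e i.

Lemma Q_lin d (a : R) f g : Q d f -> Q d g -> Q d (a *: f + g).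
Proof.
move=> [c cf] [c' cg].
exists (fun p q r => a * c p q r + c' p q r) => x.
have -> : (a *: f + g) x = a * f x + g x by [].
rewrite cf cg mulr_sumr -big_split; apply: eq_bigr => p _ /=.
rewrite mulr_sumr -big_split; apply: eq_bigr => q _ /=.
rewrite mulr_sumr -big_split; apply: eq_bigr => r _ /=.
by ring.
Qed.

Lemma Q0 d : Q d (0 : R3 R -> R).
Proof.
exists (fun _ _ _ => 0) => x; rewrite big1// => p _; rewrite big1// => q _.
by rewrite big1// => r _; rewrite !mul0r.
Qed.

Lemma Q_subspace d : subspace_closed (@Q R d).
Proof. by split=> [|a f g]; [exact: Q0|exact: Q_lin]. Qed.

Lemma Q_add d f g : Q d f -> Q d g -> Q d (f \+ g).
Proof. by move=> fd gd; have := Q_lin 1 fd gd; rewrite scale1r. Qed.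

Lemma Q_sum d n (F : 'I_n -> R3 R -> R) : (forall s, Q d (F s)) ->
  Q d (\sum_s F s).
Proof.
by move=> FQ; apply: big_ind => //; [exact: Q0|move=> f g; exact: Q_add].
Qed.

(** Reduces statements about [Q] to monomials, so that the triple sum of the definition need not be
    handled again in later closure properties. *)
Lemma Q_ind d (P : (R3 R -> R) -> Prop) : P 0 ->
  (forall a f g, P f -> P g -> P (a *: f + g)) ->
  (forall e, (forall i, (e i <= d i)%N) -> P (mono e)) ->
  forall f, Q d f -> P f.
Proof.
move=> P0 PL PM f [c cf].
pose ex (p q r : nat) (i : 'I_3) := nth 0%N [:: p; q; r] i.
have -> : f = \sum_(p < (d (inord 0)).+1) \sum_(q < (d (inord 1)).+1)
  \sum_(r < (d (inord 2)).+1) c p q r *: mono (ex p q r).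
  apply/funext => x; rewrite cf fct_sumE; apply: eq_bigr => p _.
  rewrite fct_sumE; apply: eq_bigr => q _; rewrite fct_sumE; apply: eq_bigr => r _.
  have -> : (c p q r *: mono (ex p q r)) x = c p q r * mono (ex p q r) x by [].
  by rewrite /mono big3_inord /ex /= !inordK//= !mulrA.
have PA u v : P u -> P v -> P (u + v).
  by move=> Pu Pv; have := PL 1 _ _ Pu Pv; rewrite scale1r.
apply: big_ind => // p _; apply: big_ind => // q _; apply: big_ind => // r _.
have := PL (c p q r) _ _ (PM (ex p q r) _) P0; rewrite addr0; apply=> i.
by case: (ord3_inord i) => ->; rewrite /ex inordK//= -ltnS ltn_ord.
Qed.

Lemma Q_mono d e : (forall i, (e i <= d i)%N) -> Q d (mono e).
Proof.
move=> ed; exists (fun p q r => ((p == e (inord 0)) && (q == e (inord 1)) &&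
  (r == e (inord 2)))%:R) => x.
have le i : (e i < (d i).+1)%N by rewrite ltnS.
rewrite (bigD1 (Ordinal (le (inord 0))))//= [X in _ + X]big1 ?addr0; last first.
  move=> p; rewrite -val_eqE /= => /negbTE pe; rewrite big1// => q _.
  by rewrite big1// => r _; rewrite pe /= !mul0r.
rewrite (bigD1 (Ordinal (le (inord 1))))//= [X in _ + X]big1 ?addr0; last first.
  move=> q; rewrite -val_eqE /= => /negbTE qe.
  by rewrite big1// => r _; rewrite qe andbF /= !mul0r.
rewrite (bigD1 (Ordinal (le (inord 2))))//= [X in _ + X]big1 ?addr0; last first.
  by move=> r; rewrite -val_eqE /= => /negbTE re; rewrite re andbF /= !mul0r.
by rewrite !eqxx /= mul1r /mono big3_inord.
Qed.

Lemma Q_le d d' f : (forall i, (d i <= d' i)%N) -> Q d f -> Q d' f.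
Proof.
move=> dd; elim/Q_ind; [exact: Q0|by move=> a u v; exact: Q_lin|].
by move=> e ed; apply: Q_mono => i; exact: leq_trans (ed i) (dd i).
Qed.

Lemma Q_mul d d' f g : Q d f -> Q d' g -> Q (fun i => d i + d' i)%N (f \* g).
Proof.
move=> fd; move: f fd; apply: Q_ind.
- move=> _; rewrite (_ : _ \* _ = 0); first exact: Q0.
  by apply/funext => x; rewrite /= mul0r.
- move=> a u v Qu Qv gd.
  rewrite (_ : _ \* _ = a *: (u \* g) + (v \* g)).
    by apply: Q_lin; [exact: Qu|exact: Qv].
  by apply/funext => x; rewrite /= mulrDl -mulrA.
move=> e ed; move: g; apply: Q_ind.
- rewrite (_ : _ \* _ = 0); first exact: Q0.
  by apply/funext => x; rewrite /= mulr0.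
- move=> a u v Qu Qv; rewrite (_ : _ \* _ = a *: (mono e \* u) + (mono e \* v)).
    by apply: Q_lin; [exact: Qu|exact: Qv].
  by apply/funext => x; rewrite /= mulrDr mulrCA.
move=> e' ed'; rewrite (_ : _ \* _ = mono (fun i => e i + e' i)%N).
  by apply: Q_mono => i; rewrite leq_add.
by apply/funext => x; rewrite /= /mono -big_split; apply: eq_bigr => i _; rewrite exprD.
Qed.

Lemma Q_cst d a : Q d (cst a : R3 R -> R).
Proof.
rewrite (_ : cst a = a *: mono (fun=> 0%N) + 0).
  by apply: Q_lin; [exact: Q_mono|exact: Q0].
by apply/funext => x; rewrite addr0 -[RHS]/(a * mono _ x) /mono big1 ?mulr1// => m _; exact: expr0.
Qed.

Definition dset d i n : 'I_3 -> nat := fun m => if m == i then n else d m.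

Lemma monoD e i x : mono e x = crd x i ^+ e i * mono (dset e i 0) x.
Proof.
rewrite /mono (bigD1 i)//= [in RHS](bigD1 i)//= /dset eqxx expr0 mul1r.
by congr (_ * _); apply: eq_bigr => m /negbTE ->.
Qed.

Lemma mono_upd e i x a : mono (dset e i 0) (upd x i a) = mono (dset e i 0) x.
Proof.
by apply: eq_bigr => m _; rewrite /dset crd_upd; case: eqP => // _; rewrite !expr0.
Qed.

Lemma Q_crd i : Q (dset (fun=> 0%N) i 1) (fun x => crd x i).
Proof.
rewrite (_ : (fun _ => _) = mono (dset (fun=> 0%N) i 1)); first exact: Q_mono.
apply/funext => x; rewrite (monoD _ i) /dset eqxx expr1.
by rewrite /mono big1 ?mulr1// => m _; case: ifP => mi; rewrite ?mi expr0.
Qed.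

Lemma Q_upd d i a f : Q d f -> Q (dset d i 0) (fun x => f (upd x i a)).
Proof.
move: f; apply: Q_ind; first exact: Q0.
- by move=> b u v Qu Qv; exact: Q_lin.
move=> e ed.
rewrite (_ : (fun _ => _) = (a ^+ e i) *: mono (dset e i 0) + 0).
  apply: Q_lin; last exact: Q0.
  by apply: Q_mono => m; rewrite /dset; case: eqP.
by apply/funext => x; rewrite addr0 (monoD _ i) mono_upd crd_upd eqxx.
Qed.

Lemma Q_upd0 d i a f x : d i = 0%N -> Q d f -> f (upd x i a) = f x.
Proof.
move=> di0; move: f; apply: Q_ind => //.
- by move=> b u v eu ev; rewrite -[RHS]/(b * u x + v x) -eu -ev.
move=> e ed; have ei0 : e i = 0%N by move: (ed i); rewrite di0 leqn0 => /eqP.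
by rewrite (monoD _ i) mono_upd ei0 expr0 [RHS](monoD _ i) ei0 expr0.
Qed.

Lemma Q_poly d i f x : Q d f ->
  exists p : {poly R}, forall t, f (upd x i t) = p.[t].
Proof.
move: f; apply: Q_ind; first by exists 0 => t; rewrite horner0.
- move=> b u v [p pP] [q qP]; exists (b *: p + q) => t.
  by rewrite hornerD hornerZ -pP -qP.
move=> e ed; exists (mono (dset e i 0) x *: 'X^(e i)) => t.
by rewrite (monoD _ i) mono_upd crd_upd eqxx hornerZ hornerXn mulrC.
Qed.

Lemma poly_eq0_itv (p : {poly R}) (a b : R) : a < b ->
  (forall t, a < t < b -> p.[t] = 0) -> p = 0.
Proof.
move=> ab p0; apply/eqP; apply: contraT => pN0.
(* Infinitely many distinct points; the shift by 2 keeps the fraction below 1, hence the points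
   strictly inside the interval. *)
pose r n : R := a + (b - a) / n.+2%:R.
have rinj : injective r.
  move=> m n /addrI /(mulfI _) h; have /h : b - a != 0 by rewrite subr_eq0 gt_eqF.
  by move/invr_inj/eqP; rewrite eqr_nat => /eqP [].
have := @max_poly_roots _ p [seq r n | n <- iota 0 (size p)] pN0.
rewrite map_inj_uniq// iota_uniq size_map size_iota ltnn; apply=> //.
apply/allP => _ /mapP[n _ ->]; apply/rootP/p0; rewrite /r ltrDl divr_gt0//=; last first.
  by rewrite subr_gt0.
rewrite -ltrBrDl ltr_pdivrMr ?ltr0n// ltr_pMr ?subr_gt0// ltr1n//.
Qed.

(** The coordinates are freed from their intervals one at a time: along a coordinate line the
    function is a univariate polynomial that vanishes on an interval. *)
Lemma Q_eq0_open d f (T : cuboid R) : Q d f ->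
  (forall x, open_cell T x -> f x = 0) -> f = 0.
Proof.
move=> fd f0; apply/funext => x.
(* [S] holds the interval conditions on the coordinates not yet freed. *)
have ext i (S : set (R3 R)) : (forall y t, S y -> lo T i < t < hi T i -> f (upd y i t) = 0) ->
    forall y, S y -> f y = 0.
  move=> h y Sy; have [p pP] := Q_poly i y fd.
  rewrite -(upd_id y i) pP (@poly_eq0_itv p _ _ (lo_lt_hi T i)) ?horner0// => t tT.
  by rewrite -pP h.
pose in_ m y := lo T m < crd y m < hi T m.
have h0 : forall y, in_ (inord 1) y /\ in_ (inord 2) y -> f y = 0.
  apply: (ext (inord 0)) => y t [y1 y2] tT; apply: f0 => m; rewrite crd_upd.
  by case: (ord3_inord m) => ->; rewrite ?eqxx// -val_eqE /= !inordK.
have h1 : forall y, in_ (inord 2) y -> f y = 0.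
  apply: (ext (inord 1)) => y t y2 tT; apply: h0; rewrite /in_ !crd_upd eqxx.
  by rewrite -val_eqE /= !inordK.
apply: (ext (inord 2) setT) => // y t _ tT; apply: h1.
by rewrite /in_ crd_upd eqxx.
Qed.

(** The factor theorem in the variable [x_i], the other variables being parameters and
    [f (upd x i a)] the remainder. *)
Lemma Q_sub_upd d i a f : Q d f -> exists2 g, Q (dset d i (d i).-1) g &
  forall x, f x - f (upd x i a) = (crd x i - a) * g x.
Proof.
move: f; apply: Q_ind.
- by exists 0 => [|x]; [exact: Q0|rewrite /= mulr0 subrr].
- move=> b u v [g gQ ug] [h hQ vh]; exists (b *: g + h); first exact: Q_lin.
  move=> x; rewrite -[LHS]/(b * u x + v x - (b * u (upd x i a) + v (upd x i a))).
  rewrite -[(b *: g + h) x]/(b * g x + h x).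
  by rewrite mulrDr mulrCA -ug -vh; ring.
move=> e ed.
(* The quotient in the factorisation of a difference of powers; for exponent 0 the sum is empty, in
   accordance with the truncated predecessor. *)
exists (\sum_(s < e i) (a ^+ s *: mono (dset e i ((e i).-1 - s)) + 0)).
  apply: Q_sum => s; apply: Q_lin; last exact: Q0.
  apply: Q_mono => m; rewrite /dset; case: eqP => // _.
  by rewrite (leq_trans (leq_subr _ _))// -!subn1 leq_sub.
move=> x; rewrite (monoD _ i) [mono e (upd _ _ _)](monoD _ i) mono_upd crd_upd eqxx.
rewrite -mulrBl subrXX -mulrA; congr (_ * _).
rewrite fct_sumE mulr_suml; apply: eq_bigr => s _; rewrite addr0.
rewrite -[RHS]/(a ^+ s * mono _ x) [in RHS](monoD _ i) mulrCA mulrA.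
have -> : dset e i ((e i).-1 - s) i = ((e i).-1 - s)%N by rewrite /dset eqxx.
congr (_ * _ * _).
by apply: eq_bigr => m _; congr (_ ^+ _); rewrite /dset; case: eqP.
Qed.

Definition bub (T : cuboid R) i x : R := (crd x i - lo T i) * (hi T i - crd x i).

Lemma Q_bub (T : cuboid R) i : Q (dset (fun=> 0%N) i 2) (bub T i).
Proof.
pose d1 := dset (fun=> 0%N) i 1.
have a1 : Q d1 (fun x => crd x i - lo T i).
  exact: (@Q_add d1 (fun x => crd x i) (cst (- lo T i)) (Q_crd i) (Q_cst _ _)).
have a2 : Q d1 (fun x => hi T i - crd x i).
  rewrite (_ : (fun _ => _) = (-1) *: (fun x => crd x i) + cst (hi T i)).
    by apply: Q_lin; [exact: Q_crd|exact: Q_cst].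
  by apply/funext => x; rewrite -[RHS]/(-1 * crd x i + hi T i) mulN1r addrC.
by apply: Q_le (Q_mul a1 a2) => m; rewrite /d1 /dset; case: eqP.
Qed.

(** The factor theorem is applied at [lo T i] and then at [hi T i], each time lowering the degree in
    [x_i] by one. *)
Lemma Q_bub_div d i (T : cuboid R) f : Q d f ->
  (forall x b, f (upd x i (bnd T i b)) = 0) ->
  exists2 g, Q (dset d i (d i - 2)) g & f = bub T i \* g.
Proof.
move=> fd f0; have [g gQ fg] := Q_sub_upd i (lo T i) fd.
have fE x : f x = (crd x i - lo T i) * g x.
  by rewrite -fg (f0 x false) subr0.
have [h hQ gh] := Q_sub_upd i (hi T i) gQ.
(* The sign comes from the factor [hi T i - crd x i] of the bubble, opposite to the one in the
   factor theorem. *)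
exists (-1 *: h + 0).
  apply: Q_lin; last exact: Q0.
  apply: Q_le hQ => m; rewrite /dset; case: eqP => // _.
  by rewrite eqxx -subn2.
apply/funext => x; rewrite fE.
have g0 : g (upd x i (hi T i)) = 0.
  have := f0 x true; rewrite fE crd_upd eqxx /= => /eqP; rewrite mulf_eq0.
  by rewrite subr_eq0 gt_eqF ?lo_lt_hi//= => /eqP.
have := gh x; rewrite g0 subr0 => ->.
rewrite -[RHS]/(bub T i x * (-1 * h x + 0)) /bub; ring.
Qed.

Lemma bub_gt0 (T : cuboid R) i x : lo T i < crd x i < hi T i -> 0 < bub T i x.
Proof. by move=> /andP[l h]; rewrite mulr_gt0 ?subr_gt0. Qed.

Lemma bub_ge0 (T : cuboid R) i x : lo T i <= crd x i <= hi T i -> 0 <= bub T i x.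
Proof. by move=> /andP[l h]; rewrite mulr_ge0 ?subr_ge0. Qed.

Lemma bub_bnd (T : cuboid R) i x b : crd x i = bnd T i b -> bub T i x = 0.
Proof. by rewrite /bub => ->; case: b; rewrite /= subrr ?mulr0 ?mul0r. Qed.

Definition hat (T : cuboid R) i b x : R :=
  (crd x i - bnd T i (~~ b)) / (bnd T i b - bnd T i (~~ b)).

Lemma bnd_neq (T : cuboid R) i b : bnd T i b != bnd T i (~~ b).
Proof. by case: b => /=; have := lo_lt_hi T i; [move/gt_eqF|move/lt_eqF] => ->. Qed.

Lemma hat_bnd (T : cuboid R) i b b' x : crd x i = bnd T i b' ->
  hat T i b x = (b' == b)%:R.
Proof.
move=> xb; rewrite /hat xb; case: eqP => [->|].
  by rewrite divff// subr_eq0 bnd_neq.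
by case: b b' {xb} => [] [] //= _; rewrite subrr mul0r.
Qed.

Lemma Q_hat (T : cuboid R) i b : Q (dset (fun=> 0%N) i 1) (hat T i b).
Proof.
rewrite (_ : hat T i b = (bnd T i b - bnd T i (~~ b))^-1 *: (fun x => crd x i) +
  cst (- bnd T i (~~ b) / (bnd T i b - bnd T i (~~ b)))).
  by apply: Q_lin; [exact: Q_crd|exact: Q_cst].
apply/funext => x; rewrite /hat mulrBl mulrC mulNr; reflexivity.
Qed.

(** Both derivatives have literally the same difference quotient; this carries univariate calculus
    over to the directions of the axes. *)
Lemma is_derive_upd f x i (l : R) :
  is_derive (crd x i) 1 (fun t => f (upd x i t)) l <-> is_derive x (unitv R i) f l.
Proof.
have E : (fun h : R => h^-1 *: (f (h *: unitv R i + x) - f x)) =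
  (fun h : R => h^-1 *: (f (upd x i (h *: 1 + crd x i)) - f (upd x i (crd x i)))).
  by apply/funext => h; rewrite upd_add upd_id /GRing.scale /= mulr1.
have E1 : derivable (fun t => f (upd x i t)) (crd x i) 1 = derivable f x (unitv R i).
  by rewrite /derivable -E.
have E2 : 'D_1 (fun t => f (upd x i t)) (crd x i) = 'D_(unitv R i) f x.
  by rewrite /derive -E.
split=> -[h1 h2]; split; [by rewrite -E1|by rewrite -E2|by rewrite E1|by rewrite E2].
Qed.

(** The degree bound is kept rather than lowered: what matters later is that the derivative is again
    a polynomial, hence continuous. *)
Lemma Q_derive d i f : Q d f -> exists2 g, Q d g &
  forall x, is_derive x (unitv R i) f (g x).
Proof.
move: f; apply: Q_ind.
- exists 0; first exact: Q0.
  by move=> x; exact: (@is_derive_cst _ _ _ (0 : R) x (unitv R i)).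
- move=> b u v [g gQ ug] [h hQ vh]; exists (b *: g + h); first exact: Q_lin.
  by move=> x; apply: is_deriveD.
move=> e ed; exists ((e i)%:R *: mono (dset e i (e i).-1) + 0).
  apply: Q_lin; last exact: Q0.
  by apply: Q_mono => m; rewrite /dset; case: eqP => // ->; rewrite (leq_trans (leq_pred _)).
move=> x; apply/is_derive_upd.
rewrite (_ : (fun t => _) = mono (dset e i 0) x \*: (fun t : R => t ^+ e i)); last first.
  by apply/funext => t; rewrite (monoD _ i) mono_upd crd_upd eqxx mulrC.
have Dexp : is_derive (crd x i) (1 : R) (fun t : R => t ^+ e i)
    ((e i)%:R * crd x i ^+ (e i).-1).
  apply: DeriveDef; first exact: exprn_derivable.
  by rewrite exp_derive /GRing.scale /= mulr1.
rewrite (_ : (_ + _) x = mono (dset e i 0) x *: ((e i)%:R * crd x i ^+ (e i).-1)).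
  exact: (is_deriveZ _ Dexp).
rewrite -[LHS]/((e i)%:R * mono _ x + 0) addr0 [in LHS](monoD _ i).
have -> : dset e i (e i).-1 i = (e i).-1 by rewrite /dset eqxx.
rewrite /GRing.scale /= mulrA mulrC; congr (_ * _).
by apply: eq_bigr => m _; congr (_ ^+ _); rewrite /dset; case: eqP.
Qed.

Lemma crd_continuous i : continuous (fun x => crd x i).
Proof.
rewrite (_ : (fun x => crd x i) = if val i == 0%N then (fun x : R3 R => x.1.1) else
  if val i == 1%N then (fun x : R3 R => x.1.2) else (fun x : R3 R => x.2)); last first.
  by apply/funext => x; rewrite /crd; case: ifP => // _; case: ifP.
have c1 : continuous (fst : R3 R -> R * R) by move=> x; exact: cvg_fst.
have c2 : continuous (fst : R * R -> R) by move=> x; exact: cvg_fst.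
have c3 : continuous (snd : R * R -> R) by move=> x; exact: cvg_snd.
case: ifP => _; [|case: ifP => _]; move=> x.
- exact: (continuous_comp (c1 x) (c2 _)).
- exact: (continuous_comp (c1 x) (c3 _)).
- exact: cvg_snd.
Qed.

Lemma Q_continuous d f : Q d f -> continuous f.
Proof.
move: f; apply: Q_ind.
- by move=> x; exact: cvg_cst.
- move=> a u v cu cv x; apply: cvgD; last exact: cv.
  by apply: cvgZr; exact: cu.
move=> e _ x; rewrite /mono.
have : forall m, {for x, continuous (fun y => crd y m ^+ e m)}.
  by move=> m; apply: (@continuous_comp _ _ _ (fun y => crd y m) (fun t => t ^+ e m));
    [exact: crd_continuous|exact: exprn_continuous].
move=> h; rewrite (_ : (fun y => _) = fun y => crd y (inord 0) ^+ e (inord 0) *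
  crd y (inord 1) ^+ e (inord 1) * crd y (inord 2) ^+ e (inord 2)); last first.
  by apply/funext => y; rewrite big3_inord.
by apply: cvgM; [apply: cvgM|]; exact: h.
Qed.

End Polynomials.

(** * Integration over boxes *)

Notation M1 R := (measurableTypeR R).
Notation M2 R := (measurableTypeR R * measurableTypeR R)%type.
Notation M3 R := (measurableTypeR R * measurableTypeR R * measurableTypeR R)%type.

(** * Neighbourhoods and measures on products *)

Section CountableBases.

(** Measurable sets and neighbourhoods enter as bare set systems, so that the topology and the
    sigma-algebra of a product need not come from a single structure. *)
Definition countable_base (T : Type) (m : set (set T)) (nb : T -> set (set T)) :=
  exists (I : countType) (B : I -> set T), (forall i, m (B i)) /\
    forall x A, nb x A -> exists2 i, B i x & B i `<=` A.

Lemma countable_base_prod (T1 T2 : Type) (m1 : set (set T1)) (m2 : set (set T2))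
    (m12 : set (set (T1 * T2))) nb1 nb2 nb12 :
  countable_base m1 nb1 -> countable_base m2 nb2 ->
  (forall A B, m1 A -> m2 B -> m12 (A `*` B)) ->
  (forall x C, nb12 x C -> exists A B, [/\ nb1 x.1 A, nb2 x.2 B & A `*` B `<=` C]) ->
  countable_base m12 nb12.
Proof.
move=> [I [B [mB bB]]] [J [C [mC bC]]] mX nbX.
exists (I * J)%type, (fun ij => B ij.1 `*` C ij.2); split.
  by move=> [i j]; exact: mX.
move=> x A /nbX[U [V [xU xV UVA]]].
have [i Bx BU] := bB _ _ xU; have [j Cx CV] := bC _ _ xV.
by exists (i, j) => //= -[y z] [/= /BU Uy /CV Vz]; exact: UVA.
Qed.

(** The measure has full support. This is what turns a vanishing integral of a nonnegative
    continuous function into pointwise vanishing. *)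
Definition charges_nbhs (R : realType) (T : Type) (m : set (set T))
    (nb : T -> set (set T)) (mu : set T -> \bar R) :=
  forall x A, nb x A -> exists B, [/\ m B, B `<=` A & (0 < mu B)%E].

Lemma charges_nbhs_prod (R : realType) (T1 T2 : Type) (m1 : set (set T1))
    (m2 : set (set T2)) (m12 : set (set (T1 * T2))) nb1 nb2 nb12
    (mu1 : set T1 -> \bar R) mu2 mu12 :
  charges_nbhs m1 nb1 mu1 -> charges_nbhs m2 nb2 mu2 ->
  (forall A B, m1 A -> m2 B -> m12 (A `*` B) /\ mu12 (A `*` B) = (mu1 A * mu2 B)%E) ->
  (forall x C, nb12 x C -> exists A B, [/\ nb1 x.1 A, nb2 x.2 B & A `*` B `<=` C]) ->
  charges_nbhs m12 nb12 mu12.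
Proof.
move=> c1 c2 mX nbX x C /nbX[U [V [xU xV UVC]]].
have [A [mA AU A0]] := c1 _ _ xU; have [B [mB BV B0]] := c2 _ _ xV.
have [mAB eAB] := mX _ _ mA mB.
exists (A `*` B); split => //; last by rewrite eAB mule_gt0.
by move=> [y z] [/= /AU ? /BV ?]; exact: UVC.
Qed.

End CountableBases.

(** * Borel measurability and full support in dimensions one, two and three *)

Section BorelProducts.
Variable R : realType.

Lemma nbhs_prodP (T U : topologicalType) (x : T * U) (C : set (T * U)) :
  nbhs x C -> exists A B, [/\ nbhs x.1 A, nbhs x.2 B & A `*` B `<=` C].
Proof. by case=> -[A B] [/= xA xB ABC]; exists A, B. Qed.

Lemma countable_base1 : countable_base (@measurable _ (M1 R)) (fun x : R => nbhs x).
Proof.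
exists (rat * rat)%type, (fun q : rat * rat => `](ratr q.1 : R), ratr q.2[%classic).
split=> [q|x A /nbhs_ballP[e /= e0 eA]]; first exact: measurable_itv.
have [p] := @rat_in_itvoo R (x - e) x ltac:(by rewrite gtrBl).
rewrite in_itv/= => /andP[xp px].
have [q] := @rat_in_itvoo R x (x + e) ltac:(by rewrite ltrDl).
rewrite in_itv/= => /andP[xq qx].
exists (p, q) => /=; first by rewrite in_itv/= px xq.
move=> y /=; rewrite in_itv/= => /andP[py yq]; apply: eA.
by rewrite /ball/= ltr_norml; apply/andP; split; lra.
Qed.

Lemma countable_base2 :
  countable_base (@measurable _ (M2 R)) (fun x : R * R => nbhs x).
Proof.
apply: countable_base_prod countable_base1 countable_base1 _ _.
  by move=> A B; exact: measurableX.
by move=> x C; exact: nbhs_prodP.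
Qed.

Lemma countable_base3 :
  countable_base (@measurable _ (M3 R)) (fun x : R3 R => nbhs x).
Proof.
apply: countable_base_prod countable_base2 countable_base1 _ _.
  by move=> A B; exact: measurableX.
by move=> x C; exact: nbhs_prodP.
Qed.

(** An open set is the countable union of the base sets that it contains. *)
Lemma countable_base_open d (T : measurableType d) (nb : T -> set (set T)) A :
  countable_base measurable nb -> (forall x, A x -> nb x A) -> measurable A.
Proof.
move=> [I [B [mB bB]]] oA.
have -> : A = \bigcup_i (if `[< B i `<=` A >] then B i else set0).
  apply/seteqP; split=> [x Ax|x [i _]].
    have [i Bx BA] := bB _ _ (oA _ Ax).
    by exists i => //; case: asboolP.
  by case: asboolP => // + Bx; exact.
apply: countable_bigcupT_measurable; first exact: countableP.
by move=> i; case: ifP.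
Qed.

Lemma open_measurable2 (A : set (R * R)) : open A -> @measurable _ (M2 R) A.
Proof.
move=> oA; apply: countable_base_open countable_base2 _ => x Ax.
exact: open_nbhs_nbhs.
Qed.

Lemma open_measurable3 (A : set (R3 R)) : open A -> @measurable _ (M3 R) A.
Proof.
move=> oA; apply: countable_base_open countable_base3 _ => x Ax.
exact: open_nbhs_nbhs.
Qed.

Lemma continuous_measurable2 (f : R * R -> R) : continuous f ->
  measurable_fun setT (f : M2 R -> R).
Proof.
move=> /continuousP cf; apply: (measurability _ (RGenOpens.measurableE R)).
move=> _ [_ [a [b ->] <-]]; rewrite setTI; apply: open_measurable2; apply: cf.
exact: interval_open.
Qed.

Lemma continuous_measurable3 (f : R3 R -> R) : continuous f ->
  measurable_fun setT (f : M3 R -> R).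
Proof.
move=> /continuousP cf; apply: (measurability _ (RGenOpens.measurableE R)).
move=> _ [_ [a [b ->] <-]]; rewrite setTI; apply: open_measurable3; apply: cf.
exact: interval_open.
Qed.

Lemma charges_nbhs1 :
  charges_nbhs (@measurable _ (M1 R)) (fun x : R => nbhs x) (leb1 R).
Proof.
move=> x A /nbhs_ballP[e /= e0 eA].
exists `]x - e, x + e[%classic; split; first exact: measurable_itv.
  move=> y /=; rewrite in_itv/= => /andP[ey ye]; apply: eA.
  by rewrite /ball/= distrC ltr_distl ey ye.
rewrite lebesgue_measure_itv/= lte_fin ifT; last by rewrite ltrBlDr -addrA ltrDl addr_gt0.
by rewrite -EFinB lte_fin subr_gt0 ltrBlDr -addrA ltrDl addr_gt0.
Qed.

Lemma charges_nbhs2 :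
  charges_nbhs (@measurable _ (M2 R)) (fun x : R * R => nbhs x) (leb2 R).
Proof.
apply: charges_nbhs_prod charges_nbhs1 charges_nbhs1 _ _.
  by move=> A B mA mB; split; [exact: measurableX|exact: product_measure1E].
by move=> x C; exact: nbhs_prodP.
Qed.

Lemma charges_nbhs3 :
  charges_nbhs (@measurable _ (M3 R)) (fun x : R3 R => nbhs x) (leb3 R).
Proof.
apply: charges_nbhs_prod charges_nbhs2 charges_nbhs1 _ _.
  by move=> A B mA mB; split; [exact: measurableX|exact: product_measure1E].
by move=> x C; exact: nbhs_prodP.
Qed.

(* The library's canonical sigma-finite structure on a product measure is the
   one of products of subprobabilities; an alias is needed for [leb2]. *)
Definition leb2' : set (M2 R) -> \bar R := leb2 R.

HB.instance Definition _ := Measure.on leb2'.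

Lemma leb2'_sigma_finite : sigma_finite setT leb2'.
Proof.
pose I n : set R := `](- n%:R), n%:R[%classic.
exists (fun n => I n `*` I n).
  apply/seteqP; split=> // -[x y] _.
  exists (Num.bound (`|x| + `|y|)) => //.
  have h : `|x| + `|y| < (Num.bound (`|x| + `|y|))%:R.
    by apply: archi_boundP; rewrite addr_ge0.
  split; rewrite /I /= in_itv/= -ltr_norml; apply: le_lt_trans h.
    by rewrite lerDl.
  by rewrite lerDr.
move=> n; split; first by apply: measurableX; exact: measurable_itv.
have Ifin : (leb1 R (I n) < +oo)%E.
  by rewrite lebesgue_measure_itv/=; case: ifP => // _; rewrite -EFinB ltry.
rewrite /leb2' product_measure1E; [|exact: measurable_itv|exact: measurable_itv].
by rewrite lte_mul_pinfty// ge0_fin_numE.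
Qed.

HB.instance Definition _ := Measure_isSigmaFinite.Build _ _ _ leb2' leb2'_sigma_finite.

End BorelProducts.

(** * Linearity and strict positivity of real-valued integrals *)

Section RealIntegrals.
Context d (T : measurableType d) (R : realType) (mu : {measure set T -> \bar R}).
Implicit Types (D : set T) (f g : T -> R).

Lemma Rintegral_lin D f g (a : R) : measurable D ->
  mu.-integrable D (EFin \o f) -> mu.-integrable D (EFin \o g) ->
  \int[mu]_(x in D) (a * f x + g x) =
  a * \int[mu]_(x in D) f x + \int[mu]_(x in D) g x.
Proof.
move=> mD fi gi; rewrite RintegralD//; last first.
  rewrite (_ : EFin \o _ = fun x => a%:E * (EFin \o f) x)%E; last by apply/funext.
  exact: integrableZl.
by rewrite RintegralZl.
Qed.

Lemma bounded_integrable D f (M : R) : measurable D -> (mu D < +oo)%E ->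
  measurable_fun setT f -> (forall x, D x -> `|f x| <= M) ->
  mu.-integrable D (EFin \o f).
Proof.
move=> mD muD mf fM; apply: measurable_bounded_integrable => //.
  by apply: measurable_funTS.
exists M; split; first exact: num_real.
by move=> N MN x /= Dx; rewrite (le_trans (fM x Dx))// ltW.
Qed.

Lemma Rintegral_gt0 D B f (c : R) : measurable D -> measurable B -> B `<=` D ->
  mu.-integrable D (EFin \o f) -> (forall x, D x -> 0 <= f x) ->
  0 < c -> (forall x, B x -> c <= f x) -> (0 < mu B)%E ->
  0 < \int[mu]_(x in D) f x.
Proof.
move=> mD mB BD fi f0 c0 cf B0.
(* [fine] sends an infinite integral to 0, so finiteness must accompany positivity. *)
apply: fine_gt0; apply/andP; split; last first.
  case/integrableP: (fi) => mf; apply: le_lt_trans.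
  apply: ge0_le_integral => //.
  - exact: measurable_int (integrable_abse fi).
  - by move=> x Dx; rewrite /= lee_fin ler_norm.
apply: (@lt_le_trans _ _ (\int[mu]_(x in B) c%:E)%E).
  by rewrite integral_cst// mule_gt0.
apply: (@le_trans _ _ (\int[mu]_(x in B) (f x)%:E)%E).
  apply: ge0_le_integral => //.
  - by move=> x _; rewrite lee_fin ltW.
  - exact: measurable_int (integrableS mD mB BD fi).
apply: ge0_subset_integral => //.
exact: measurable_int fi.
Qed.

(** Were [f x] positive, the set where [f] exceeds [f x / 2] would contain a set of positive measure
    and make the integral positive. *)
Lemma Rintegral_eq0 D f (nb : T -> set (set T)) : charges_nbhs measurable nb mu ->
  measurable D -> mu.-integrable D (EFin \o f) -> (forall x, D x -> 0 <= f x) ->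
  \int[mu]_(x in D) f x = 0 ->
  forall x, nb x (D `&` [set y | f x / 2 < f y]) -> f x <= 0.
Proof.
move=> cn mD fi f0 int0 x nbx; rewrite leNgt; apply/negP => fx.
have [B [mB BA B0]] := cn _ _ nbx.
suff : 0 < \int[mu]_(x in D) f x by rewrite int0 ltxx.
apply: (@Rintegral_gt0 _ B _ (f x / 2)) => //.
- by move=> y /BA[].
- by rewrite divr_gt0.
- by move=> y /BA[_ /ltW].
Qed.

End RealIntegrals.

(** * Fubini for bounded functions on rectangles of finite measure *)

Section RealFubini.
Context d1 d2 (T1 : measurableType d1) (T2 : measurableType d2) (R : realType).
Variables (m1 : {sigma_finite_measure set T1 -> \bar R}).
Variables (m2 : {sigma_finite_measure set T2 -> \bar R}).
Variables (A : set T1) (B : set T2) (f : T1 * T2 -> R) (M : R).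
Hypotheses (mA : measurable A) (mB : measurable B).
Hypotheses (Afin : (m1 A < +oo)%E) (Bfin : (m2 B < +oo)%E).
Hypotheses (mf : measurable_fun setT f).
Hypothesis fM : forall x y, A x -> B y -> `|f (x, y)| <= M.

Let g := (EFin \o f) \_ (A `*` B).

Let gi : (m1 \x m2)%E.-integrable setT g.
Proof.
apply/(integrable_mkcond _ (measurableX mA mB)).

apply: (@bounded_integrable _ _ _ _ _ _ M) => //.
- exact: measurableX.
- by rewrite [ltLHS]product_measure1E// lte_mul_pinfty// ge0_fin_numE.
- by move=> [x y] [/= Ax By]; exact: fM.
Qed.

Let fE : \int[(m1 \x m2)%E]_(z in A `*` B) f z = fine (\int[(m1 \x m2)]_z g z)%E.
Proof. by rewrite /Rintegral integral_mkcond. Qed.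

(** The function is extended by zero, so that Fubini on the whole product applies. Boundedness makes
    every slice integrable, which allows [fine] to be undone in the inner integral. *)
Lemma Rfubini2 : \int[(m1 \x m2)%E]_(z in A `*` B) f z =
  \int[m2]_(y in B) \int[m1]_(x in A) f (x, y).
Proof.
rewrite fE -integral21_prod_meas1// /Rintegral [in RHS]integral_mkcond.
congr fine; apply: eq_integral => y _; rewrite /fubini_G /patch.
case: ifPn => [yB|yB].
  rewrite fineK; last first.
    apply: integrable_fin_num => //.
    apply: (@bounded_integrable _ _ _ _ _ (fun x => f (x, y)) M) => //.
      exact: measurableT_comp.
    by move=> x Ax; apply: fM => //; rewrite inE in yB.
  rewrite [RHS]integral_mkcond; apply: eq_integral => x _.
  by rewrite /g /patch in_setX yB andbT.
apply: integral0_eq => x _.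
by rewrite /g /patch in_setX (negbTE yB) andbF.
Qed.

Lemma Rfubini1 : \int[(m1 \x m2)%E]_(z in A `*` B) f z =
  \int[m1]_(x in A) \int[m2]_(y in B) f (x, y).
Proof.
rewrite fE -integral12_prod_meas1// /Rintegral [in RHS]integral_mkcond.
congr fine; apply: eq_integral => x _; rewrite /fubini_F /patch.
case: ifPn => [xA|xA].
  rewrite fineK; last first.
    apply: integrable_fin_num => //.
    apply: (@bounded_integrable _ _ _ _ _ (fun y => f (x, y)) M) => //.
      exact: measurableT_comp.
    by move=> y By; apply: fM => //; rewrite inE in xA.
  rewrite [RHS]integral_mkcond; apply: eq_integral => y _.
  by rewrite /g /patch in_setX xA.
apply: integral0_eq => y _.
by rewrite /g /patch in_setX (negbTE xA).
Qed.

End RealFubini.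

(** * Cells, faces and edges as domains of integration *)

Section CellIntegrals.
Variables (R : realType).
Implicit Types (T : cuboid R) (i : 'I_3).

Lemma ordS_inord : (ordS (inord 0) = inord 1 :> 'I_3) *
  (ordS (inord 1) = inord 2 :> 'I_3) * (ordS (inord 2) = inord 0 :> 'I_3).
Proof. by split; [split|]; apply/val_inj; rewrite /= !inordK. Qed.

Lemma ord_pred_inord : (ord_pred (inord 0) = inord 2 :> 'I_3) *
  (ord_pred (inord 1) = inord 0 :> 'I_3) * (ord_pred (inord 2) = inord 1 :> 'I_3).
Proof. by split; [split|]; apply/val_inj; rewrite /= !inordK. Qed.

Lemma crd_inord (x : R3 R) : (crd x (inord 0) = x.1.1) *
  (crd x (inord 1) = x.1.2) * (crd x (inord 2) = x.2).
Proof. by rewrite /crd /= !inordK. Qed.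

Lemma inord_eq : (((inord 0 == inord 1 :> 'I_3) = false) *
  ((inord 0 == inord 2 :> 'I_3) = false) * ((inord 1 == inord 0 :> 'I_3) = false)) *
  (((inord 1 == inord 2 :> 'I_3) = false) *
  ((inord 2 == inord 0 :> 'I_3) = false) * ((inord 2 == inord 1 :> 'I_3) = false)).
Proof. by do !split; apply/eqP => /(congr1 val); rewrite /= !inordK. Qed.

Lemma pt3_inord (s t u : R) : (pt3 (inord 0) s t u = (s, t, u)) *
  (pt3 (inord 1) s t u = (u, s, t)) * (pt3 (inord 2) s t u = (t, u, s)).
Proof. by rewrite /pt3 /pt !ordS_inord !inord_eq !eqxx. Qed.

Definition cside T i : set R := `[lo T i, hi T i].
Definition oside T i : set R := `]lo T i, hi T i[.

Lemma oside_cside T i : oside T i `<=` cside T i.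
Proof. exact: subset_itv_oo_cc. Qed.

Lemma measurable_cside T i : @measurable _ (M1 R) (cside T i).
Proof. exact: measurable_itv. Qed.

Lemma measurable_oside T i : @measurable _ (M1 R) (oside T i).
Proof. exact: measurable_itv. Qed.

Lemma cside_fin T i : (leb1 R (cside T i) < +oo)%E.
Proof. by rewrite lebesgue_measure_itv/=; case: ifP => // _; rewrite -EFinB ltry. Qed.

Lemma oside_fin T i : (leb1 R (oside T i) < +oo)%E.
Proof. by rewrite lebesgue_measure_itv/=; case: ifP => // _; rewrite -EFinB ltry. Qed.

Lemma cellE T : cell T =
  (cside T (inord 0) `*` cside T (inord 1)) `*` cside T (inord 2).
Proof.
apply/seteqP; split=> [x xT|x /= [[x0 x1] x2] i].
  have := xT (inord 0); have := xT (inord 1); have := xT (inord 2).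
  by rewrite !crd_inord /cside /= !in_itv.
by case: (ord3_inord i) => ->; rewrite crd_inord; move: x0 x1 x2; rewrite /cside /= !in_itv.
Qed.

Lemma open_cellE T : open_cell T =
  (oside T (inord 0) `*` oside T (inord 1)) `*` oside T (inord 2).
Proof.
apply/seteqP; split=> [x xT|x /= [[x0 x1] x2] i].
  have := xT (inord 0); have := xT (inord 1); have := xT (inord 2).
  by rewrite !crd_inord /oside /= !in_itv.
by case: (ord3_inord i) => ->; rewrite crd_inord; move: x0 x1 x2; rewrite /oside /= !in_itv.
Qed.

Lemma open_cell_cell T : open_cell T `<=` cell T.
Proof. by move=> x xT i; have /andP[/ltW -> /ltW ->] := xT i. Qed.

Lemma measurable_cell T : @measurable _ (M3 R) (cell T).
Proof.
rewrite cellE; apply: measurableX; last exact: measurable_cside.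
by apply: measurableX; exact: measurable_cside.
Qed.

Lemma measurable_open_cell T : @measurable _ (M3 R) (open_cell T).
Proof.
rewrite open_cellE; apply: measurableX; last exact: measurable_oside.
by apply: measurableX; exact: measurable_oside.
Qed.

Lemma leb2_fin (A B : set R) : @measurable _ (M1 R) A -> @measurable _ (M1 R) B ->
  (leb1 R A < +oo)%E -> (leb1 R B < +oo)%E -> (leb2 R (A `*` B) < +oo)%E.
Proof.
by move=> mA mB fA fB; rewrite product_measure1E// lte_mul_pinfty// ge0_fin_numE.
Qed.

Lemma cell_fin T : (leb3 R (cell T) < +oo)%E.
Proof.
have m := @measurable_cside T; have f := @cside_fin T.
have f2 := leb2_fin (m (inord 0)) (m (inord 1)) (f _) (f _).
have m2 := measurableX (m (inord 0)) (m (inord 1)).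
rewrite cellE (product_measure1E _ _ m2 (m _)); apply: lte_mul_pinfty => //.
  by rewrite ge0_fin_numE.
exact: f.
Qed.

Lemma compact_cside T i : compact (cside T i).
Proof. exact: segment_compact. Qed.

Lemma compact_cell T : compact (cell T).
Proof.
rewrite cellE; apply: compact_setX; last exact: compact_cside.
by apply: compact_setX; exact: compact_cside.
Qed.

Lemma continuous_compact_le (U : topologicalType) (D : set U) (f : U -> R) :
  compact D -> continuous f -> exists M, forall x, D x -> `|f x| <= M.
Proof.
move=> cD cf.
have : bounded_set (f @` D).
  apply: compact_bounded; apply: continuous_compact => //.
  exact: continuous_subspaceT.
move=> [M [_ MP]]; exists (M + 1) => x Dx.
by apply: MP; [rewrite ltrDl|exists x].
Qed.

Lemma cell_integrable T (f : R3 R -> R) : continuous f ->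
  (leb3 R).-integrable (cell T) (EFin \o f).
Proof.
move=> cf; have [M fM] := continuous_compact_le (@compact_cell T) cf.
apply: (@bounded_integrable _ _ _ _ _ _ M) => //.
- exact: measurable_cell.
- exact: cell_fin.
- exact: continuous_measurable3.
Qed.

Lemma open_cell_integrable T (f : R3 R -> R) : continuous f ->
  (leb3 R).-integrable (open_cell T) (EFin \o f).
Proof.
move=> cf; apply: integrableS (cell_integrable T cf).
- exact: measurable_cell.
- exact: measurable_open_cell.
- exact: open_cell_cell.
Qed.

Lemma measurable_rect T i j : @measurable _ (M2 R) (cside T i `*` cside T j).
Proof. by apply: measurableX; exact: measurable_cside. Qed.

Lemma measurable_orect T i j : @measurable _ (M2 R) (oside T i `*` oside T j).
Proof. by apply: measurableX; exact: measurable_oside. Qed.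

Lemma rect_integrable T i j (f : R * R -> R) : continuous f ->
  (leb2 R).-integrable (cside T i `*` cside T j) (EFin \o f).
Proof.
move=> cf.
have cS : compact (cside T i `*` cside T j) by apply: compact_setX; exact: compact_cside.
have [M fM] := continuous_compact_le cS cf.
apply: (@bounded_integrable _ _ _ _ _ _ M) => //.
- exact: measurable_rect.
- by apply: leb2_fin; rewrite ?cside_fin//; exact: measurable_cside.
- exact: continuous_measurable2.
Qed.

Lemma orect_integrable T i j (f : R * R -> R) : continuous f ->
  (leb2 R).-integrable (oside T i `*` oside T j) (EFin \o f).
Proof.
move=> cf; apply: integrableS (rect_integrable T i j cf).
- exact: measurable_rect.
- exact: measurable_orect.
- by apply: setSX; exact: oside_cside.
Qed.

Lemma cside_integrable T i (f : R -> R) : continuous f ->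
  (leb1 R).-integrable (cside T i) (EFin \o f).
Proof.
move=> cf; apply: continuous_compact_integrable; first exact: compact_cside.
exact: continuous_subspaceT.
Qed.

Lemma continuous_crdP (U : topologicalType) (h : U -> R3 R) :
  (forall i, continuous (fun x => crd (h x) i)) -> continuous h.
Proof.
move=> ch x.
have -> : h = fun x => (crd (h x) (inord 0), crd (h x) (inord 1), crd (h x) (inord 2)).
  by apply/funext => y; rewrite !crd_inord; case: (h y) => -[].
exact: (cvg_pair (cvg_pair (ch _ x) (ch _ x)) (ch _ x)).
Qed.

Lemma edge_pt_continuous T e : continuous (edge_pt T e).
Proof.
apply: continuous_crdP => i.
rewrite (_ : (fun _ => _) = if i == edge_dir e then id else
  cst (crd (edge_pt T e 0) i)).
  by case: ifP => _ x; [exact: cvg_id|exact: cvg_cst].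
by apply/funext => x; rewrite /edge_pt !crd_pt3; case: eqP.
Qed.

Lemma pt3_continuous i (a : R) : continuous (fun u : R * R => pt3 i a u.1 u.2).
Proof.
apply: continuous_crdP => m.
rewrite (_ : (fun _ => _) = if m == i then cst a else
  if m == ordS i then fst else snd).
  by case: ifP => _ x; [exact: cvg_cst|case: ifP => _; [exact: cvg_fst|exact: cvg_snd]].
by apply/funext => x; rewrite /edge_pt !crd_pt3; case: eqP => // _; case: eqP.
Qed.

Lemma face_pt_continuous T F : continuous (face_pt T F).
Proof. exact: pt3_continuous. Qed.

Lemma nbhs_oside T i x : oside T i x -> nbhs x (oside T i).
Proof. by move=> xi; apply: open_nbhs_nbhs; split => //; exact: interval_open. Qed.

Lemma nbhs_setX (U V : topologicalType) (x : U * V) A B :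
  nbhs x.1 A -> nbhs x.2 B -> nbhs x (A `*` B).
Proof. by move=> xA xB; exists (A, B). Qed.

Lemma open_cell_nbhs T x : open_cell T x -> nbhs x (open_cell T).
Proof.
rewrite open_cellE => -[[x0 x1] x2].
by apply: nbhs_setX; [apply: nbhs_setX|]; exact: nbhs_oside.
Qed.

Lemma nbhs_gt_half (U : topologicalType) (f : U -> R) x : continuous f ->
  0 < f x -> nbhs x [set y | f x / 2 < f y].
Proof.
move=> cf fx; apply: (cvgr_gt (f x) (cf x)).
by rewrite ltr_pdivrMr// ltr_pMr// ltr1n.
Qed.

(** Vanishing is claimed at interior points, which have a whole neighbourhood in the cell;
    polynomials extend it further. *)
Lemma cell_int_eq0 T (f : R3 R -> R) : continuous f ->
  (forall x, cell T x -> 0 <= f x) -> \int[leb3 R]_(x in cell T) f x = 0 ->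
  forall x, open_cell T x -> f x = 0.
Proof.
move=> cf f0 int0 x xT; apply/eqP; rewrite eq_le f0; last exact: open_cell_cell.
rewrite andbT leNgt; apply/negP => fx.
suff : f x <= 0 by rewrite leNgt fx.
apply: (Rintegral_eq0 (@charges_nbhs3 R) (@measurable_cell T)
  (cell_integrable T cf) f0 int0).
apply: filterI; last exact: nbhs_gt_half.
by apply: filterS (open_cell_nbhs xT); exact: open_cell_cell.
Qed.

Lemma rect_int_eq0 T i j (f : R * R -> R) : continuous f ->
  (forall x, (cside T i `*` cside T j) x -> 0 <= f x) ->
  \int[leb2 R]_(x in cside T i `*` cside T j) f x = 0 ->
  forall x, (oside T i `*` oside T j) x -> f x = 0.
Proof.
have sub : oside T i `*` oside T j `<=` cside T i `*` cside T j.
  by apply: setSX; exact: oside_cside.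
move=> cf f0 int0 x xT; apply/eqP; rewrite eq_le f0; last exact: sub.
rewrite andbT leNgt; apply/negP => fx.
suff : f x <= 0 by rewrite leNgt fx.
apply: (Rintegral_eq0 (@charges_nbhs2 R) (@measurable_rect T i j)
  (rect_integrable T i j cf) f0 int0).
apply: filterI; last exact: nbhs_gt_half.
case: xT => x1 x2; apply: (filterS sub).
by apply: nbhs_setX; exact: nbhs_oside.
Qed.

Lemma cside_int_eq0 T i (f : R -> R) : continuous f ->
  (forall x, cside T i x -> 0 <= f x) -> \int[leb1 R]_(x in cside T i) f x = 0 ->
  forall x, oside T i x -> f x = 0.
Proof.
move=> cf f0 int0 x xT; apply/eqP; rewrite eq_le f0; last exact: oside_cside.
rewrite andbT leNgt; apply/negP => fx.
suff : f x <= 0 by rewrite leNgt fx.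
apply: (Rintegral_eq0 (@charges_nbhs1 R) (@measurable_cside T i)
  (cside_integrable T i cf) f0 int0).
apply: filterI; last exact: nbhs_gt_half.
by apply: filterS (nbhs_oside xT); exact: oside_cside.
Qed.

(** * Integral of a directional derivative as a difference of face integrals *)

Section FundamentalTheorem.
Variables (T : cuboid R) (i : 'I_3) (F h : R3 R -> R).
Hypotheses (cF : continuous F) (ch : continuous h).
Hypothesis Fh : forall x, is_derive x (unitv R i) F (h x).

Lemma int_oside_derive (a b : R) :
  \int[leb1 R]_(t in oside T i) h (pt3 i t a b) =
  F (pt3 i (hi T i) a b) - F (pt3 i (lo T i) a b).
Proof.
have cpt : continuous (fun t => pt3 i t a b).
  apply: continuous_crdP => m.
  rewrite (_ : (fun _ => _) = if m == i then id else cst (crd (pt3 i 0 a b) m)).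
    by case: ifP => _ x; [exact: cvg_id|exact: cvg_cst].
  by apply/funext => x; rewrite !crd_pt3; case: eqP.
have ch1 : continuous (fun t => h (pt3 i t a b)).
  by move=> t; exact: (continuous_comp (cpt t) (@ch _)).
have cF1 : continuous (fun t => F (pt3 i t a b)).
  by move=> t; exact: (continuous_comp (cpt t) (@cF _)).
have D (t : R) : is_derive t (1 : R) (fun s => F (pt3 i s a b)) (h (pt3 i t a b)).
  have /is_derive_upd := Fh (pt3 i t a b); rewrite crd_pt3 eqxx.
  by under eq_fun do rewrite upd_pt3.
(* The end points are negligible; the fundamental theorem is applied on the closed interval. *)
rewrite /Rintegral -(@integral_itv_bndoo _ _ _ _ true false); last first.
  apply/measurable_EFinP; apply: measurable_funTS.
  exact: continuous_measurable_fun.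
rewrite (@continuous_FTC2 _ _ (fun t => F (pt3 i t a b))) ?lo_lt_hi//.
- exact: continuous_subspaceT.
- split=> [t _||]; first exact: ex_derive.
    by apply: cvg_at_right_filter; exact: cF1.
  by apply: cvg_at_left_filter; exact: cF1.
- by move=> t _; rewrite derive1E derive_val.
Qed.

Lemma int_open_cell_derive : \int[leb3 R]_(x in open_cell T) h x =
  \int[leb2 R]_(u in oside T (ordS i) `*` oside T (ord_pred i))
    (F (pt3 i (hi T i) u.1 u.2) - F (pt3 i (lo T i) u.1 u.2)).
Proof.
set G := fun u : R * R => F (pt3 i (hi T i) u.1 u.2) - F (pt3 i (lo T i) u.1 u.2).
have cG : continuous G.
  have c a : continuous (fun u : R * R => F (pt3 i a u.1 u.2)).
    by move=> u; exact: (@continuous_comp _ _ _ (fun v : R * R => pt3 i a v.1 v.2) F u (@pt3_continuous i a u) (@cF _)).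
  by move=> u; apply: cvgB; exact: c.
have mG := continuous_measurable2 cG.
have mh := continuous_measurable3 ch.
have [M hM] := continuous_compact_le (@compact_cell T) ch.
have cR j l : compact (cside T j `*` cside T l) by apply: compact_setX; exact: compact_cside.
have [N GN] := continuous_compact_le (cR (ordS i) (ord_pred i)) cG.
have hM' x y z : oside T (inord 0) x -> oside T (inord 1) y -> oside T (inord 2) z ->
    `|h (x, y, z)| <= M.
  by move=> x0 x1 x2; apply: hM; apply: open_cell_cell; rewrite open_cellE.
have GN' y z : oside T (ordS i) y -> oside T (ord_pred i) z -> `|G (y, z)| <= N.
  by move=> yS zP; apply: GN; split; exact: oside_cside.
have IG a b : \int[leb1 R]_(t in oside T i) h (pt3 i t a b) = G (a, b).
  exact: int_oside_derive.
have m j := @measurable_oside T j; have f j := @oside_fin T j.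
have fin2 : (@leb2' R (oside T (inord 0) `*` oside T (inord 1)) < +oo)%E.
  exact: leb2_fin.
have mX := measurableX (m (inord 0)) (m (inord 1)).
have mh2 z : measurable_fun setT (fun u : M2 R => h (u, z)).
  by apply: measurableT_comp mh _; exact: measurable_pair2.
have hM3 u z : (oside T (inord 0) `*` oside T (inord 1)) u -> oside T (inord 2) z ->
    `|h (u, z)| <= M.
  by case: u => x y [/= ? ?] ?; exact: hM'.
rewrite open_cellE; clearbody G.
(* The direction [i] has to become the innermost integral. Its place in the nested triple decides
   the version of Fubini, and the cyclic order of the two face variables decides the one used for
   [G]. *)
case: (ord3_inord i) => ei; rewrite ei !ordS_inord !ord_pred_inord in IG mG GN' *.
- rewrite (@Rfubini2 _ _ _ _ _ (@leb2' R) (leb1 R) _ _ h M mX (m _) fin2 (f _) mh hM3).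

  rewrite (@Rfubini2 _ _ _ _ _ (leb1 R) (leb1 R) _ _ G N (m _) (m _) (f _) (f _) mG GN').
  apply: eq_Rintegral => z; rewrite inE => zT.
  rewrite (@Rfubini2 _ _ _ _ _ (leb1 R) (leb1 R) _ _ (fun u => h (u, z)) M
    (m _) (m _) (f _) (f _) (mh2 z)); last by move=> x y ? ?; exact: hM'.
  by apply: eq_Rintegral => y _; rewrite -IG; apply: eq_Rintegral => x _; rewrite pt3_inord.
- rewrite (@Rfubini2 _ _ _ _ _ (@leb2' R) (leb1 R) _ _ h M mX (m _) fin2 (f _) mh hM3).
  rewrite (@Rfubini1 _ _ _ _ _ (leb1 R) (leb1 R) _ _ G N (m _) (m _) (f _) (f _) mG GN').
  apply: eq_Rintegral => z; rewrite inE => zT.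
  rewrite (@Rfubini1 _ _ _ _ _ (leb1 R) (leb1 R) _ _ (fun u => h (u, z)) M
    (m _) (m _) (f _) (f _) (mh2 z)); last by move=> x y ? ?; exact: hM'.
  by apply: eq_Rintegral => y _; rewrite -IG; apply: eq_Rintegral => x _; rewrite pt3_inord.
- rewrite (@Rfubini1 _ _ _ _ _ (@leb2' R) (leb1 R) _ _ h M mX (m _) fin2 (f _) mh hM3).
  apply: eq_Rintegral => -[x y] _; rewrite -IG.
  by apply: eq_Rintegral => z _; rewrite pt3_inord.
Qed.

End FundamentalTheorem.

End CellIntegrals.

Lemma ord3_forall i (P : 'I_3 -> Prop) :
  P i -> P (ordS i) -> P (ord_pred i) -> forall m, P m.
Proof. by move=> Pi PS PP m; case/or3P: (ord3P i m) => /eqP ->. Qed.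

Lemma ord3_eq (i : 'I_3) : (((ordS i == i) = false) * ((ord_pred i == i) = false) *
  ((i == ordS i) = false)) * (((i == ord_pred i) = false) *
  ((ordS i == ord_pred i) = false) * ((ord_pred i == ordS i) = false)).
Proof.
by case: i => [[|[|[|//]]] ?]; do !split.
Qed.

Lemma ordSS (i : 'I_3) : ordS (ordS i) = ord_pred i.
Proof. by case: i => [[|[|[|//]]] ?]; apply/val_inj. Qed.

Lemma ordS_pred (i : 'I_3) : ordS (ord_pred i) = i.
Proof. by case: i => [[|[|[|//]]] ?]; apply/val_inj. Qed.

(** * Bilinearity of moments, uniformly for edges, faces and the cell *)

Section Moments.
Context d (X : measurableType d) (R : realType) (mu : {measure set X -> \bar R}).
Variables (D : set X) (iota : X -> R3 R).
Hypothesis mD : measurable D.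
Hypothesis iotaI : forall f : R3 R -> R, continuous f ->
  mu.-integrable D (EFin \o (fun x => f (iota x))).
Implicit Types f g p q : R3 R -> R.

Lemma mulf_continuous (T : topologicalType) (f g : T -> R) :
  continuous f -> continuous g -> continuous (f \* g).
Proof. by move=> cf cg x; apply: cvgM; [exact: cf|exact: cg]. Qed.

(** [iota] stands for the parametrisation of an edge or a face, or for the identity on the cell. *)
Lemma moment_linl a f g p : continuous f -> continuous g -> continuous p ->
  \int[mu]_(x in D) ((a *: f + g) (iota x) * p (iota x)) =
  a * (\int[mu]_(x in D) (f (iota x) * p (iota x))) +
  \int[mu]_(x in D) (g (iota x) * p (iota x)).
Proof.
move=> cf cg cp; rewrite -Rintegral_lin//.
- by apply: eq_Rintegral => x _; rewrite mulrA -mulrDl.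
- exact: (iotaI (mulf_continuous cf cp)).
- exact: (iotaI (mulf_continuous cg cp)).
Qed.

Lemma moment_linr a f p q : continuous f -> continuous p -> continuous q ->
  \int[mu]_(x in D) (f (iota x) * (a *: p + q) (iota x)) =
  a * (\int[mu]_(x in D) (f (iota x) * p (iota x))) +
  \int[mu]_(x in D) (f (iota x) * q (iota x)).
Proof.
move=> cf cp cq; rewrite -Rintegral_lin//.
- by apply: eq_Rintegral => x _; rewrite mulrCA -mulrDr.
- exact: (iotaI (mulf_continuous cf cp)).
- exact: (iotaI (mulf_continuous cf cq)).
Qed.

Lemma moment_eq0 f p : (forall x, D x -> f (iota x) = 0) ->
  \int[mu]_(x in D) (f (iota x) * p (iota x)) = 0.
Proof.
move=> f0; rewrite (@eq_Rintegral _ _ _ _ _ (fun=> 0)).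
  by rewrite /Rintegral integral0.
by move=> x; rewrite inE => Dx; rewrite f0 ?mul0r.
Qed.

End Moments.

(** * Moments on one cell: nondegeneracy, and vanishing on edges and faces *)

Section CellMoments.
Variables (R : realType) (T : cuboid R).
Implicit Types (f g p q w : R3 R -> R) (e : edge_ix) (F : face_ix) (d : 'I_3 -> nat).

Lemma edge_iotaI e f : continuous f ->
  (leb1 R).-integrable (edge_dom T e) (EFin \o (fun t => f (edge_pt T e t))).
Proof.
move=> cf; apply: cside_integrable => t.
exact: (@continuous_comp _ _ _ (edge_pt T e) f t (@edge_pt_continuous _ T e t) (cf _)).
Qed.

Lemma face_iotaI F f : continuous f ->
  (leb2 R).-integrable (face_dom T F) (EFin \o (fun t => f (face_pt T F t))).
Proof.
move=> cf; apply: rect_integrable => t.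
exact: (@continuous_comp _ _ _ (face_pt T F) f t (@face_pt_continuous _ T F t) (cf _)).
Qed.

Lemma edge_moment_linl e a f g p : continuous f -> continuous g -> continuous p ->
  edge_moment T e (a *: f + g) p = a * edge_moment T e f p + edge_moment T e g p.
Proof.
exact: (@moment_linl _ _ _ (leb1 R) _ (edge_pt T e) (@measurable_cside R T (edge_dir e)) (@edge_iotaI e)).
Qed.

Lemma face_moment_linl F a f g p : continuous f -> continuous g -> continuous p ->
  face_moment T F (a *: f + g) p = a * face_moment T F f p + face_moment T F g p.
Proof.
exact: (@moment_linl _ _ _ (leb2 R) _ (face_pt T F) (@measurable_rect R T (ordS F.1) (ord_pred F.1)) (@face_iotaI F)).
Qed.

Lemma cell_moment_linl a f g p : continuous f -> continuous g -> continuous p ->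
  cell_moment T (a *: f + g) p = a * cell_moment T f p + cell_moment T g p.
Proof.
exact: (@moment_linl _ _ _ (leb3 R) _ id (@measurable_cell R T) (@cell_integrable R T)).
Qed.

Lemma edge_moment_test_linear k e f : continuous f ->
  linear_on (edge_test k e) (edge_moment T e f).
Proof.
move=> cf a u v /Q_continuous cu /Q_continuous cv.
exact: (@moment_linr _ _ _ (leb1 R) _ (edge_pt T e) (@measurable_cside R T (edge_dir e)) (@edge_iotaI e)).
Qed.

Lemma face_moment_test_linear d F f : continuous f ->
  linear_on (Q d) (face_moment T F f).
Proof.
move=> cf a u v /Q_continuous cu /Q_continuous cv.
exact: (@moment_linr _ _ _ (leb2 R) _ (face_pt T F) (@measurable_rect R T (ordS F.1) (ord_pred F.1)) (@face_iotaI F)).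
Qed.

Lemma cell_moment_test_linear d f : continuous f ->
  linear_on (Q d) (cell_moment T f).
Proof.
move=> cf a u v /Q_continuous cu /Q_continuous cv.
exact: (@moment_linr _ _ _ (leb3 R) _ id (@measurable_cell R T) (@cell_integrable R T)).
Qed.

Lemma crd_edge_pt e t m : crd (edge_pt T e t) m = if m == edge_dir e then t
  else bnd T m (if m == ordS (edge_dir e) then e.1.2 else e.2).
Proof.
rewrite /edge_pt crd_pt3; case: eqP => // /eqP me; case: eqP => [->//|/eqP mS].
by have := ord3P (edge_dir e) m; rewrite (negbTE me) (negbTE mS) => /eqP ->.
Qed.

Lemma crd_face_pt F u m : crd (face_pt T F u) m =
  if m == F.1 then bnd T m F.2 else if m == ordS F.1 then u.1 else u.2.
Proof. by rewrite /face_pt crd_pt3; case: eqP => [->|]. Qed.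

Definition vside (v : vert_ix) (m : 'I_3) : bool :=
  if m == inord 0 then v.1.1 else if m == inord 1 then v.1.2 else v.2.

Lemma crd_vertex v m : crd (vertex T v) m = bnd T m (vside v m).
Proof.
by case: (ord3_inord m) => ->; rewrite crd_inord /vside ?inord_eq ?eqxx.
Qed.

Lemma vertexP x : (forall m, exists b, crd x m = bnd T m b) ->
  exists v, x = vertex T v.
Proof.
move=> h; have [b0 e0] := h (inord 0); have [b1 e1] := h (inord 1).
have [b2 e2] := h (inord 2); exists (b0, b1, b2); apply: crd_inj => m.
by case: (ord3_inord m) => ->; rewrite crd_vertex /vside ?inord_eq ?eqxx.
Qed.

Lemma bnd_itv m b : lo T m <= bnd T m b <= hi T m.
Proof. by have := ltW (lo_lt_hi T m); case: b => /=; rewrite lexx => ->. Qed.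

Lemma sq_mul0 (a b : R) : 0 < a -> a * b * b = 0 -> b = 0.
Proof.
move=> a0 /eqP; rewrite -mulrA mulf_eq0 gt_eqF//= mulf_eq0 orbb => /eqP //.
Qed.

Lemma sq_mul_ge0 (a b : R) : 0 <= a -> 0 <= a * b * b.
Proof. by move=> a0; rewrite -mulrA mulr_ge0// -expr2 sqr_ge0. Qed.

(** The integrand is [w] times a square, so [p] vanishes inside the edge. Being constant in the two
    other variables, [p] then vanishes on the open cell, hence everywhere. *)
Lemma edge_nondeg e d w p : Q d p -> d (ordS e.1.1) = 0%N ->
  d (ord_pred e.1.1) = 0%N -> continuous w ->
  (forall t, cside T e.1.1 t -> 0 <= w (edge_pt T e t)) ->
  (forall t, oside T e.1.1 t -> 0 < w (edge_pt T e t)) ->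
  edge_moment T e (w \* p) p = 0 -> p = 0.
Proof.
move=> pQ dS dP cw w0 w1 m0.
apply: (Q_eq0_open pQ (T := T)) => x xT.
have cp := Q_continuous pQ.
have cc : continuous (fun t => ((w \* p) \* p) (edge_pt T e t)).
  move=> t; apply: (@continuous_comp _ _ _ (edge_pt T e) ((w \* p) \* p)).
    exact: edge_pt_continuous.
  by do 2?apply: mulf_continuous.
have tT : oside T e.1.1 (crd x e.1.1) by rewrite /oside /= in_itv/=; exact: xT.
have tx : edge_pt T e (crd x e.1.1) =
    upd (upd x (ordS e.1.1) (bnd T (ordS e.1.1) e.1.2)) (ord_pred e.1.1)
      (bnd T (ord_pred e.1.1) e.2).
  apply: crd_inj => m; rewrite crd_edge_pt !crd_upd; move: m.
  by apply: (ord3_forall (i := e.1.1)); rewrite ?eqxx !ord3_eq.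
have /sq_mul0 : ((w \* p) \* p) (edge_pt T e (crd x e.1.1)) = 0.
  apply: (cside_int_eq0 cc _ m0 tT) => t' t'T.
  by apply: sq_mul_ge0; exact: w0.
by rewrite {2}tx !(Q_upd0 _ _ _ pQ)//; apply; exact: w1.
Qed.

Lemma face_nondeg F d w p : Q d p -> d F.1 = 0%N -> continuous w ->
  (forall u, (cside T (ordS F.1) `*` cside T (ord_pred F.1)) u ->
     0 <= w (face_pt T F u)) ->
  (forall u, (oside T (ordS F.1) `*` oside T (ord_pred F.1)) u ->
     0 < w (face_pt T F u)) ->
  face_moment T F (w \* p) p = 0 -> p = 0.
Proof.
move=> pQ dF cw w0 w1 m0.
apply: (Q_eq0_open pQ (T := T)) => x xT.
have cp := Q_continuous pQ.
have cc : continuous (fun t => ((w \* p) \* p) (face_pt T F t)).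
  move=> t; apply: (@continuous_comp _ _ _ (face_pt T F) ((w \* p) \* p)).
    exact: face_pt_continuous.
  by do 2?apply: mulf_continuous.
pose u := (crd x (ordS F.1), crd x (ord_pred F.1)).
have uT : (oside T (ordS F.1) `*` oside T (ord_pred F.1)) u.
  by split; rewrite /oside /= in_itv/=; exact: xT.
have ux : face_pt T F u = upd x F.1 (bnd T F.1 F.2).
  apply: crd_inj => m; rewrite crd_face_pt crd_upd; move: m.
  by apply: (ord3_forall (i := F.1)); rewrite ?eqxx ?ord3_eq.
have /sq_mul0 : ((w \* p) \* p) (face_pt T F u) = 0.
  apply: (rect_int_eq0 cc _ m0 uT) => v vT.
  by apply: sq_mul_ge0; exact: w0.
by rewrite {2}ux (Q_upd0 _ _ _ pQ)//; apply; exact: w1.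
Qed.

Lemma cell_nondeg d w p : Q d p -> continuous w ->
  (forall x, cell T x -> 0 <= w x) -> (forall x, open_cell T x -> 0 < w x) ->
  cell_moment T (w \* p) p = 0 -> p = 0.
Proof.
move=> pQ cw w0 w1 m0.
apply: (Q_eq0_open pQ (T := T)) => x xT.
have cp := Q_continuous pQ.
have cc : continuous ((w \* p) \* p) by do 2?apply: mulf_continuous.
have /sq_mul0 : ((w \* p) \* p) x = 0.
  by apply: (cell_int_eq0 cc _ m0 xT) => y yT; apply: sq_mul_ge0; exact: w0.
by apply; exact: w1.
Qed.

(** Vanishing at both ends, the trace on the edge is a bubble times a polynomial of degree (k-1) - 2
    = k-3. That quotient is an admissible test function, and testing with it shows that it is
    zero. *)
Lemma edge_vanish k e d f : (3 <= k)%N -> Q d f -> (d e.1.1 <= k - 1)%N ->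
  (forall b, f (edge_pt T e (bnd T e.1.1 b)) = 0) ->
  (forall p, edge_test k e p -> edge_moment T e f p = 0) ->
  forall t, f (edge_pt T e t) = 0.
Proof.
move=> k3 fQ dk f0 mf.
pose S := ordS e.1.1; pose P := ord_pred e.1.1.
(* The trace, extended constantly in the two other directions so as to remain a polynomial on
   R^3. *)
pose f' x := f (upd (upd x S (bnd T S e.1.2)) P (bnd T P e.2)).
have f'Q : Q (dset (dset d P 0) S 0) f'.
  exact: (Q_upd _ _ (Q_upd _ _ fQ)).
have f'e x : f' x = f (edge_pt T e (crd x e.1.1)).
  congr f; apply: crd_inj => m; rewrite crd_edge_pt !crd_upd; move: m.
  by apply: (ord3_forall (i := e.1.1)); rewrite /S /P ?eqxx ?ord3_eq.
have [|g gQ fg] := @Q_bub_div _ _ e.1.1 T _ f'Q.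
  by move=> x b; rewrite f'e crd_upd eqxx.
suff g0 : g = 0.
  move=> t; have := f'e (edge_pt T e t); rewrite crd_edge_pt eqxx => <-.
  by rewrite fg g0 /= mulr0.
have gt : edge_test k e g.
  apply: Q_le gQ; apply: (ord3_forall (i := e.1.1));
    rewrite /dset /S /P /edge_dir ?eqxx ?ord3_eq ?eqxx //.
  by move: dk k3; clear; lia.
apply: (edge_nondeg gQ (e := e) (w := bub T e.1.1)).
- by rewrite /dset ?eqxx ?ord3_eq ?eqxx.
- by rewrite /dset ?eqxx ?ord3_eq ?eqxx.
- exact: Q_continuous (Q_bub T _).
- by move=> t tT; apply: bub_ge0; rewrite crd_edge_pt eqxx; move: tT; rewrite /cside /= in_itv.
- by move=> t tT; apply: bub_gt0; rewrite crd_edge_pt eqxx; move: tT; rewrite /oside /= in_itv.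
rewrite -[RHS](mf _ gt); apply: eq_Rintegral => t _; congr (_ * _).
by rewrite -fg f'e crd_edge_pt eqxx.
Qed.

(** The same idea with two bubbles: vanishing on the boundary lines of the face, the trace is
    divisible by both, and the quotient has degree at most k-3 in each face variable. *)
Lemma face_vanish k F d f : (3 <= k)%N -> Q d f -> (forall m, d m <= k - 1)%N ->
  (forall x m b, m != F.1 -> crd x F.1 = bnd T F.1 F.2 -> crd x m = bnd T m b -> f x = 0) ->
  (forall p, diag_face_test k F p -> face_moment T F f p = 0) ->
  forall x, crd x F.1 = bnd T F.1 F.2 -> f x = 0.
Proof.
move=> k3 fQ dk f0 mf.
pose S := ordS F.1; pose P := ord_pred F.1.
pose f' x := f (upd x F.1 (bnd T F.1 F.2)).
have f'Q : Q (dset d F.1 0) f' by exact: Q_upd.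
have [|g gQ fg] := @Q_bub_div _ _ S T _ f'Q.
  by move=> x b; apply: (f0 _ S b); rewrite /S ?ord3_eq// !crd_upd ?ord3_eq ?eqxx ?ord3_eq ?eqxx.
have [|h hQ gh] := @Q_bub_div _ _ P T _ gQ.
  move=> y b; have gQ' := Q_upd P (bnd T P b) gQ.
  rewrite -[LHS]/((fun z => g (upd z P (bnd T P b))) y).
  (* The trace vanishes, but [g] inherits this only where the first bubble is nonzero. The open cell
     suffices, because the restriction of [g] to the plane is a polynomial. *)
  rewrite (Q_eq0_open gQ' (T := T))// => x xT.
  have : f' (upd x P (bnd T P b)) = 0.
    by apply: (f0 _ P b); rewrite /P ?ord3_eq// !crd_upd ?ord3_eq ?eqxx ?ord3_eq ?eqxx.
  rewrite fg /= /bub crd_upd /P /S ord3_eq => /eqP; rewrite mulf_eq0 => /orP[|/eqP//].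
  by rewrite (gt_eqF (bub_gt0 (xT (ordS F.1)))).
suff h0 : h = 0.
  move=> x xF; have : f' x = f x by rewrite /f' -xF upd_id.
  by move=> <-; rewrite fg gh h0 /= !mulr0.
have ht : diag_face_test k F h.
  apply: Q_le hQ; apply: (ord3_forall (i := F.1));
    rewrite /dset /S /P /face_normal ?eqxx ?ord3_eq ?eqxx //.
    by move: (dk (ordS F.1)) k3; clear; lia.
  by move: (dk (ord_pred F.1)) k3; clear; lia.
apply: (face_nondeg hQ (F := F) (w := bub T S \* bub T P)).
- by rewrite /dset /S /P ?eqxx ?ord3_eq ?eqxx.
- by apply: mulf_continuous; exact: Q_continuous (Q_bub T _).
- move=> u [u1 u2]; apply: mulr_ge0; apply: bub_ge0; rewrite crd_face_pt /S /P ?ord3_eq ?eqxx.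
    by move: u1; rewrite /cside /= in_itv.
  by move: u2; rewrite /cside /= in_itv.
- move=> u [u1 u2]; apply: mulr_gt0; apply: bub_gt0; rewrite crd_face_pt /S /P ?ord3_eq ?eqxx.
    by move: u1; rewrite /oside /= in_itv.
  by move: u2; rewrite /oside /= in_itv.
rewrite -[RHS](mf _ ht); apply: eq_Rintegral => u _; congr (_ * _).
have -> : f (face_pt T F u) = f' (face_pt T F u).
  congr f; apply: crd_inj => m; rewrite crd_upd crd_face_pt.
  by case: eqP => // ->.
by rewrite fg gh /= mulrA.
Qed.

(** Vertex values give vanishing at the ends of the edges, edge moments then give vanishing along
    the edges of the face, and face moments do the rest. Everything used is attached to the face, so
    the lemma serves for unisolvence and for trace continuity alike. *)
Lemma diag_face_vanish k i b d f : (3 <= k)%N -> Q d f -> (forall m, d m <= k - 1)%N ->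
  (forall v, crd (vertex T v) i = bnd T i b -> f (vertex T v) = 0) ->
  (forall e p, (forall t, crd (edge_pt T e t) i = bnd T i b) -> edge_test k e p ->
     edge_moment T e f p = 0) ->
  (forall p, diag_face_test k (i, b) p -> face_moment T (i, b) f p = 0) ->
  forall x, crd x i = bnd T i b -> f x = 0.
Proof.
move=> k3 fQ dk vf ef ff; apply: (@face_vanish k (i, b) d) => //= x m c mi xi xm.
have edge e t : (forall t, crd (edge_pt T e t) i = bnd T i b) -> f (edge_pt T e t) = 0.
  move=> ei; apply: (@edge_vanish k _ d) => // [c'|p pt]; last exact: ef.
  have [v vE] : exists v, edge_pt T e (bnd T e.1.1 c') = vertex T v.
    apply: vertexP => l; rewrite crd_edge_pt; case: eqP => [->|_]; first by exists c'.
    by eexists.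
  by rewrite vE; apply: vf; rewrite -vE.
have /orP[/eqP mS|/eqP mP] : (m == ordS i) || (m == ord_pred i).
  by have := ord3P i m; rewrite (negbTE mi).
(* For an edge in direction [ord_pred i], the first side flag refers to [i] and the second to
   [ordS i]. *)
- have -> : x = edge_pt T (ord_pred i, b, c) (crd x (ord_pred i)).
    apply: crd_inj => l; rewrite crd_edge_pt /=; move: l.
    by apply: (ord3_forall (i := i)); rewrite ?ordS_pred ?ord3_eq ?eqxx -?mS ?xi ?xm ?ord3_eq.
  by apply: edge => t; rewrite crd_edge_pt /= ordS_pred ord3_eq eqxx.
(* For direction [ordS i] the flags refer to [ord_pred i] and then to [i], so [b] and [c] change
   places. *)
- have -> : x = edge_pt T (ordS i, c, b) (crd x (ordS i)).
    apply: crd_inj => l; rewrite crd_edge_pt /=; move: l.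
    by apply: (ord3_forall (i := i)); rewrite ?ordSS ?ord3_eq ?eqxx -?mP ?xi ?xm ?ord3_eq.
  by apply: edge => t; rewrite crd_edge_pt /= ordSS !ord3_eq.
Qed.

End CellMoments.

(** * Unisolvence *)

Section Unisolvence.
Variables (R : realType) (k : nat) (k3 : (3 <= k)%N) (T : cuboid R).
Implicit Types (g p q : R3 R -> R) (tau : R3 R -> 'M[R]_3).

Lemma entry_lin (a : R) (u v : R3 R -> 'M[R]_3) i j :
  entry (a *: u + v) i j = a *: entry u i j + entry v i j.
Proof.
apply/funext => x; rewrite /entry -[(a *: u + v) x]/(a *: u x + v x) !mxE.
by [].
Qed.

Lemma Xi_subspace : subspace_closed (@Xi R k).
Proof.
split=> [|a u v [u1 u2 u3] [v1 v2 v3]].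
  have e0 i j : entry (0 : R3 R -> 'M[R]_3) i j = 0.
    by apply/funext => x; rewrite /entry -[(0 : _ -> _) x]/(0 : 'M[R]_3) mxE.
  by split=> *; [exact: mxtrace0|rewrite e0; exact: Q0|rewrite e0; exact: Q0].
split=> [x|i|i j ij].
- by rewrite -[(a *: u + v) x]/(a *: u x + v x) mxtraceD mxtraceZ u1 v1 mulr0 addr0.
- by rewrite entry_lin; exact: Q_lin.
- by rewrite entry_lin; apply: Q_lin; [exact: u3|exact: v3].
Qed.

Lemma Xi_entryQ tau i j : Xi k tau -> exists d, Q d (entry tau i j).
Proof.
move=> [_ t2 t3]; have [<-|ij] := eqVneq i j; first by eexists; exact: t2.
by eexists; exact: t3 ij.
Qed.

Lemma Xi_continuous tau i j : Xi k tau -> continuous (entry tau i j).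
Proof. by move=> /(@Xi_entryQ _ i j)[d]; exact: Q_continuous. Qed.

Lemma Xi_trace tau x : Xi k tau -> \sum_i entry tau i i x = 0.
Proof. by case=> + _ _; exact. Qed.

Definition diagf (f : 'I_3 -> R3 R -> R) (x : R3 R) : 'M[R]_3 :=
  diag_mx (\row_m f m x).

Lemma entry_diagf f i j : entry (diagf f) i j = if i == j then f i else 0.
Proof.
apply/funext => x; rewrite /entry /diagf !mxE.
by case: eqP => [->|_]; rewrite ?mulr1n ?mulr0n.
Qed.

Lemma diagf_Xi f : (forall i, Q (fun=> (k - 1)%N) (f i)) ->
  (forall x, \sum_i f i x = 0) -> Xi k (diagf f).
Proof.
move=> fQ f0; split=> [x|i|i j ij]; rewrite ?entry_diagf ?eqxx//.
  by rewrite mxtrace_diag -[RHS](f0 x); apply: eq_bigr => i _; rewrite mxE.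
by rewrite (negbTE ij); exact: Q0.
Qed.

Definition offf (i j : 'I_3) g (x : R3 R) : 'M[R]_3 := g x *: delta_mx i j.

Lemma entry_offf i j g i' j' :
  entry (offf i j g) i' j' = if (i' == i) && (j' == j) then g else 0.
Proof.
apply/funext => x; rewrite /entry /offf !mxE.
by case: ifP; rewrite ?mulr1 ?mulr0.
Qed.

Lemma offf_Xi i j g : i != j -> Q (deg3 i (k - 2) j k (k - 1)) g -> Xi k (offf i j g).
Proof.
move=> ij gQ.
have d0 m : (m == i) && (m == j) = false.
  by apply/negbTE; apply: contraNN ij => /andP[/eqP <- /eqP <-].
split=> [x|m|i' j' ij'].
- by rewrite /mxtrace big1// => m _; have := congr1 (@^~ x) (entry_offf i j g m m); rewrite d0.
- by rewrite entry_offf d0; exact: Q0.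
- rewrite entry_offf; case: ifP => [/andP[/eqP -> /eqP ->]//|_]; exact: Q0.
Qed.

(** At vertices and on edges [o] is the omitted entry, so the compensating [-g] required by the
    trace is invisible to the functionals that are counted. *)
Definition pairf (i o : 'I_3) g := diagf (fun m => ((m == i)%:R - (m == o)%:R) *: g).

Lemma pairf_Xi i o g : Q (fun=> (k - 1)%N) g -> Xi k (pairf i o g).
Proof.
move=> gQ; apply: diagf_Xi => [m|x].
  by rewrite -[_ *: g]addr0; apply: Q_lin => //; exact: Q0.
have e m : (((m == i)%:R - (m == o)%:R) *: g) x = ((m == i)%:R - (m == o)%:R) * g x by [].
rewrite (eq_bigr _ (fun m _ => e m)) -mulr_suml sumrB.
have s1 n : \sum_(m < 3) ((m == n)%:R : R) = 1.
  by rewrite (bigD1 n)//= eqxx big1 ?addr0// => m /negbTE ->.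
by rewrite !s1 subrr mul0r.
Qed.

Lemma entry_pairf i o g m : entry (pairf i o g) m m = ((m == i)%:R - (m == o)%:R) *: g.
Proof. by rewrite entry_diagf eqxx. Qed.

Lemma edge_momentZ e a g p : continuous g -> continuous p ->
  edge_moment T e (a *: g) p = a * edge_moment T e g p.
Proof.
move=> cg cp; have m0 : edge_moment T e 0 p = 0 by apply: moment_eq0.
rewrite -[a *: g]addr0 edge_moment_linl ?m0 ?addr0//.
by move=> x; exact: cvg_cst.
Qed.

(** The trilinear nodal function of the vertex [v]. *)
Definition hatv (v : vert_ix) : R3 R -> R :=
  hat T (inord 0) v.1.1 \* hat T (inord 1) v.1.2 \* hat T (inord 2) v.2.

Lemma Q_hatv v : Q (fun=> (k - 1)%N) (hatv v).
Proof.
apply: Q_le (Q_mul (Q_mul (Q_hat T _ _) (Q_hat T _ _)) (Q_hat T _ _)) => m.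
case: (ord3_inord m) => ->; rewrite /dset !inord_eq !eqxx /=; move: k3; clear; lia.
Qed.

Lemma hatv_vertex v v' : hatv v (vertex T v') = (v' == v)%:R.
Proof.
rewrite /hatv /= !(hat_bnd _ (crd_vertex T v' _)) /vside !inord_eq !eqxx.
case: v v' => [[a b] c] [[a' b'] c'] /=; rewrite -!natrM !mulnb.
by rewrite -!pair_eqE /=.
Qed.

Variable D : dof_choice k T.

Lemma mem_all_but (i o : 'I_3) : (i \in all_but o) = (i != o).
Proof. by rewrite mem_filter mem_enum andbT. Qed.

Lemma uniq_all_but o : uniq (all_but o).
Proof. exact: filter_uniq (enum_uniq _). Qed.

Lemma pair_coef (i o m : 'I_3) : m != o -> (m == i)%:R - (m == o)%:R = (m == i)%:R :> R.
Proof. by move=> /negbTE ->; rewrite subr0. Qed.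

Lemma vertex_dofs_indep : indep (Xi k) (vertex_dofs D).
Proof.
pose Y v : set (R3 R -> 'M[R]_3) := [set tau | Xi k tau /\ forall v' i, v' != v ->
  entry tau i i (vertex T v') = 0].
apply: (@indep_flatten _ _ _ _ _ _ Y); first exact: enum_uniq.
- by move=> v _ tau [].
- move=> v _; apply: indep_map; first exact: uniq_all_but.
  move=> i; rewrite mem_all_but => io.
  exists (pairf i (vert_omit D v) (hatv v)).
    split; first exact/pairf_Xi/Q_hatv.
    move=> v' m v'v; rewrite entry_pairf.
    by rewrite -[LHS]/(_ * hatv v (vertex T v')) hatv_vertex (negbTE v'v) mulr0.
  split.
    rewrite entry_pairf pair_coef// eqxx scale1r hatv_vertex eqxx; exact: oner_neq0.
  move=> m; rewrite mem_all_but => mo im.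
  by rewrite entry_pairf pair_coef// eq_sym (negbTE im) scale0r.
- move=> v v' _ _ vv' tau [_ h] f /mapP[i _ ->]; apply: h; by rewrite eq_sym.
Qed.

Lemma edge_two_bnd e t : exists m1 m2 b1 b2, [/\ m1 != m2,
  crd (edge_pt T e t) m1 = bnd T m1 b1 & crd (edge_pt T e t) m2 = bnd T m2 b2].
Proof.
exists (ordS e.1.1), (ord_pred e.1.1), e.1.2, e.2.
by rewrite !crd_edge_pt /edge_dir !ord3_eq eqxx.
Qed.

(** The bubble makes it vanish at the vertices and on edges of other directions; the hats are 1 on
    [e] and remove the parallel edges. The degree along [e] is 2 + (k-3) = k-1. *)
Definition edgef (e : edge_ix) q : R3 R -> R :=
  (bub T e.1.1 \* q) \* (hat T (ordS e.1.1) e.1.2 \* hat T (ord_pred e.1.1) e.2).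

Lemma Q_edgef e q : edge_test k e q -> Q (fun=> (k - 1)%N) (edgef e q).
Proof.
move=> qt.
apply: Q_le (Q_mul (Q_mul (Q_bub T _) qt) (Q_mul (Q_hat T _ _) (Q_hat T _ _))).
apply: (ord3_forall (i := e.1.1)); rewrite /dset /edge_dir !ord3_eq !eqxx /=;
  move: k3; clear; lia.
Qed.

Lemma edgef_bnd e q x b : crd x e.1.1 = bnd T e.1.1 b -> edgef e q x = 0.
Proof. by move=> xb; rewrite /edgef /= (bub_bnd xb) !mul0r. Qed.

Lemma edgef_pt e q t : edgef e q (edge_pt T e t) = (bub T e.1.1 \* q) (edge_pt T e t).
Proof.
rewrite /edgef /= (@hat_bnd _ _ _ _ e.1.2) ?(@hat_bnd _ _ _ _ e.2) ?eqxx ?mulr1//.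
  by rewrite crd_edge_pt /edge_dir !ord3_eq.
by rewrite crd_edge_pt /edge_dir !ord3_eq eqxx.
Qed.

Lemma edgef_other e e' q t : e' != e -> edgef e q (edge_pt T e' t) = 0.
Proof.
have [ee|ee] := eqVneq e.1.1 e'.1.1; last first.
  by move=> _; apply: edgef_bnd; rewrite crd_edge_pt /edge_dir (negbTE ee).
case: e e' ee => [[i a] b] [[i' a'] b'] /= <-.
rewrite !xpair_eqE eqxx /= negb_and => ab; rewrite /edgef /=.
rewrite (@hat_bnd _ _ _ _ a') ?(@hat_bnd _ _ _ _ b').
- by move: ab => /orP[|] /negbTE ->; rewrite ?mul0r ?mulr0.
- by rewrite crd_edge_pt /edge_dir /= !ord3_eq.
- by rewrite crd_edge_pt /edge_dir /= !ord3_eq eqxx.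
Qed.

Lemma edge_testQ e p : edge_test k e p -> continuous p.
Proof. exact: Q_continuous. Qed.

Lemma bub_edge_nondeg e p : edge_test k e p ->
  edge_moment T e (bub T e.1.1 \* p) p = 0 -> p = 0.
Proof.
move=> pt; apply: (edge_nondeg pt (T := T) (e := e)).
- by rewrite /edge_dir ord3_eq.
- by rewrite /edge_dir ord3_eq.
- exact: Q_continuous (Q_bub T _).
- by move=> t tT; apply: bub_ge0; rewrite crd_edge_pt eqxx; move: tT; rewrite /cside /= in_itv.
- by move=> t tT; apply: bub_gt0; rewrite crd_edge_pt eqxx; move: tT; rewrite /oside /= in_itv.
Qed.

(** Start of the descending chain [kerV], [kerE], [kerF], [kerB] in which the successive blocks are
    tested. *)
Definition kerV : set (R3 R -> 'M[R]_3) := [set tau | Xi k tau /\ kills (vertex_dofs D) tau].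

(** Since the omitted entry depends on the test function, [indep_basis] cannot be applied entry by
    entry. A family [q] dual to the test basis for the bubble-weighted pairing yields fields seen by
    a single test function, and the compensating entry is chosen for that one. *)
Lemma edge_dofs_indep : indep kerV (edge_dofs D).
Proof.
pose Y e : set (R3 R -> 'M[R]_3) := [set tau | kerV tau /\ forall e' i p, e' != e ->
  edge_moment T e' (entry tau i i) p = 0].
apply: (@indep_flatten _ _ _ _ _ _ Y); first exact: enum_uniq.
- by move=> e _ tau [].
- move=> e _.
  set b := edge_basis D e; pose L q p := edge_moment T e (bub T e.1.1 \* q) p.
  have cb := Q_continuous (Q_bub T e.1.1).
  have indL : indep (edge_test k e) [seq L^~ p | p <- b].
    apply: (indep_basis (Q_subspace R _) (edge_basisP D e)).
      move=> q qt; apply: edge_moment_test_linear.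
      by apply: mulf_continuous => //; exact: edge_testQ qt.
    by move=> p pt h; apply: (bub_edge_nondeg pt); exact: h.
  have bt n : (n < size b)%N -> edge_test k e b`_n.
    by move=> nb; exact: ((edge_basisP D e).1 (Ordinal nb)).
  have [|q qP] := dual_basis (Q_subspace R _) _ indL.
    move=> f /mapP[p pb ->] a u v ut vt; rewrite /L.
    rewrite (_ : _ \* _ = a *: (bub T e.1.1 \* u) + (bub T e.1.1 \* v)).
      move: pb => /(nthP 0)[n nb <-].
      by apply: edge_moment_linl; [apply: mulf_continuous|apply: mulf_continuous|] => //;
        apply: edge_testQ; [exact: ut|exact: vt|exact: bt].
    by apply/funext => x; rewrite /= -[(a *: u + v) x]/(a * u x + v x) mulrDr mulrCA.
  rewrite size_map in qP.
  (* Blocks are indexed by positions in the basis, which are plainly distinct. *)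
  have -> : [seq (fun tau => edge_moment T e (entry tau i i) p) | p <- b,
      i <- all_but (edge_omit D e p)] =
    flatten [seq [seq (fun tau => edge_moment T e (entry tau i i) b`_n) |
      i <- all_but (edge_omit D e b`_n)] | n <- iota 0 (size b)].
    by rewrite -[in LHS](mkseq_nth 0 b) /mkseq -map_comp.
  pose Z n : set (R3 R -> 'M[R]_3) := [set tau | Y e tau /\ forall n' i,
    (n' < size b)%N -> n' != n -> edge_moment T e (entry tau i i) b`_n' = 0].
  apply: (@indep_flatten _ _ _ _ _ _ Z); first exact: iota_uniq.
  + by move=> n _ tau [].
  + move=> n; rewrite mem_iota add0n => /andP[_ nb]; have [qt qE] := qP n nb.
    have cq := edge_testQ qt; have cE : continuous (edgef e (q n)).
      exact: Q_continuous (Q_edgef qt).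
    have mE n' m i o : (n' < size b)%N ->
        edge_moment T e (entry (pairf i o (edgef e (q n))) m m) b`_n' =
        ((m == i)%:R - (m == o)%:R) * (n' == n)%:R.
      move=> nb'; rewrite entry_pairf edge_momentZ//; last exact: edge_testQ (bt _ nb').
      congr (_ * _); rewrite -qE// (nth_map 0)//; apply: eq_Rintegral => t _.
      by rewrite edgef_pt.
    apply: indep_map; first exact: uniq_all_but.
    move=> i; rewrite mem_all_but => io.
    exists (pairf i (edge_omit D e b`_n) (edgef e (q n))).
      split; last by move=> n' m nb' nn; rewrite mE// (negbTE nn) mulr0.
      split; last first.
        move=> e' m p ee; apply: moment_eq0 => t _; rewrite entry_pairf.
        by rewrite -[LHS]/(_ * edgef e (q n) (edge_pt T e' t)) edgef_other// mulr0.
      split; first exact/pairf_Xi/Q_edgef.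
      move=> f /allpairsPdep[v [m [_ _ ->]]]; rewrite entry_pairf.
      rewrite -[LHS]/(_ * edgef e (q n) (vertex T v)).
      by rewrite (edgef_bnd _ (crd_vertex T v _)) mulr0.
    split; first by rewrite mE// pair_coef// !eqxx mulr1 oner_neq0.
    move=> m; rewrite mem_all_but => mo im.
    by rewrite mE// pair_coef// eq_sym (negbTE im) mul0r.
  + move=> n n'; rewrite !mem_iota !add0n => /andP[_ nb] /andP[_ nb'] nn tau [_ h].
    by move=> f /mapP[i _ ->]; apply: h => //; rewrite eq_sym.
- move=> e e' _ _ ee tau [_ h] f /allpairsPdep[p [i [_ _ ->]]]; apply: h.
  by rewrite eq_sym.
Qed.

(** Bubbles in the face variables kill all edges and all faces of other normals; the hat kills the
    opposite face. The degree in each face variable is at most 2 + (k-3) = k-1. *)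
Definition facef (F : face_ix) p : R3 R -> R :=
  (bub T (ordS F.1) \* bub T (ord_pred F.1)) \* (hat T F.1 F.2 \* p).

Lemma Q_facef F p : diag_face_test k F p -> Q (fun=> (k - 1)%N) (facef F p).
Proof.
move=> pt.
apply: Q_le (Q_mul (Q_mul (Q_bub T _) (Q_bub T _)) (Q_mul (Q_hat T _ _) pt)).
apply: (ord3_forall (i := F.1)); rewrite /dset /face_normal !ord3_eq !eqxx /=;
  move: k3; clear; lia.
Qed.

Lemma facef_bnd F p m b x : m != F.1 -> crd x m = bnd T m b -> facef F p x = 0.
Proof.
move=> mF xm; rewrite /facef /=; have := ord3P F.1 m; rewrite (negbTE mF) /=.
by move=> /orP[] /eqP mE; rewrite -mE (bub_bnd xm) ?mul0r ?mulr0 ?mul0r.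
Qed.

Definition kerE : set (R3 R -> 'M[R]_3) := [set tau | kerV tau /\ kills (edge_dofs D) tau].

(** The compensating entry is [ordS F.1]. It is tested only on faces with that normal, where [facef]
    vanishes. *)
Lemma diag_face_dofs_indep : indep kerE (diag_face_dofs D).
Proof.
pose Y F : set (R3 R -> 'M[R]_3) := [set tau | kerE tau /\ forall F' p, F' != F ->
  face_moment T F' (entry tau F'.1 F'.1) p = 0].
apply: (@indep_flatten _ _ _ _ _ _ Y); first exact: enum_uniq.
- by move=> F _ tau [].
- move=> F _.
  apply: (@indep_basis _ _ _ _ _ (fun tau p => face_moment T F (entry tau F.1 F.1) p)
    (Q_subspace R _) (diag_face_basisP D F)).
    move=> tau [[[Xt _] _] _]; apply: face_moment_test_linear; exact: Xi_continuous Xt.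
  move=> p pt h; have cp := Q_continuous pt.
  have cf := Q_continuous (Q_facef pt).
  apply: (face_nondeg pt (T := T) (F := F) (w := bub T (ordS F.1) \* bub T (ord_pred F.1))).
  + by rewrite /face_normal eqxx.
  + by apply: mulf_continuous; exact: Q_continuous (Q_bub T _).
  + move=> u [u1 u2]; apply: mulr_ge0; apply: bub_ge0; rewrite crd_face_pt ?ord3_eq ?eqxx.
      by move: u1; rewrite /cside /= in_itv.
    by move: u2; rewrite /cside /= in_itv.
  + move=> u [u1 u2]; apply: mulr_gt0; apply: bub_gt0; rewrite crd_face_pt ?ord3_eq ?eqxx.
      by move: u1; rewrite /oside /= in_itv.
    by move: u2; rewrite /oside /= in_itv.
  rewrite -[RHS](h (pairf F.1 (ordS F.1) (facef F p))).
    rewrite entry_pairf eqxx ord3_eq subr0 scale1r; apply: eq_Rintegral => u _.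
    rewrite /facef /= (@hat_bnd _ _ _ _ F.2) ?eqxx ?mul1r//.
    by rewrite crd_face_pt eqxx.
  have z m x : facef F p x = 0 ->
      entry (pairf F.1 (ordS F.1) (facef F p)) m m x = 0.
    move=> f0; rewrite entry_pairf.
    by rewrite -[LHS]/(_ * facef F p x) f0 mulr0.
  split; [split; [split; [exact/pairf_Xi/Q_facef|]|]|].
  + move=> f /allpairsPdep[v [m [_ _ ->]]]; apply: z.
    by apply: (facef_bnd _ _ (crd_vertex T v (ordS F.1))); rewrite ord3_eq.
  + move=> f /flattenP[_ /mapP[e _ ->] /allpairsPdep[q [m [_ _ ->]]]].
    apply: moment_eq0 => t _; apply: z.
    have [m1 [m2 [b1 [b2 [m12 x1 x2]]]]] := edge_two_bnd e t.
    have [m1F|m1F] := eqVneq m1 F.1.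
      by apply: facef_bnd x2; rewrite -m1F eq_sym.
    exact: facef_bnd x1.
  + move=> F' q FF; apply: moment_eq0 => u _.
    have cF := crd_face_pt T F' u F'.1; rewrite eqxx in cF.
    (* A different face with the same normal is the opposite one, where the hat vanishes. *)
    have [F1|F1] := eqVneq F'.1 F.1; last by apply: z; exact: facef_bnd cF.
    have F2 : F'.2 != F.2.
      by apply: contraNneq FF => F2; case: F F' F1 F2 {pt cp cf h z cF} => [? ?] [? ?] /= -> ->.
    apply: z; rewrite F1 in cF; rewrite /facef /= (hat_bnd _ cF) (negbTE F2).
    by rewrite mul0r mulr0.
- move=> F F' _ _ FF tau [_ h] f /mapP[p _ ->]; apply: h.
  by rewrite eq_sym.
Qed.

Lemma sum3_inord (V : nmodType) (F : 'I_3 -> V) :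
  \sum_i F i = F (inord 0) + F (inord 1) + F (inord 2).
Proof. exact: big3_inord. Qed.

Lemma cell_face i b x : cell T x -> crd x i = bnd T i b -> face T (i, b) x.
Proof.
move=> xT xi; exists (crd x (ordS i), crd x (ord_pred i)).
  by split; rewrite /= in_itv/=; exact: xT.
apply: crd_inj => m; rewrite crd_face_pt; move: m.
by apply: (ord3_forall (i := i)); rewrite /fst ?ord3_eq ?eqxx.
Qed.

Lemma Bub_subspace : subspace_closed (@Bub R k T).
Proof.
split=> [|a u v [u1 u2 u3] [v1 v2 v3]].
  split=> [i|x|i b x _]; last by rewrite -[(0 : _ -> _) x]/(0 : 'rV[R]_3) mxE.
    have -> : (fun x => (0 : R3 R -> 'rV[R]_3) x 0 i) = 0.
      by apply/funext => x; rewrite -[(0 : R3 R -> 'rV[R]_3) x]/(0 : 'rV[R]_3) mxE.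
    exact: Q0.
  by rewrite big1// => i _; rewrite -[(0 : _ -> _) x]/(0 : 'rV[R]_3) mxE.
have E x i : (a *: u + v) x 0 i = a * u x 0 i + v x 0 i.
  by rewrite -[(a *: u + v) x]/(a *: u x + v x) !mxE.
split=> [i|x|i b x xF].
- have -> : (fun x => (a *: u + v) x 0 i) = a *: (fun x => u x 0 i) + (fun x => v x 0 i).
    by apply/funext => x; exact: E.
  exact: Q_lin.
- under eq_bigr do rewrite E.
  by rewrite big_split -mulr_sumr /= u2 v2 mulr0 addr0.
- by rewrite E (u3 i b)// (v3 i b)// mulr0 addr0.
Qed.

Lemma Bub_continuous xi i : Bub k T xi -> continuous (fun x => xi x 0 i).
Proof. by case=> h _ _; exact: Q_continuous (h i). Qed.

Lemma ord3_third (m1 m2 m n : 'I_3) : m1 != m2 -> n != m1 -> n != m2 ->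
  m != m1 -> m != m2 -> n = m.
Proof.
move=> m12 n1 n2 m1' m2'; apply/val_inj; move: m12 n1 n2 m1' m2'; rewrite -!val_eqE /=.
by case: m1 m2 m n => [m1 h1] [m2 h2] [m h] [n h'] /=; lia.
Qed.

(** Two components vanish by the face conditions and the third by the zero sum. Bubbles thus vanish
    on all edges, which hides them from the vertex and edge functionals. *)
Lemma Bub_two_bnd xi x m1 m2 b1 b2 : Bub k T xi -> cell T x -> m1 != m2 ->
  crd x m1 = bnd T m1 b1 -> crd x m2 = bnd T m2 b2 -> forall m, xi x 0 m = 0.
Proof.
move=> [_ xi0 xiF] xT m12 x1 x2.
have z1 : xi x 0 m1 = 0 by apply: xiF; exact: cell_face x1.
have z2 : xi x 0 m2 = 0 by apply: xiF; exact: cell_face x2.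
move=> m; have [->//|n1] := eqVneq m m1; have [->//|n2] := eqVneq m m2.
have := xi0 x; rewrite (bigD1 m1)//= z1 add0r (bigD1 m2) 1?eq_sym//= z2 add0r.
rewrite (bigD1 m) ?n1 ?n2//= big1 ?addr0// => n /andP[/andP[nm1 nm2] nm].
by move: nm; rewrite (ord3_third m12 nm1 nm2 n1 n2) eqxx.
Qed.

Lemma sum_continuous (f : 'I_3 -> R3 R -> R) : (forall i, continuous (f i)) ->
  continuous (fun x => \sum_i f i x).
Proof.
move=> cf x; rewrite (_ : (fun y => _) =
  fun y => f (inord 0) y + f (inord 1) y + f (inord 2) y).
  by apply: cvgD; [apply: cvgD|]; exact: cf.
by apply/funext => y; rewrite sum3_inord.
Qed.

Lemma bub_momentE tau (xi : R3 R -> 'rV[R]_3) : (forall i, continuous (entry tau i i)) ->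
  (forall i, continuous (fun x => xi x 0 i)) ->
  bub_moment T tau xi = \sum_i cell_moment T (entry tau i i) (fun x => xi x 0 i).
Proof.
move=> ct cx; rewrite sum3_inord /cell_moment.
have I i := cell_integrable T (mulf_continuous (ct i) (cx i)).
rewrite -RintegralD//; [|exact: measurable_cell|exact: I|exact: I].
rewrite -RintegralD//; [|exact: measurable_cell| |exact: I]; last first.
  have c2 : continuous (fun x => entry tau (inord 0) (inord 0) x * xi x 0 (inord 0) +
      entry tau (inord 1) (inord 1) x * xi x 0 (inord 1)).
    by move=> x; apply: cvgD; exact: (mulf_continuous (ct _) (cx _)).
  exact: cell_integrable c2.
by apply: eq_Rintegral => x _; rewrite sum3_inord.
Qed.

Lemma bub_moment_linear tau : Xi k tau -> linear_on (@Bub R k T) (bub_moment T tau).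
Proof.
move=> Xt a u v uB vB; have ct i := @Xi_continuous tau i i Xt.
have cu i := @Bub_continuous _ i uB; have cv i := @Bub_continuous _ i vB.
have E i : (fun x => (a *: u + v) x 0 i) =
    a *: (fun x => u x 0 i) + (fun x => v x 0 i).
  by apply/funext => x; rewrite -[(a *: u + v) x]/(a *: u x + v x) !mxE.
rewrite !bub_momentE//; last by move=> i; apply: Bub_continuous; exact: Bub_subspace.2.
rewrite mulr_sumr -big_split; apply: eq_bigr => i _; rewrite E.
exact: (@moment_linr _ _ _ (leb3 R) _ id (@measurable_cell R T) (@cell_integrable R T)).
Qed.

Lemma bub_nondeg xi : Bub k T xi ->
  \int[leb3 R]_(x in cell T) (\sum_i xi x 0 i * xi x 0 i) = 0 -> xi = 0.
Proof.
move=> xB m0; have cx i := @Bub_continuous _ i xB.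
have cs : continuous (fun x => \sum_i xi x 0 i * xi x 0 i).
  by apply: sum_continuous => i; exact: (mulf_continuous (cx i) (cx i)).
have z x : open_cell T x -> forall i, xi x 0 i = 0.
  move=> xT i; have := cell_int_eq0 cs _ m0 xT.
  have s0 y : \sum_i xi y 0 i * xi y 0 i >= 0.
    by apply: sumr_ge0 => j _; rewrite -expr2 sqr_ge0.
  move=> /(_ (fun y _ => s0 y)) /eqP; rewrite psumr_eq0; last first.
    by move=> j _; rewrite -expr2 sqr_ge0.
  by move=> /allP/(_ i (mem_index_enum _)); rewrite mulf_eq0 orbb => /eqP.
case: xB => xQ _ _; apply/funext => x; apply/rowP => i.
rewrite -[(0 : _ -> _) x]/(0 : 'rV[R]_3) mxE.
have := Q_eq0_open (xQ i) (fun y yT => z y yT i).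
by move=> /(congr1 (@^~ x)).
Qed.

Definition kerF : set (R3 R -> 'M[R]_3) :=
  [set tau | kerE tau /\ kills (diag_face_dofs D) tau].

Lemma edge_pt_cell e t : edge_dom T e t -> cell T (edge_pt T e t).
Proof.
move=> te m; rewrite crd_edge_pt; case: eqP => [->|_]; last exact: bnd_itv.
by move: te; rewrite /edge_dom /= in_itv.
Qed.

Lemma bub_field_kerF xi : Bub k T xi -> kerF (diagf (fun m x => xi x 0 m)).
Proof.
move=> xB; have [xQ x0 xF] := xB.
split; [split; [split; [exact: diagf_Xi|]|]|].
- move=> f /allpairsPdep[v [m [_ _ ->]]]; rewrite entry_diagf eqxx.
  apply: (Bub_two_bnd xB _ _ (crd_vertex T v m) (crd_vertex T v (ordS m))).
    by move=> l; rewrite crd_vertex bnd_itv.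
  by rewrite ord3_eq.
- move=> f /flattenP[_ /mapP[e _ ->] /allpairsPdep[q [m [_ _ ->]]]].
  apply: moment_eq0 => t te; rewrite entry_diagf eqxx.
  have [m1 [m2 [b1 [b2 [m12 x1 x2]]]]] := edge_two_bnd e t.
  by apply: (Bub_two_bnd xB _ m12 x1 x2); exact: edge_pt_cell.
- move=> f /allpairsPdep[F [p [_ _ ->]]].
  apply: moment_eq0 => u uF; rewrite entry_diagf eqxx.
  by apply: (xF _ F.2); rewrite -surjective_pairing; exists u.
Qed.

(** Each bubble is tested with the diagonal field that it defines, so that the pairing becomes the
    integral of a sum of squares. *)
Lemma bub_dofs_indep : indep kerF (bub_dofs D).
Proof.
apply: (@indep_basis _ _ _ _ _ (@bub_moment R T) Bub_subspace (bub_basisP D)).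
  by move=> tau [[[Xt _] _] _]; exact: bub_moment_linear.
move=> xi xB h; apply: bub_nondeg => //.
rewrite -[RHS](h _ (bub_field_kerF xB)); apply: eq_Rintegral => x _.
apply: eq_bigr => i _; congr (_ * _).
by have := congr1 (@^~ x) (entry_diagf (fun m x => xi x 0 m) i i); rewrite eqxx => <-.
Qed.

Definition kerB : set (R3 R -> 'M[R]_3) :=
  [set tau | kerF tau /\ kills (bub_dofs D) tau].

Lemma kerB_off tau : Xi k tau -> (forall i, entry tau i i = 0) -> kerB tau.
Proof.
move=> Xt t0; split; [split; [split; [split => //|]|]|].
- by move=> f /allpairsPdep[v [m [_ _ ->]]]; rewrite t0.
- move=> f /flattenP[_ /mapP[e _ ->] /allpairsPdep[q [m [_ _ ->]]]].
  by apply: moment_eq0 => t _; rewrite t0.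
- by move=> f /allpairsPdep[F [p [_ _ ->]]]; apply: moment_eq0 => u _; rewrite t0.
- move=> f /mapP[xi _ ->]; rewrite /bub_moment (@eq_Rintegral _ _ _ _ _ (fun=> 0)).
    by rewrite /Rintegral integral0.
  move=> x _; rewrite big1// => i _.
  by have := congr1 (@^~ x) (t0 i); rewrite /entry => ->; rewrite mul0r.
Qed.

Lemma deg3E i j a b c : i != j ->
  (deg3 i a j b c i = a) * (deg3 i a j b c j = b).
Proof. by move=> ij; rewrite /deg3 !eqxx eq_sym (negbTE ij). Qed.

(** [Y] is left open so that it can be the kernel of the face functionals: the bubble in [x_j]
    vanishes on the faces that carry them. *)
Lemma off_cell_dofs_indep i j (Y : set (R3 R -> 'M[R]_3)) : i != j ->
  Y `<=` Xi k ->
  (forall p, off_cell_test k i j p -> Y (offf i j (bub T j \* p))) ->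
  indep Y (off_cell_dofs D i j).
Proof.
move=> ij YX Yo.
apply: (@indep_basis _ _ _ _ _ (fun tau p => cell_moment T (entry tau i j) p)
  (Q_subspace R _) (off_cell_basisP D ij)).
  by move=> tau /YX Xt; apply: cell_moment_test_linear; exact: Xi_continuous.
move=> p pt h; apply: (cell_nondeg pt (T := T) (w := bub T j)).
- exact: Q_continuous (Q_bub T j).
- by move=> x xT; apply: bub_ge0; exact: xT.
- by move=> x xT; apply: bub_gt0; exact: xT.
by rewrite -[RHS](h _ (Yo _ pt)) entry_offf !eqxx.
Qed.

(** The weight is 1: the face test space is the full space of traces of the entry, without any
    condition on the boundary of the face. *)
Lemma off_face_dofs_indep i j (Y : set (R3 R -> 'M[R]_3)) : i != j ->
  Y `<=` Xi k ->
  (forall p b, off_face_test k i j p -> Y (offf i j (hat T j b \* p))) ->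
  indep Y (off_face_dofs D i j).
Proof.
move=> ij YX Yo.
pose Z b : set (R3 R -> 'M[R]_3) := [set tau | Y tau /\ forall b' p, b' != b ->
  face_moment T (j, b') (entry tau i j) p = 0].
apply: (@indep_flatten _ _ _ _ _ _ Z); first exact: enum_uniq.
- by move=> b _ tau [].
- move=> b _.
  apply: (@indep_basis _ _ _ _ _ (fun tau p => face_moment T (j, b) (entry tau i j) p)
    (Q_subspace R _) (@off_face_basisP _ _ _ D i (j, b) ij)).
    by move=> tau [/YX Xt _]; apply: face_moment_test_linear; exact: Xi_continuous.
  move=> p pt h; apply: (face_nondeg pt (T := T) (F := (j, b)) (w := cst 1)).
  + by rewrite deg3E.
  + by move=> x; exact: cvg_cst.
  + by move=> u _; exact: ler01.
  + by move=> u _; exact: ltr01.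
  rewrite -[RHS](h (offf i j (hat T j b \* p))).
    rewrite entry_offf !eqxx /=; apply: eq_Rintegral => u _ /=.
    by rewrite (@hat_bnd _ _ _ _ b) ?eqxx// crd_face_pt eqxx.
  split; first exact: Yo.
  move=> b' q b'b; rewrite entry_offf !eqxx; apply: moment_eq0 => u _ /=.
  by rewrite (@hat_bnd _ _ _ _ b') ?(negbTE b'b) ?mul0r// crd_face_pt eqxx.
- move=> b b' _ _ bb tau [_ h] f /mapP[p _ ->]; apply: h.
  by rewrite eq_sym.
Qed.

Lemma off_dofs_indep : indep kerB (flatten
  [seq off_face_dofs D i j ++ off_cell_dofs D i j | i <- enum 'I_3, j <- all_but i]).
Proof.
pose S (ij : 'I_3 * 'I_3) := off_face_dofs D ij.1 ij.2 ++ off_cell_dofs D ij.1 ij.2.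
have -> : [seq off_face_dofs D i j ++ off_cell_dofs D i j |
    i <- enum 'I_3, j <- all_but i] =
  [seq S ij | ij <- [seq (i, j) | i <- enum 'I_3, j <- all_but i]].
  by rewrite map_allpairs.
have pairsP i j : (i, j) \in [seq (i, j) | i <- enum 'I_3, j <- all_but i] -> i != j.
  by move=> /allpairsPdep[i' [j' [_ + [-> ->]]]]; rewrite mem_all_but eq_sym.
pose Y (ij : 'I_3 * 'I_3) : set (R3 R -> 'M[R]_3) := [set tau | kerB tau /\
  forall i j, i != j -> (i, j) != ij -> entry tau i j = 0].
apply: (@indep_flatten _ _ _ _ _ _ Y).
- apply: allpairs_uniq_dep; first exact: enum_uniq.
    by move=> i _; exact: uniq_all_but.
  by move=> [i j] [i' j'] _ _ [-> ->].
- by move=> ij _ tau [].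
- move=> [i j] /pairsP ij; rewrite /S /=.
  have YX : Y (i, j) `<=` Xi k by move=> tau [[[[[]]]]].
  have Yo g : Q (deg3 i (k - 2) j k (k - 1)) g -> Y (i, j) (offf i j g).
    move=> gQ; split.
      apply: kerB_off; first exact: offf_Xi.
      move=> m; rewrite entry_offf; case: ifP => // /andP[/eqP mi /eqP mj].
      by move: ij; rewrite -mi -mj eqxx.
    move=> i' j' _ ne; rewrite entry_offf; case: ifP => // /andP[/eqP ei /eqP ej].
    by move: ne; rewrite ei ej eqxx.
  pose Z := [set tau | Y (i, j) tau /\ kills (off_face_dofs D i j) tau].
  apply: (@indep_cat_r _ _ _ Z); first by move=> tau [].
  + by move=> tau [].
  + apply: off_cell_dofs_indep => // [tau [/YX]//|p pt]; split.
      apply: Yo; apply: Q_le (Q_mul (Q_bub T j) pt) => m.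
      rewrite /dset /deg3; case: eqP => [->|_]; first by rewrite eq_sym (negbTE ij); lia.
      by case: ifP => _; rewrite add0n.
    move=> f /allpairsPdep[b [p' [_ _ ->]]]; apply: moment_eq0 => u _.
    rewrite entry_offf !eqxx /= (@bub_bnd _ _ _ _ b) ?mul0r//.
    by rewrite crd_face_pt eqxx.
  + apply: off_face_dofs_indep => // p b pt.
    apply: Yo; apply: Q_le (Q_mul (Q_hat T j b) pt) => m.
    rewrite /dset /deg3; case: eqP => [->|_].
      by rewrite eq_sym (negbTE ij); move: k3; clear; lia.
    by case: ifP => _; rewrite add0n.
- move=> ij [i' j'] _ /pairsP ij' ne tau [_ h] f.
  have t0 : entry tau i' j' = 0 by apply: h; rewrite // eq_sym.
  rewrite mem_cat => /orP[/allpairsPdep[b [p' [_ _ ->]]]|/mapP[p _ ->]].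
    by apply: moment_eq0 => u _; rewrite t0.
  by rewrite t0; exact: (@moment_eq0 _ _ _ (leb3 R) (cell T) id 0 p (fun _ _ => erefl)).
Qed.

Lemma dofs_indep : indep (Xi k) (dofs D).
Proof.
apply: (@indep_cat_r _ _ _ kerV); [by move=> ? []|by move=> ? []| |exact: vertex_dofs_indep].
apply: (@indep_cat_r _ _ _ kerE); [by move=> ? []|by move=> ? []| |exact: edge_dofs_indep].
apply: (@indep_cat_r _ _ _ kerF); [by move=> ? []|by move=> ? []| |exact: diag_face_dofs_indep].
apply: (@indep_cat_r _ _ _ kerB); [by move=> ? []|by move=> ? []| |exact: bub_dofs_indep].
exact: off_dofs_indep.
Qed.

Lemma dofs_linear f : f \in dofs D -> linear_on (Xi k) f.
Proof.
move=> fD a u v Xu Xv.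
have cu i j : continuous (entry u i j) by exact: Xi_continuous.
have cv i j : continuous (entry v i j) by exact: Xi_continuous.
move: fD; rewrite !mem_cat => /orP[|/orP[|/orP[|/orP[]]]].
- by move=> /allpairsPdep[w [m [_ _ ->]]]; rewrite entry_lin.
- move=> /flattenP[_ /mapP[e _ ->] /allpairsPdep[q [m [qb _ ->]]]]; rewrite entry_lin.
  apply: edge_moment_linl => //; exact: Q_continuous (basis_mem (edge_basisP D e) qb).
- move=> /allpairsPdep[F [p [_ pb ->]]]; rewrite entry_lin.
  apply: face_moment_linl => //; exact: Q_continuous (basis_mem (diag_face_basisP D F) pb).
- move=> /mapP[xi xb ->]; have xB := basis_mem (bub_basisP D) xb.
  have cx i := @Bub_continuous _ i xB.
  have ca i : continuous (entry (a *: u + v) i i).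
    by apply: Xi_continuous; exact: Xi_subspace.2.
  rewrite !bub_momentE// mulr_sumr -big_split; apply: eq_bigr => i _.
  by rewrite entry_lin; exact: cell_moment_linl.
move=> /flattenP[_ /allpairsPdep[i [j [_ + ->]]]]; rewrite mem_all_but eq_sym => ij.
rewrite mem_cat => /orP[/allpairsPdep[b [p [_ pb ->]]]|/mapP[p pb ->]]; rewrite entry_lin.
  apply: face_moment_linl => //.
  exact: Q_continuous (basis_mem (@off_face_basisP _ _ _ D i (j, b) ij) pb).
apply: cell_moment_linl => //; exact: Q_continuous (basis_mem (off_cell_basisP D ij) pb).
Qed.

(** * The degrees of freedom separate the shape functions *)

Lemma off_face_vanish i j b f : i != j -> Q (deg3 i (k - 2) j k (k - 1)) f ->
  (forall p, off_face_test k i j p -> face_moment T (j, b) f p = 0) ->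
  forall x, f (upd x j (bnd T j b)) = 0.
Proof.
move=> ij fQ mf; have fQ' := Q_upd j (bnd T j b) fQ.
have ft : off_face_test k i j (fun x => f (upd x j (bnd T j b))).
  apply: Q_le fQ' => m; rewrite /dset /deg3; case: (eqVneq m j) => [->//|_].
  by case: ifP.
suff /(congr1 (@^~ _)) h : (fun x => f (upd x j (bnd T j b))) = 0 by exact: h.
apply: (face_nondeg fQ' (T := T) (F := (j, b)) (w := cst 1)).
- by rewrite /dset eqxx.
- by move=> x; exact: cvg_cst.
- by move=> u _; exact: ler01.
- by move=> u _; exact: ltr01.
rewrite -[RHS](mf _ ft); apply: eq_Rintegral => u _; congr (_ * _).
rewrite [LHS]mul1r; congr f; apply: crd_inj => m; rewrite crd_upd crd_face_pt /=.
by case: eqP => // ->.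
Qed.

(** Recovers from the trace constraint the diagonal functional that was left out of the count. *)
Lemma omit_zero (o : 'I_3) (F : 'I_3 -> R) : \sum_i F i = 0 ->
  (forall i, i != o -> F i = 0) -> forall i, F i = 0.
Proof.
move=> F0 Fo i; have [->|/Fo//] := eqVneq i o.
by move: F0; rewrite (bigD1 o)//= big1 ?addr0// => m /Fo.
Qed.

(** Once its entries vanish on their faces, the diagonal of [tau] is itself a bubble and can be
    tested with itself. An off-diagonal entry becomes a bubble in [x_j] times a polynomial of the
    cell test space. *)
Lemma dofs_separate tau : Xi k tau -> kills (dofs D) tau -> tau = 0.
Proof.
move=> Xt kt; have [_ tQ oQ] := Xt.
have ct i j : continuous (entry tau i j) by exact: Xi_continuous.
have tV v i : entry tau i i (vertex T v) = 0.
  apply: (@omit_zero (vert_omit D v) (fun i => entry tau i i (vertex T v))).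
    exact: Xi_trace.
  move=> m mo.
  apply: (kt (fun tau => entry tau m m (vertex T v))); rewrite mem_cat; apply/orP; left.
  by apply/allpairsPdep; exists v, m; rewrite mem_enum mem_all_but.
have tE e i p : edge_test k e p -> edge_moment T e (entry tau i i) p = 0.
  apply: (@kills_basis _ _ _ _ (edge_basis D e)
    (fun tau p => edge_moment T e (entry tau i i) p) (Q_subspace R _) (edge_basisP D e)).
    exact: edge_moment_test_linear.
  (* The omitted entry is attached to basis functions, so it is restored for each of them before
     passing to the whole test space. *)
  move=> _ /mapP[q qb ->].
  apply: (@omit_zero (edge_omit D e q) (fun i => edge_moment T e (entry tau i i) q)).
    have cq : continuous q by exact: Q_continuous (basis_mem (edge_basisP D e) qb).
    have cs : continuous (1 *: entry tau (inord 0) (inord 0) + entry tau (inord 1) (inord 1)).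
      by rewrite scale1r => x; apply: cvgD; exact: ct.
    rewrite sum3_inord.
    rewrite -[edge_moment T e (entry tau (inord 0) (inord 0)) q]mul1r -edge_moment_linl//.
    rewrite -[X in X + _]mul1r -edge_moment_linl//.
    apply: moment_eq0 => t _; rewrite !scale1r -[RHS](Xi_trace (edge_pt T e t) Xt).
    by rewrite sum3_inord.
  move=> m mo; apply: (kt (fun tau => edge_moment T e (entry tau m m) q)).
  rewrite !mem_cat; apply/orP; right; apply/orP; left.
  apply/flattenP; eexists; first by apply/mapP; exists e => //; rewrite mem_enum.
  by apply/allpairsPdep; exists q, m; rewrite mem_all_but.
have tF F p : diag_face_test k F p -> face_moment T F (entry tau F.1 F.1) p = 0.
  apply: (@kills_basis _ _ _ _ (diag_face_basis D F)
    (fun tau p => face_moment T F (entry tau F.1 F.1) p) (Q_subspace R _) (diag_face_basisP D F)).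
    exact: face_moment_test_linear.
  move=> _ /mapP[q qb ->]; apply: (kt (fun tau => face_moment T F (entry tau F.1 F.1) q)).
  rewrite !mem_cat; do 2![apply/orP; right]; apply/orP; left.
  by apply/allpairsPdep; exists F, q; rewrite mem_enum.
have tz i b x : crd x i = bnd T i b -> entry tau i i x = 0.
  apply: (diag_face_vanish k3 (tQ i)) => //.
  - by move=> e p _; exact: tE.
  - by move=> p pt; exact: (tF (i, b)).
pose xi x : 'rV[R]_3 := \row_m tau x m m.
have xiE m : (fun x => xi x 0 m) = entry tau m m by apply/funext => x; rewrite mxE.
have xB : Bub k T xi.
  split=> [i|x|i b x [u uF <-]].
  - by rewrite xiE.
  - by rewrite -[RHS](Xi_trace x Xt); apply: eq_bigr => i _; rewrite mxE.
  - by rewrite mxE; apply: (tz i b); rewrite crd_face_pt eqxx.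
have xi0 : xi = 0.
  apply: bub_nondeg => //; have : bub_moment T tau xi = 0.
    apply: (@kills_basis _ _ _ _ (bub_basis D) (@bub_moment R T) Bub_subspace (bub_basisP D)) => //.
      exact: bub_moment_linear.
    move=> f fb; apply: kt; rewrite !mem_cat.
    by do 3![apply/orP; right]; apply/orP; left.
  move=> h; rewrite -[RHS]h; apply: eq_Rintegral => x _; apply: eq_bigr => i _.
  by congr (_ * _); rewrite mxE.
have off0 i j : i != j -> entry tau i j = 0.
  move=> ij.
  have mem f : f \in off_face_dofs D i j ++ off_cell_dofs D i j -> f tau = 0.
    move=> fij; apply: kt; rewrite !mem_cat; do 4![apply/orP; right].
    apply/flattenP; eexists; last exact: fij.
    by apply/allpairsPdep; exists i, j; rewrite mem_enum mem_all_but eq_sym.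
  have fM b p : off_face_test k i j p -> face_moment T (j, b) (entry tau i j) p = 0.
    apply: (@kills_basis _ _ _ _ (off_face_basis D i (j, b))
      (fun tau p => face_moment T (j, b) (entry tau i j) p) (Q_subspace R _)
      (@off_face_basisP _ _ _ D i (j, b) ij)).
      exact: face_moment_test_linear.
    move=> _ /mapP[q qb ->]; apply: (mem (fun tau => face_moment T (j, b) (entry tau i j) q)).
    rewrite mem_cat; apply/orP; left.
    by apply/allpairsPdep; exists b, q; rewrite mem_enum.
  have cM p : off_cell_test k i j p -> cell_moment T (entry tau i j) p = 0.
    apply: (@kills_basis _ _ _ _ (off_cell_basis D i j)
      (fun tau p => cell_moment T (entry tau i j) p) (Q_subspace R _) (off_cell_basisP D ij)).
      exact: cell_moment_test_linear.
    move=> _ /mapP[q qb ->]; apply: (mem (fun tau => cell_moment T (entry tau i j) q)).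
    by rewrite mem_cat; apply/orP; right; apply/mapP; exists q.
  have [|g gQ tg] := @Q_bub_div _ _ j T _ (oQ _ _ ij).
    by move=> x b; apply: (off_face_vanish ij (oQ _ _ ij)); exact: fM.
  have gt : off_cell_test k i j g.
    apply: Q_le gQ => m; rewrite deg3E// /dset /deg3; case: (eqVneq m j) => [->|//].
    by rewrite eq_sym (negbTE ij).
  rewrite tg (_ : g = 0); first by apply/funext => x; rewrite /= mulr0.
  apply: (cell_nondeg gt (T := T) (w := bub T j)).
  - exact: Q_continuous (Q_bub T j).
  - by move=> x xT; apply: bub_ge0; exact: xT.
  - by move=> x xT; apply: bub_gt0; exact: xT.
  by rewrite -tg; exact: cM.
apply/funext => x; apply/matrixP => i j; rewrite -[(0 : _ -> _) x]/(0 : 'M[R]_3) mxE.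
have [<-|ij] := eqVneq i j; last exact: (congr1 (@^~ x) (off0 _ _ ij)).
have := congr1 (fun z : R3 R -> 'rV[R]_3 => z x 0 i) xi0; rewrite mxE => ->.
by rewrite -[(0 : _ -> _) x]/(0 : 'rV[R]_3) mxE.
Qed.

Lemma dofs_unisolvent : unisolvent (@Xi R k) (dofs D).
Proof.
apply: unisolventP; [exact: Xi_subspace|exact: dofs_linear|exact: dofs_indep|].
exact: dofs_separate.
Qed.
End Unisolvence.

(** * Conformity *)

Section FaceGeometry.
Variable R : realType.
Implicit Types (T : cuboid R) (x : R3 R) (i j m : 'I_3).

Lemma faceP T F x : face T F x <-> crd x F.1 = bnd T F.1 F.2 /\ cell T x.
Proof.
split=> [[u [u1 u2] <-]|[xF xT]].
  rewrite crd_face_pt eqxx; split=> // m; rewrite crd_face_pt; move: m.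
  apply: (ord3_forall (i := F.1)); rewrite ?eqxx ?ord3_eq.
  - exact: bnd_itv.
  - by move: u1; rewrite /= in_itv.
  - by move: u2; rewrite /= in_itv.
by case: F xF => i b xF; exact: cell_face.
Qed.

Lemma face_sub_eq T T' F F' : face T F `<=` face T' F' -> F.1 = F'.1 /\
  bnd T F.1 F.2 = bnd T' F'.1 F'.2 /\
  forall m, m != F.1 -> lo T' m <= lo T m /\ hi T m <= hi T' m.
Proof.
move=> FF.
(* Points of the face with one tangential coordinate running; such a coordinate cannot be the
   constant one of the other face. *)
pose P m (c : R) : R3 R := pt (fun n => if n == F.1 then bnd T F.1 F.2 else
  if n == m then c else lo T n).
have PF m c : lo T m <= c <= hi T m -> face T' F' (P m c).
  move=> mc; apply: FF; apply/faceP; rewrite /P crd_pt eqxx; split=> // n.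
  rewrite crd_pt; case: eqP => [->|_]; first exact: bnd_itv.
  by case: eqP => [->//|_]; rewrite lexx ltW ?lo_lt_hi.
have e1 : F.1 = F'.1.
  apply: contrapT => /eqP ne.
  have /faceP[h1 _] := PF F'.1 (lo T F'.1) ltac:(by rewrite lexx ltW ?lo_lt_hi).
  have /faceP[h2 _] := PF F'.1 (hi T F'.1) ltac:(by rewrite lexx ltW ?lo_lt_hi).
  move: h1 h2; rewrite !crd_pt eqxx eq_sym (negbTE ne) => h1 h2.
  by have := lo_lt_hi T F'.1; rewrite h1 h2 ltxx.
split=> //; split=> [|m mF].
  have /faceP[] := PF F.1 (lo T F.1) ltac:(by rewrite lexx ltW ?lo_lt_hi).
  by rewrite crd_pt -e1 eqxx.
have /faceP[_ /(_ m)] := PF m (lo T m) ltac:(by rewrite lexx ltW ?lo_lt_hi).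
have /faceP[_ /(_ m)] := PF m (hi T m) ltac:(by rewrite lexx ltW ?lo_lt_hi).
by rewrite !crd_pt (negbTE mF) eqxx => /andP[_ h] /andP[h' _].
Qed.

Lemma face_eq T T' F F' : face T F = face T' F' -> F.1 = F'.1 /\
  bnd T F.1 F.2 = bnd T' F'.1 F'.2 /\
  forall m, m != F.1 -> lo T m = lo T' m /\ hi T m = hi T' m.
Proof.
move=> FF.
have [e1 [e2 le1]] : _ := @face_sub_eq T T' F F' ltac:(by rewrite FF).
have [_ [_ le2]] : _ := @face_sub_eq T' T F' F ltac:(by rewrite FF).
split=> //; split=> // m mF; have [l1 h1] := le1 m mF.
have [|l2 h2] := le2 m; first by rewrite -e1.
by split; apply/eqP; rewrite eq_le ?l1 ?l2 ?h1 ?h2.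
Qed.

End FaceGeometry.

(** * Continuity of the normal components across a common face *)

Section TraceAgreement.
Variables (R : realType) (k : nat) (k3 : (3 <= k)%N) (N : nat) (K : 'I_N -> cuboid R).
Variable tau : 'I_N -> R3 R -> 'M[R]_3.
Hypotheses (tauX : forall m, Xi k (tau m)) (tauV : vertex_match K tau).
Hypotheses (tauE : edge_match k K tau) (tauF : face_match k K tau).

(** All functionals attached to the common face vanish on the difference of the two polynomials, so
    the vanishing lemmas for a single face apply to it. *)
Lemma trace_agree m n j b c i : face (K m) (j, b) = face (K n) (j, c) ->
  forall x, crd x j = bnd (K m) j b -> entry (tau m) i j x = entry (tau n) i j x.
Proof.
move=> FF x xj; have [_ /= [ej el]] := face_eq FF.
have bl l a : l != j -> bnd (K n) l a = bnd (K m) l a.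
  by move=> lj; rewrite /bnd; have [-> ->] := el l lj.
have cm a a' := @Xi_continuous R k _ a a' (tauX m).
have cn a a' := @Xi_continuous R k _ a a' (tauX n).
set f := (-1) *: entry (tau n) i j + entry (tau m) i j.
suff f0 : f x = 0.
  by move: f0; rewrite -[f x]/(-1 * _ + _) mulN1r => /eqP; rewrite addrC subr_eq0 => /eqP.
have fmE g p : face_moment (K n) (j, c) g p = face_moment (K m) (j, b) g p.
  rewrite /face_moment.
  have -> : face_dom (K n) (j, c) = face_dom (K m) (j, b).
    by rewrite /face_dom /=; have [|-> ->] := el (ordS j);
      [|have [|-> ->] := el (ord_pred j)]; rewrite ?ord3_eq.
  apply: eq_Rintegral => u _; congr (g _ * p _); apply: crd_inj => l;
    rewrite !crd_face_pt /=; by case: eqP => // ->.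
have [mM1 mM2] := tauF FF.
have [ij|ij] := eqVneq i j; last first.
  have fQ : Q (deg3 i (k - 2) j k (k - 1)) f.
    by apply: Q_lin; [case: (tauX n)|case: (tauX m)] => _ _; apply.
  rewrite -(upd_id x j) xj; apply: (off_face_vanish ij fQ) => p pt.
  have cp := Q_continuous pt.
  rewrite face_moment_linl//.
  by rewrite (mM2 _ _ ij pt) /= fmE mulN1r addNr.
have fQ : Q (fun=> (k - 1)%N) f.
  by rewrite /f ij; apply: Q_lin; [case: (tauX n)|case: (tauX m)].
apply: (diag_face_vanish k3 fQ _ _ _ _ xj) => [//|v vj|e p ej' pt|p pt].
- have [w vw] : exists w, vertex (K m) v = vertex (K n) w.
    apply: vertexP => l; have [->|lj] := eqVneq l j; first by exists c; rewrite -ej.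
    by exists (vside v l); rewrite bl// crd_vertex.
  rewrite /f ij -[LHS]/(-1 * entry (tau n) j j (vertex (K m) v) + entry (tau m) j j (vertex (K m) v)).
  by rewrite (tauV vw) vw mulN1r addNr.
- have cp := Q_continuous pt.
  (* Along an edge in direction [j] the coordinate [j] would take both values 0 and 1. *)
  have ed : j != edge_dir e.
    apply/eqP => je; have := ej' 0; have := ej' 1.
    rewrite !crd_edge_pt je eqxx => h1 h0.
    by have /eqP := etrans h1 (esym h0); rewrite oner_eq0.
  have ex l a : l != edge_dir e -> bnd (K m) l a = crd (edge_pt (K m) e 0) l ->
      exists a', bnd (K n) l a' = bnd (K m) l a.
    move=> le; have [->|lj] := eqVneq l j; last by exists a; exact: bl.
    by rewrite ej' => ->; exists c.
  have [a1 e1] := ex (ordS (edge_dir e)) e.1.2 ltac:(by rewrite ord3_eq)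
    ltac:(by rewrite crd_edge_pt ord3_eq eqxx).
  have [a2 e2] := ex (ord_pred (edge_dir e)) e.2 ltac:(by rewrite ord3_eq)
    ltac:(by rewrite crd_edge_pt !ord3_eq).
  (* The same segment as an edge of [K n]; only the side flags may differ. *)
  pose e' : edge_ix := (edge_dir e, a1, a2).
  have ptE : edge_pt (K n) e' = edge_pt (K m) e.
    by apply/funext => t; rewrite /edge_pt /= e1 e2.
  have domE : edge_dom (K n) e' = edge_dom (K m) e.
    by rewrite /edge_dom /=; have [|-> ->] := el (edge_dir e); rewrite 1?eq_sym.
  have emE g q : edge_moment (K n) e' g q = edge_moment (K m) e g q.
    by rewrite /edge_moment ptE domE.
  have eE : edge (K m) e = edge (K n) e' by rewrite /edge ptE domE.
  rewrite edge_moment_linl// ij (tauE eE j pt) emE.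
  by rewrite mulN1r addNr.
- have cp := Q_continuous pt.
  by rewrite face_moment_linl// ij (mM1 _ pt) /= fmE mulN1r addNr.
Qed.

End TraceAgreement.

(** * Existence and uniqueness of the cell across an interior face *)

Section MeshGeometry.
Variables (R : realType) (Omega : set (R3 R)) (N : nat) (K : 'I_N -> cuboid R).
Hypotheses (oO : open Omega) (meshK : cuboid_mesh Omega K).

Lemma upd_continuous (x : R3 R) j (s : R) :
  continuous (fun e : R => upd x j (crd x j + s * e)).
Proof.
apply: continuous_crdP => m.
rewrite (_ : (fun _ => _) = if m == j then (fun e : R => crd x j + s * e) else
  cst (crd x m)).
  case: ifP => _ e; last exact: cvg_cst.
  by apply: cvgD; [exact: cvg_cst|apply: cvgM; [exact: cvg_cst|exact: cvg_id]].
by apply/funext => e; rewrite crd_upd; case: eqP.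
Qed.

(** If each of the finitely many cells missed a punctured one-sided neighbourhood of [x] on the ray,
    points of [Omega] close to [x] would lie in no cell. *)
Lemma cell_arbitrarily_close x j (s : R) : Omega x -> exists n, forall d, 0 < d ->
  exists2 e, 0 < e < d & cell (K n) (upd x j (crd x j + s * e)).
Proof.
move=> Ox; pose y e := upd x j (crd x j + s * e).
apply: contrapT => /forallNP nn.
have far n : \forall e \near (0 : R)^'+, ~ cell (K n) (y e).
  have [d /not_implyP[d0 dn]] : exists d : R, ~ (0 < d ->
      exists2 e, 0 < e < d & cell (K n) (upd x j (crd x j + s * e))).
    exact/existsNP/nn.
  near=> e => ye; apply: dn; exists e => //.
  apply/andP; split; near: e; first exact: nbhs_right_gt.
  exact: nbhs_right_lt.
have near_Omega : \forall e \near (0 : R)^'+, Omega (y e).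
  have y0 : y 0 = x by rewrite /y mulr0 addr0 upd_id.
  have c0 : y e @[e --> (0 : R)^'+] --> y 0.
    by apply: cvg_at_right_filter; exact: upd_continuous.
  by apply: c0; rewrite y0; apply: open_nbhs_nbhs.
have [e [Oe ne]] : exists e, Omega (y e) /\ forall n, ~ cell (K n) (y e).
  apply: (@filter_ex _ (0 : R)^'+); near=> e; split; first by near: e.
  by near: e; exact: filter_forall.
have [cO _ _] := meshK.
have : closure Omega (y e) by exact: subset_closure.
by rewrite cO => -[n _]; exact: ne.
Unshelve. all: by end_near. Qed.

(** A cell met just outside [K m] contains [x]. As [x] is interior to the face, it lies on no edge
    or vertex of [K m], so face-to-face conformity leaves only a common face. *)
Lemma mesh_neighbour x m j b : Omega x -> crd x j = bnd (K m) j b ->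
  (forall l, l != j -> lo (K m) l < crd x l < hi (K m) l) ->
  exists n, face (K m) (j, b) = face (K n) (j, ~~ b).
Proof.
move=> Ox xj xl; pose s : R := if b then 1 else -1.
have [n nP] := cell_arbitrarily_close j s Ox.
have other l : l != j -> lo (K n) l <= crd x l <= hi (K n) l.
  move=> lj; have [e _ /(_ l)] := nP 1 ltr01.
  by rewrite crd_upd (negbTE lj).
have nj e : cell (K n) (upd x j (crd x j + s * e)) ->
    lo (K n) j <= crd x j + s * e <= hi (K n) j.
  by move=> /(_ j); rewrite crd_upd eqxx.
(* Points of [K n] arbitrarily close to [x] force [x] into [K n]; since they lie beyond [x] in the
   outward direction, [x] is not on side [b] of [K n]. *)
have side : lo (K n) j <= crd x j <= hi (K n) j /\ crd x j != bnd (K n) j b.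
  have [e /andP[e0 _] /nj] := nP 1 ltr01.
  rewrite /bnd; case: b {xj} @s nP nj => s nP nj /andP[h1 h2].
    have h3 : crd x j < hi (K n) j by rewrite /s in h2; lra.
    split; last by rewrite lt_eqF.
    rewrite (ltW h3) andbT leNgt; apply/negP => h4.
    have [|e' /andP[e'0 e'd] /nj/andP[]] := nP (lo (K n) j - crd x j).
      by rewrite subr_gt0.
    by rewrite /s; lra.
  have h3 : lo (K n) j < crd x j by rewrite /s in h1; lra.
  split; last by rewrite gt_eqF.
  rewrite (ltW h3) /= leNgt; apply/negP => h4.
  have [|e' /andP[e'0 e'd] /nj/andP[]] := nP (crd x j - hi (K n) j).
    by rewrite subr_gt0.
  by rewrite /s; lra.
have [sj nb] := side.
have xn : cell (K n) x by move=> l; have [->//|/other] := eqVneq l j.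
have xm : cell (K m) x.
  move=> l; have [->|/xl] := eqVneq l j; first by rewrite xj bnd_itv.
  by move=> /andP[/ltW -> /ltW ->].
have mn : m != n by apply: contraNneq nb => <-; rewrite xj.
have xl_bnd l a : l != j -> crd x l != bnd (K m) l a.
  by move=> /xl /andP[h1 h2]; case: a; rewrite /= ?(gt_eqF h1) ?(lt_eqF h2).
have [_ _ /(_ m n mn) /=] := meshK; case.
- by move=> G0; have : set0 x by rewrite -G0.
- move=> [v [w [Gv _]]]; have : [set vertex (K m) v] x by rewrite -Gv.
  move=> /= xv; have := xl_bnd (ordS j) (vside v (ordS j)).
  by rewrite ord3_eq xv crd_vertex eqxx => /(_ isT).
- move=> [d [e [Gd _]]]; have : edge (K m) d x by rewrite -Gd.
  move=> [t _ xt].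
  have [m1 [m2 [b1 [b2 [m12 x1 x2]]]]] := edge_two_bnd (K m) d t.
  rewrite xt in x1 x2.
  have [m1j|m1j] := eqVneq m1 j; last by have := xl_bnd m1 b1 m1j; rewrite x1 eqxx.
  have m2j : m2 != j by rewrite -m1j eq_sym.
  by have := xl_bnd m2 b2 m2j; rewrite x2 eqxx.
move=> [[i c] [[i' c'] [Gm Gn]]].
have : face (K m) (i, c) x by rewrite -Gm.
move=> /faceP[/= xi _].
have ij : i = j.
  by apply/eqP; apply: contraT => ij; have := xl_bnd i c ij; rewrite xi eqxx.
subst i.
have cb : c = b.
  apply/eqP; apply: contraT => cb; have cE : ~~ b = c by move: cb; clear; case: b c => [] [].
  by have := bnd_neq (K m) j b; rewrite cE -xj -xi eqxx.
subst c.
have FF : face (K m) (j, b) = face (K n) (i', c') by rewrite -Gm.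
have [/= ji _] := face_eq FF; subst i'.
have : face (K n) (j, c') x by rewrite -Gn.
move=> /faceP[/= xc _].
suff cE : ~~ b = c' by exists n; rewrite cE.
by move: nb; rewrite xc; clear; case: b c' => [] [] //=; rewrite eqxx.
Qed.

(** Two cells lying on the same side of one face overlap in an open box, against the disjointness of
    open cells. *)
Lemma mesh_neighbour_unique j b n n' : (exists m, face (K m) (j, b) = face (K n) (j, ~~ b) /\
  face (K m) (j, b) = face (K n') (j, ~~ b)) -> n = n'.
Proof.
move=> [m [/face_eq[_ /= [e1 l1]] /face_eq[_ /= [e2 l2]]]].
have bb : bnd (K n) j (~~ b) = bnd (K n') j (~~ b) by rewrite -e1.
have ll l : l != j -> lo (K n) l = lo (K n') l /\ hi (K n) l = hi (K n') l.
  by move=> lj; have [<- <-] := l1 l lj; have [<- <-] := l2 l lj.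
apply/eqP; apply: contraT => nn.
have [_ /(_ n n' nn) d0 _] := meshK.
pose a l := Num.max (lo (K n) l) (lo (K n') l).
pose c l := Num.min (hi (K n) l) (hi (K n') l).
have ac l : a l < c l.
  rewrite /a /c lt_min !gt_max !lo_lt_hi /= andbT.
  have [->|/ll[-> ->]] := eqVneq l j; last by rewrite !lo_lt_hi.
  have h1 := lo_lt_hi (K n) j; have h2 := lo_lt_hi (K n') j.
  by case: b {e1 e2} bb => /= bb; do ?(apply/andP; split); lra.
(* The centre of the overlap. *)
have : set0 (pt (fun l => (a l + c l) / 2)).
  rewrite -d0; split=> l; rewrite crd_pt.
    have h1 : lo (K n) l <= a l by rewrite le_max lexx.
    have h2 : c l <= hi (K n) l by rewrite ge_min lexx.
    by have := ac l; lra.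
  have h1 : lo (K n') l <= a l by rewrite le_max lexx orbT.
  have h2 : c l <= hi (K n') l by rewrite ge_min lexx orbT.
  by have := ac l; lra.
by [].
Qed.

End MeshGeometry.

(** * Piecewise fields and their integrals *)

Section PiecewiseIntegrals.
Variables (R : realType) (N : nat) (K : 'I_N -> cuboid R).

(** A sum rather than a choice of cell, so that integrals and L^2 membership follow by linearity. On
    a mesh at most one term is nonzero, and the value on the skeleton is zero. *)
Definition pcw (V : zmodType) (f : 'I_N -> R3 R -> V) (x : R3 R) : V :=
  \sum_m (if x \in open_cell (K m) then f m x else 0).

Lemma pcw_entry (f : 'I_N -> R3 R -> 'M[R]_3) i j x :
  pcw f x i j = pcw (fun m => entry (f m) i j) x.
Proof.
by rewrite /pcw summxE; apply: eq_bigr => m _; case: ifP => // _; rewrite mxE.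
Qed.

Lemma Rintegral_sum d (X : measurableType d) (mu : {measure set X -> \bar R})
    (I : Type) (s : seq I) (f : I -> X -> R) :
  (forall i, mu.-integrable setT (EFin \o f i)) ->
  \int[mu]_x (\sum_(i <- s) f i x) = \sum_(i <- s) \int[mu]_x f i x /\
  mu.-integrable setT (EFin \o (fun x => \sum_(i <- s) f i x)).
Proof.
move=> fi; elim: s => [|i s [IH1 IH2]].
  split.
    rewrite big_nil (@eq_Rintegral _ _ _ _ _ (fun=> 0)) => [|x _]; last by rewrite big_nil.
    by rewrite /Rintegral integral0.
  rewrite (_ : EFin \o _ = cst 0%E); first exact: integrable0.
  by apply/funext => x; rewrite /= big_nil.
have E : (fun x => \sum_(l <- i :: s) f l x) = (fun x => f i x + \sum_(l <- s) f l x).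
  by apply/funext => x; rewrite big_cons.
rewrite big_cons E; split; first by rewrite RintegralD// IH1.
pose S x := \sum_(l <- s) f l x.
rewrite (_ : EFin \o _ = ((EFin \o f i) \+ (EFin \o S))%E); first exact: integrableD.
by apply/funext => x.
Qed.

(** The vanishing of [h] outside [Omega] absorbs any discrepancy between [Omega] and the union of
    the open cells. *)
Lemma Rintegral_pcw (Omega : set (R3 R)) (h : 'I_N -> R3 R -> R) f :
  (forall m, continuous (h m)) -> (forall m x, ~ Omega x -> h m x = 0) ->
  (forall x, Omega x -> f x = pcw h x) ->
  \int[leb3 R]_(x in Omega) f x = \sum_m \int[leb3 R]_(x in open_cell (K m)) h m x.
Proof.
move=> ch h0 fh; rewrite Rintegral_mkcond.
have -> : f \_ Omega = fun x => \sum_m (h m \_ (open_cell (K m))) x.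
  apply/funext => x; rewrite patchE; case: ifPn => [|/negP]; rewrite inE => Ox.
    rewrite fh//; apply: eq_bigr => m _; by rewrite patchE.
  rewrite big1// => m _; rewrite patchE; case: ifP => // _; exact: h0.
have hi_ m : (leb3 R).-integrable setT (EFin \o (h m \_ (open_cell (K m)))).
  have mo := @measurable_open_cell R (K m).
  have := open_cell_integrable (K m) (@ch m).
  by move/(integrable_mkcond _ mo); rewrite restrict_EFin.
have [-> _] := Rintegral_sum (index_enum 'I_N) hi_.
by apply: eq_bigr => m _; rewrite -Rintegral_mkcond.
Qed.

Lemma restrict_L2 (T : cuboid R) (D : set (R3 R)) (h : R3 R -> R) :
  @measurable _ (M3 R) D -> D `<=` cell T -> continuous h ->
  (h \_ D : M3 R -> R) \in Lfun (leb3 R) 2%:E.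
Proof.
move=> mD DT ch.
have mh : measurable_fun setT (h \_ D : M3 R -> R).
  apply/(measurable_restrictT _ mD); apply: measurable_funTS.
  exact: continuous_measurable3.
apply/andP; split; first by rewrite inE.
rewrite inE /=/finite_norm unlock /Lnorm /=.
apply: poweR_lty.
have c2 : continuous (fun x => h x ^+ 2) by exact: (mulf_continuous ch ch).
have i2 : (leb3 R).-integrable setT (EFin \o ((fun x => h x ^+ 2) \_ D)).
  rewrite -restrict_EFin; apply/(integrable_mkcond _ mD).
  exact: integrableS (@measurable_cell R T) mD DT (cell_integrable T c2).
apply: le_lt_trans (integrable_lty measurableT i2).
rewrite le_eqVlt; apply/orP; left; apply/eqP; apply: eq_integral => x _.
rewrite /= powR_mulrn// real_normK ?num_real// !patchE.
by case: ifP => // _; rewrite expr0n.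
Qed.

End PiecewiseIntegrals.

(** * Regularity and support of test functions *)

Section TestFunctions.
Variables (R : realType) (Omega : set (R3 R)) (phi : R3 R -> R).
Hypothesis phiT : test_function Omega phi.

Lemma test_continuous : continuous phi.
Proof. by case: phiT => /(_ [::])[]. Qed.

Lemma test_partial_continuous j : continuous (partial j phi).
Proof. by case: phiT => /(_ [:: j])[]. Qed.

Lemma test_is_derive j x : is_derive x (unitv R j) phi (partial j phi x).
Proof. by apply: derivableP; case: phiT => /(_ [::])[]. Qed.

Lemma test_outside x : ~ Omega x -> phi x = 0.
Proof.
case: phiT => _ _ sO nO; apply/eqP; apply: contraT => px.
by exfalso; apply: nO; apply: sO; exact: subset_closure.
Qed.

(** The complement of the support is open, so [phi] is zero in a whole neighbourhood of [x]. *)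
Lemma test_partial_outside j x : ~ Omega x -> partial j phi x = 0.
Proof.
case: phiT => _ _ sO nO.
have nc : ~ closure [set y | phi y != 0] x by move/sO.
rewrite /partial (@near_eq_derive _ _ _ phi (cst 0)) ?derive_cst//.
have : nbhs x (~` closure [set y | phi y != 0]).
  apply: open_nbhs_nbhs; split => //; exact/closed_openC/closed_closure.
apply: filterS => y nyc; apply/eqP; apply: contraT => py.
by exfalso; apply: nyc; exact: subset_closure.
Qed.

End TestFunctions.

(** * Cancellation of fluxes and the weak divergence *)

Section Divergence.
Variables (R : realType) (k : nat) (k3 : (3 <= k)%N).
Variables (Omega : set (R3 R)) (N : nat) (K : 'I_N -> cuboid R).
Hypotheses (oO : open Omega) (meshK : cuboid_mesh Omega K).
Variable tau : 'I_N -> R3 R -> 'M[R]_3.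
Hypotheses (tauX : forall m, Xi k (tau m)) (tauV : vertex_match K tau).
Hypotheses (tauE : edge_match k K tau) (tauF : face_match k K tau).

Let orect m j : set (R * R) := oside (K m) (ordS j) `*` oside (K m) (ord_pred j).

(** Rewrites a face flux as a sum over neighbouring cells: there is exactly one, or the flux is
    zero. *)
Lemma sum_if_unique (r : 'I_N -> bool) (a : R) :
  (forall n n', r n -> r n' -> n = n') -> ((forall n, ~~ r n) -> a = 0) ->
  \sum_n (if r n then a else 0) = a.
Proof.
move=> ru r0; have [n rn|rn] := pickP r.
  by rewrite (bigD1 n)//= rn big1 ?addr0// => n' /eqP nn; case: ifP => // /ru/(_ rn).
by rewrite r0 => [|n]; [rewrite big1// => n _; case: ifP|rewrite rn].
Qed.

Section FaceCancellation.
Variables (i j : 'I_3) (phi : R3 R -> R).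
Hypotheses (phiC : continuous phi) (phi0 : forall x, ~ Omega x -> phi x = 0).

Let F m : R3 R -> R := entry (tau m) i j \* phi.

Let flux m (b : bool) : R := \int[leb2 R]_(u in orect m j)
  F m (pt3 j (bnd (K m) j b) u.1 u.2).

Let F_continuous m : continuous (F m).
Proof. by apply: mulf_continuous => //; exact: Xi_continuous (tauX m). Qed.

Let flux_continuous m (a : R) : continuous (fun u : R * R => F m (pt3 j a u.1 u.2)).
Proof.
move=> u; apply: (@continuous_comp _ _ _ (fun v : R * R => pt3 j a v.1 v.2) (F m)).
  exact: pt3_continuous.
exact: F_continuous.
Qed.

Let flux_eq0 m b : (forall n, face (K m) (j, b) <> face (K n) (j, ~~ b)) ->
  flux m b = 0.
Proof.
move=> nn; rewrite /flux (@eq_Rintegral _ _ _ _ _ (fun=> 0)).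
  by rewrite /Rintegral integral0.
move=> u; rewrite inE => -[u1 u2]; rewrite /F /= phi0 ?mulr0// => Ou.
have [||n /nn//] := mesh_neighbour oO meshK (m := m) (j := j) (b := b) Ou.
  by rewrite crd_pt3 eqxx.
move=> l lj; rewrite crd_pt3; have := ord3P j l; rewrite (negbTE lj) /=.
move=> /orP[] /eqP ->; rewrite ?eqxx ?ord3_eq.
  by move: u1; rewrite /oside /= in_itv.
by move: u2; rewrite /oside /= in_itv.
Qed.

Let adj m n := `[< face (K m) (j, true) = face (K n) (j, false) >].

(** The upper fluxes and the lower fluxes both become sums over adjacent pairs of cells; on each
    pair the two integrals coincide by agreement of the traces. *)
Lemma flux_cancel : \sum_m (flux m true - flux m false) = 0.
Proof.
have out m : \sum_n (if adj m n then flux m true else 0) = flux m true.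
  apply: sum_if_unique => [n n' /asboolP e1 /asboolP e2|h].
    by apply: (@mesh_neighbour_unique _ _ _ _ meshK j true); exists m.
  by apply: flux_eq0 => n e; have /asboolP := h n; apply.
have inn n : \sum_m (if adj m n then flux n false else 0) = flux n false.
  apply: sum_if_unique => [m m' /asboolP e1 /asboolP e2|h].
    by apply: (@mesh_neighbour_unique _ _ _ _ meshK j false); exists n.
  by apply: flux_eq0 => m e; have /asboolP := h m; apply.
rewrite sumrB; apply/eqP; rewrite subr_eq0; apply/eqP.
rewrite -(eq_bigr _ (fun m _ => out m)) -(eq_bigr _ (fun n _ => inn n)) exchange_big /=.
apply: eq_bigr => n _; apply: eq_bigr => m _; case: ifP => // /asboolP FF.
have [_ /= [ej el]] := face_eq FF.
rewrite /flux; have -> : orect m j = orect n j.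
  by rewrite /orect /oside; have [|-> ->] := el (ordS j);
    [|have [|-> ->] := el (ord_pred j)]; rewrite ?ord3_eq.
apply: eq_Rintegral => u _; rewrite /F /= ej; congr (_ * _).
by apply: (trace_agree k3 tauX tauV tauE tauF i FF); rewrite crd_pt3 eqxx.
Qed.

Lemma int_derive_cancel (dF : 'I_N -> R3 R -> R) : (forall m, continuous (dF m)) ->
  (forall m x, is_derive x (unitv R j) (F m) (dF m x)) ->
  \sum_m \int[leb3 R]_(x in open_cell (K m)) dF m x = 0.
Proof.
move=> cd dP; rewrite -[RHS]flux_cancel; apply: eq_bigr => m _.
rewrite (int_open_cell_derive _ (@F_continuous m) (@cd m) (dP m)) RintegralB//.
- exact: measurable_orect.
- exact: (orect_integrable (K m) _ _ (@flux_continuous m (bnd (K m) j true))).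
- exact: (orect_integrable (K m) _ _ (@flux_continuous m (bnd (K m) j false))).
Qed.

End FaceCancellation.

Let dtau m i j : R3 R -> R := partial j (entry (tau m) i j).

Lemma dtau_continuous m i j : continuous (dtau m i j).
Proof.
have [d tQ] := Xi_entryQ i j (tauX m).
have [g gQ gD] := Q_derive j tQ.
rewrite (_ : dtau m i j = g); first exact: Q_continuous gQ.
by apply/funext => x; rewrite /dtau /partial derive_val.
Qed.

Lemma dtau_is_derive m i j x : is_derive x (unitv R j) (entry (tau m) i j) (dtau m i j x).
Proof.
have [d tQ] := Xi_entryQ i j (tauX m).
by have [g gQ gD] := Q_derive j tQ; apply: derivableP; exact: ex_derive.
Qed.

Definition field : R3 R -> 'M[R]_3 := pcw K tau.

Definition field_div (x : R3 R) : 'rV[R]_3 :=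
  \row_i pcw K (fun m x => \sum_j dtau m i j x) x.

Lemma pcw_mulr (f : 'I_N -> R3 R -> R) (g : R3 R -> R) x :
  pcw K f x * g x = pcw K (fun m => f m \* g) x.
Proof. by rewrite mulr_suml; apply: eq_bigr => m _; case: ifP; rewrite ?mul0r. Qed.

(** By the product rule the two sides differ by the cellwise integrals of the derivatives of
    [tau i j] times [phi]. *)
Lemma field_weak_div : weak_div Omega field field_div.
Proof.
move=> phi phiT i.
have cp := test_continuous phiT; have cdp j := @test_partial_continuous _ _ _ phiT j.
have ct m j : continuous (entry (tau m) i j) by exact: Xi_continuous (tauX m).
pose h1 m x := \sum_j entry (tau m) i j x * partial j phi x.
pose h2 m x := (\sum_j dtau m i j x) * phi x.
have ch1 m : continuous (h1 m).
  by apply: sum_continuous => j; exact: (mulf_continuous (ct m j) (cdp j)).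
have ch2 m : continuous (h2 m).
  apply: (@mulf_continuous _ _ (fun x => \sum_j dtau m i j x)) => //.
  by apply: sum_continuous => j; exact: dtau_continuous.
rewrite (@Rintegral_pcw _ _ K _ h1)//; last 2 first.
- by move=> m x Ox; rewrite /h1 big1// => j _; rewrite (test_partial_outside phiT)// mulr0.
- move=> x _; under eq_bigr do rewrite pcw_entry pcw_mulr.
  by rewrite exchange_big; apply: eq_bigr => m _ /=; case: ifP => // _; rewrite big1.
rewrite (@Rintegral_pcw _ _ K _ h2)//; last 2 first.
- by move=> m x Ox; rewrite /h2 (test_outside phiT)// mulr0.
- by move=> x _; rewrite mxE pcw_mulr.
apply/eqP; rewrite -addr_eq0 -big_split /=; apply/eqP.
pose dF j m x := entry (tau m) i j x * partial j phi x + phi x * dtau m i j x.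
have cdF j m : continuous (dF j m).
  move=> x; apply: cvgD; first exact: (mulf_continuous (ct m j) (cdp j)).
  exact: (mulf_continuous cp (@dtau_continuous m i j)).
transitivity (\sum_m \sum_j \int[leb3 R]_(x in open_cell (K m)) dF j m x).
  apply: eq_bigr => m _; have mo := @measurable_open_cell R (K m).
  rewrite -RintegralD//; [|exact: open_cell_integrable|exact: open_cell_integrable].
  have I j := open_cell_integrable (K m) (@cdF j m).
  rewrite sum3_inord -RintegralD// -RintegralD//; last first.
    have c2 : continuous (fun x => dF (inord 0) m x + dF (inord 1) m x).
      by move=> x; apply: cvgD; exact: cdF.
    exact: open_cell_integrable c2.
  apply: eq_Rintegral => x _; rewrite -[RHS](sum3_inord (fun j => dF j m x)).
  rewrite /h1 /h2 mulr_suml -big_split.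
  by apply: eq_bigr => j _; rewrite /dF [phi x * _]mulrC.
(* Each direction [j] cancels separately, so only the normal components on faces normal to [x_j]
   matter. *)
rewrite exchange_big big1// => j _.
apply: (@int_derive_cancel i j phi cp (fun x => @test_outside _ _ _ phiT x) (dF j)) => // m x.
have D1 := dtau_is_derive m i j x; have D2 := test_is_derive phiT j x.
exact: is_deriveM.
Qed.

Lemma pcw_L2 (f : 'I_N -> R3 R -> R) : (forall m, continuous (f m)) ->
  L2 Omega (pcw K f).
Proof.
move=> cf; rewrite /L2.
have -> : pcw K f \_ Omega = \sum_m (f m \_ (open_cell (K m) `&` Omega)).
  apply/funext => x; rewrite fct_sumE patchE; case: ifPn => xO.
    by apply: eq_bigr => m _; rewrite patchE in_setI xO andbT.
  by rewrite big1// => m _; rewrite patchE in_setI (negbTE xO) andbF.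
have [L0 LD] := @Lfun_addr_closed _ _ _ (leb3 R) 2%:E ltac:(by rewrite lee_fin ler1n).
apply: (big_ind (fun f : M3 R -> R => f \in Lfun (leb3 R) 2%:E) L0 LD) => m _.
apply: (@restrict_L2 _ (K m)) => //.
  apply: measurableI; first exact: measurable_open_cell.
  exact: open_measurable3.
by move=> x [/open_cell_cell].
Qed.

Lemma field_open_cell m x : open_cell (K m) x -> field x = tau m x.
Proof.
move=> xm; have [_ dis _] := meshK.
rewrite /field /pcw (bigD1 m)//= mem_set// big1 ?addr0// => n nm.
case: ifPn => //; rewrite inE => xn.
by have : set0 x by rewrite -(dis _ _ nm).
Qed.

Lemma field_trace x : \tr (field x) = 0.
Proof.
rewrite /field /pcw raddf_sum big1// => m _; case: ifP => // _; last exact: raddf0.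
by case: (tauX m) => t1 _ _; exact: t1.
Qed.

Lemma ae_neq_crd j (c : R) : {ae leb3 R, forall x, crd x j != c}.
Proof.
(* The plane as a product with one degenerate side; zero times infinity is zero, so its measure
   vanishes. *)
pose S l : set R := if l == j then [set c] else setT.
have mS l : @measurable _ (M1 R) (S l).
  by rewrite /S; case: ifP => _ //; exact: measurable_set1.
exists ((S (inord 0) `*` S (inord 1)) `*` S (inord 2)); split.
- by apply: measurableX => //; exact: measurableX.
- have m2 := measurableX (mS (inord 0)) (mS (inord 1)).
  have e2 : leb2 R (S (inord 0) `*` S (inord 1)) =
      (leb1 R (S (inord 0)) * leb1 R (S (inord 1)))%E by exact: product_measure1E.
  transitivity (leb1 R (S (inord 0)) * leb1 R (S (inord 1)) * leb1 R (S (inord 2)))%E.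
    by rewrite -e2; exact: product_measure1E.
  have z : leb1 R [set c] = 0%E by exact: lebesgue_measure_set1.
  by case: (ord3_inord j) => jE; rewrite /S jE !inord_eq eqxx z ?mul0e ?mule0 ?mul0e.
- move=> x /= /negP; rewrite negbK => /eqP xj.
  have Sx l : S l (crd x l) by rewrite /S; case: eqP => [->|].
  by have := Sx (inord 0); have := Sx (inord 1); have := Sx (inord 2); rewrite !crd_inord.
Qed.

(** Away from the finitely many planes that carry the faces, a point of [Omega] lies in an open
    cell, where [v] and [field] agree. *)
Lemma field_Hdiv v : (forall m x, open_cell (K m) x -> v x = tau m x) -> Hdiv Omega v.
Proof.
move=> vtau; exists field, field_div; split.
- have FF : Filter (nbhs (almost_everywhere (leb3 R))).
    exact: (@ae_filter_ringOfSetsType _ (M3 R) R (leb3 R)).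
  have ae : {ae leb3 R, forall x, forall l : 'I_N * 'I_3 * bool,
      crd x l.1.2 != bnd (K l.1.1) l.1.2 l.2}.
    by apply: (@filter_forall _ _ _ _ FF) => l; exact: ae_neq_crd.
  apply: filterS ae => x xl Ox; split; last exact: field_trace.
  have [cO _ _] := meshK.
  have : closure Omega x by exact: subset_closure.
  rewrite cO => -[m _ xm].
  have xo : open_cell (K m) x.
    move=> l; have /andP[h1 h2] := xm l.
    rewrite !lt_neqAle h1 h2 !andbT [lo _ _ == _]eq_sym.
    by apply/andP; split; [exact: (xl (m, l, false))|exact: (xl (m, l, true))].
  by rewrite (field_open_cell xo) (vtau m).
- move=> i j; rewrite (_ : entry field i j = pcw K (fun m => entry (tau m) i j)).
    by apply: pcw_L2 => m; exact: Xi_continuous (tauX m).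
  by apply/funext => x; rewrite /entry pcw_entry.
- move=> i; rewrite (_ : (fun x => _) = pcw K (fun m x => \sum_j dtau m i j x)).
    by apply: pcw_L2 => m; apply: sum_continuous => j; exact: dtau_continuous.
  by apply/funext => x; rewrite mxE.
- exact: field_weak_div.
Qed.

End Divergence.

Theorem proposition3p9 (R : realType) (k : nat) (hk : (3 <= k)%N) :
  (forall (T : cuboid R) (D : dof_choice k T), unisolvent (@Xi R k) (dofs D))
  /\
  (forall (Omega : set (R3 R)) (N : nat) (K : 'I_N -> cuboid R),
     lipschitz_domain Omega -> contractible Omega -> cuboid_mesh Omega K ->
     Xi_h k K `<=` Hdiv Omega).
Proof.
split=> [T D|Omega N K [oO _ _] _ meshK v [tau [tX vtau tV tE tF]]].
  exact: dofs_unisolvent.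
exact: (field_Hdiv hk oO meshK tX tV tE tF vtau).
Qed.
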